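(* Assume $0<q<1$. There is a constant $C>0$ such that the mixed Sobolev inequality $$\eta(v)^2\ge C\left(\int_\Omega|v|^{1-q}\,dx\right)^{\frac{2}{1-q}}$$ is satisfied for every $v\in\mathcal{X}^{1,2}_{\mathcal{D}}(U)$ if and only if the problem $$\mathcal{L}u=u^{-q},\ u>0 \text{ in }\Omega,\qquad u=0\text{ in }U^c,\qquad \mathcal{N}_s(u)=0\text{ in }\mathcal{N},\qquad \frac{\partial u}{\partial\nu}=0\text{ in }\partial\Omega\cap\overline{\mathcal{N}}$$ admits a weak solution in $\mathcal{X}^{1,2}_{\mathcal{D}}(U)$.
   Context: Let $N\ge 3$, $s\in(0,1)$. Let $\Omega\subseteq\mathbb{R}^N$ be a nonempty open set, and let $\mathcal{D},\mathcal{N}$ be open subsets of $\mathbb{R}^N\setminus\overline{\Omega}$ with $\mathcal{D}\cap\mathcal{N}=\emptyset$ and $\mathcal{D}\cup\mathcal{N}=\mathbb{R}^N\setminus\overline{\Omega}$, such that $\Omega\cup\mathcal{N}$ is bounded with smooth boundary. Put $U=\Omega\cup\mathcal{N}\cup(\partial\Omega\cap\overline{\mathcal{N}})$ and $U^c=\mathbb{R}^N\setminus U$; $\nu$ is the outward normal on $\partial\Omega$. Operators: $\mathcal{L}=-\Delta+(-\Delta)^s$ with $(-\Delta)^s$ the fractional Laplacian, and $\mathcal{N}_su(x)=\int_\Omega\frac{u(x)-u(y)}{|x-y|^{N+2s}}\,dy$ for $x\in\mathbb{R}^N\setminus\overline{\Omega}$. (As in the weak formulation below, normalizing constants are omitted.)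 Space: $\mathcal{X}^{1,2}_{\mathcal{D}}(U)=\{u\in H^1(\mathbb{R}^N): u|_U\in H^1_0(U),\ u\equiv0\text{ a.e. in }U^c\}$. With $Q=\mathbb{R}^{2N}\setminus(\Omega^c\times\Omega^c)$, it is normed by $\eta(u)^2=\int_\Omega|\nabla u|^2dx+\int_Q\frac{|u(x)-u(y)|^2}{|x-y|^{N+2s}}dx\,dy$. Weak solution: $u\in\mathcal{X}^{1,2}_{\mathcal{D}}(U)$ with $u>0$ a.e. in $\Omega$ and $$\int_\Omega\nabla u\cdot\nabla\varphi\,dx+\int_Q\frac{(u(x)-u(y))(\varphi(x)-\varphi(y))}{|x-y|^{N+2s}}dx\,dy=\int_\Omega u^{-q}\varphi\,dx\quad\forall\varphi\in C_0^\infty(\Omega).$$ *)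

(* Defs.v *)
From HB Require Import structures.
From mathcomp Require Import all_boot all_order all_algebra.
From mathcomp Require Import all_classical all_reals all_analysis.

Set Implicit Arguments.
Unset Strict Implicit.
Unset Printing Implicit Defensive.

Import Order.TTheory GRing.Theory Num.Theory.
Import numFieldNormedType.Exports.

Local Open Scope classical_set_scope.
Local Open Scope ring_scope.

(** * Lebesgue measure on [R^n] *)

(** [R^n] is ['rV[R]_n] with its canonical topology.  Its sigma-algebra is
    generated by the coordinates, as for [n.-tuple]; it is the Borel one. *)
Definition measure_rV_display : measure_display -> measure_display.
Proof. exact. Qed.

Section measurable_rV.
Context (R : realType) (n : nat).

Definition rV_coord (i : 'I_n) (x : 'rV[R]_n) : R := x ord0 i.

Let rV_set0 : g_sigma_preimage rV_coord set0.
Proof. exact: sigma_algebra0. Qed.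

Let rV_setC A : g_sigma_preimage rV_coord A -> g_sigma_preimage rV_coord (~` A).
Proof. exact: sigma_algebraC. Qed.

Let rV_bigcup (F : _^nat) : (forall i, g_sigma_preimage rV_coord (F i)) ->
  g_sigma_preimage rV_coord (\bigcup_i (F i)).
Proof. exact: sigma_algebra_bigcup. Qed.

HB.instance Definition _ :=
  @isMeasurable.Build (measure_rV_display default_measure_display)
    'rV[R]_n (g_sigma_preimage rV_coord) rV_set0 rV_setC rV_bigcup.

Lemma measurable_rV_coord (i : 'I_n) : measurable_fun [set: 'rV[R]_n] (rV_coord i).
Proof.
move=> _ Y mY; rewrite setTI; apply: sub_sigma_algebra => /=.
rewrite -bigcup_seq/=; exists i => /=; first by rewrite mem_index_enum.
by exists Y => //; rewrite setTI.
Qed.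

Lemma measurable_fun_rVP d (T : measurableType d) (f : T -> 'rV[R]_n) :
  (forall i, measurable_fun [set: T] (rV_coord i \o f)) ->
  measurable_fun [set: T] f.
Proof.
move=> mf.
suff fS : g_sigma_preimage (fun i => rV_coord i \o f) `<=` measurable.
  move=> _ A mA; rewrite setTI; apply: fS.
  by rewrite g_sigma_preimage_comp; exists A => //; rewrite setTI.
apply: smallest_sub; first exact: sigma_algebra_measurable.
rewrite -bigcup_seq /=; apply: bigcup_sub => i _.
by move=> A [B mB <-]; exact: mf.
Qed.

End measurable_rV.

Section cons_rV.
Context (R : realType) (n : nat).

Definition cons_rV (z : R * 'rV[R]_n) : 'rV[R]_n.+1 :=
  \row_i oapp (z.2 ord0) z.1 (unlift ord0 i).

Lemma measurable_cons_rV : measurable_fun setT cons_rV.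
Proof.
apply: measurable_fun_rVP => i.
case: (unliftP ord0 i) => [j|] ->.
- rewrite (_ : _ \o _ = rV_coord j \o snd).
    by apply: measurableT_comp => //; exact: measurable_rV_coord.
  by apply/funext => z; rewrite /= /rV_coord mxE liftK.
- rewrite (_ : _ \o _ = fst)//.
  by apply/funext => z; rewrite /= /rV_coord mxE unlift_none.
Qed.

Variable mu : {sigma_finite_measure set 'rV[R]_n -> \bar R}.

Definition lebesgue_rVS : set 'rV[R]_n.+1 -> \bar R :=
  pushforward (lebesgue_measure \x mu)%E cons_rV.

Let measurable_cons_preimage (A : set 'rV[R]_n.+1) :
  measurable A -> measurable (cons_rV @^-1` A : set (measurableTypeR R * 'rV[R]_n)).
Proof. by move=> mA; rewrite -[X in measurable X]setTI; exact: measurable_cons_rV. Qed.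

Let lebesgue_rVS0 : lebesgue_rVS set0 = 0%E.
Proof. by rewrite /lebesgue_rVS /pushforward preimage_set0 measure0. Qed.

Let lebesgue_rVS_ge0 A : (0 <= lebesgue_rVS A)%E.
Proof. by rewrite /lebesgue_rVS /pushforward; exact: measure_ge0. Qed.

Let lebesgue_rVS_sigma_additive : semi_sigma_additive lebesgue_rVS.
Proof.
move=> F mF tF mUF; rewrite /lebesgue_rVS /pushforward preimage_bigcup.
apply: measure_semi_sigma_additive.
- by move=> k; exact: measurable_cons_preimage.
- apply/trivIsetP => /= i j _ _ ij; rewrite -preimage_setI.
  by move/trivIsetP : tF => /(_ _ _ _ _ ij) ->//; rewrite preimage_set0.
- by rewrite -preimage_bigcup; exact: measurable_cons_preimage.
Qed.

HB.instance Definition _ := isMeasure.Build _ _ _ lebesgue_rVS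
  lebesgue_rVS0 lebesgue_rVS_ge0 lebesgue_rVS_sigma_additive.

Definition uncons_rV (x : 'rV[R]_n.+1) : measurableTypeR R * 'rV[R]_n :=
  (x ord0 ord0, \row_j x ord0 (lift ord0 j)).

Let cons_rVK : cancel cons_rV uncons_rV.
Proof.
move=> [a v]; rewrite /uncons_rV mxE unlift_none; congr pair.
by apply/rowP => j; rewrite !mxE liftK.
Qed.

Let uncons_rVK : cancel uncons_rV cons_rV.
Proof.
move=> x; apply/rowP => i; rewrite mxE.
by case: (unliftP ord0 i) => [j|] -> //=; rewrite mxE.
Qed.

Let measurable_uncons_rV : measurable_fun setT uncons_rV.
Proof.
apply/measurable_fun_pairP; split.
  exact: (@measurable_rV_coord R n.+1 ord0).
apply: measurable_fun_rVP => i.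
rewrite (_ : _ \o _ = rV_coord (lift ord0 i)); first exact: measurable_rV_coord.
by apply/funext => x; rewrite /= /rV_coord mxE.
Qed.

Let lebesgue_rVS_sigma_finite : sigma_finite setT lebesgue_rVS.
Proof.
have /sigma_finiteP[F [TF ndF Foo]] := sigma_finiteT (@lebesgue_measure R).
have /sigma_finiteP[G [TG ndG Goo]] := sigma_finiteT mu.
exists (fun k => uncons_rV @^-1` (F k `*` G k)).
  rewrite -preimage_bigcup (_ : \bigcup_k _ = setT) ?preimage_setT//.
  rewrite -setXTT TF TG; apply/seteqP; split=> -[x y].
    by move=> [k _ []/= ? ?]; split; exists k.
  move=> [/= [k _ Fkx] [l _ Gly]]; exists (maxn k l) => //; split.
  - by move: x Fkx; exact/subsetPset/ndF/leq_maxl.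
  - by move: y Gly; exact/subsetPset/ndG/leq_maxr.
move=> k; have [? ?] := Foo k; have [? ?] := Goo k; split.
  rewrite -[X in measurable X]setTI; apply: measurable_uncons_rV => //.
  exact: measurableX.
rewrite /lebesgue_rVS /pushforward (_ : _ @^-1` _ = F k `*` G k).
  by rewrite product_measure1E// lte_mul_pinfty// ge0_fin_numE.
by apply/funext => z; rewrite /preimage /mkset cons_rVK.
Qed.

HB.instance Definition _ := Measure_isSigmaFinite.Build _ _ _ lebesgue_rVS
  lebesgue_rVS_sigma_finite.

End cons_rV.

(** [R^0] is a point, and [R^(n+1)] is [R * R^n] through [cons_rV]. *)
Fixpoint lebesgue_rV (R : realType) (n : nat) :
    {sigma_finite_measure set 'rV[R]_n -> \bar R} :=
  if n is m.+1 then lebesgue_rVS (lebesgue_rV R m)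
  else \d_(0 : 'rV[R]_0).

Section pde.
Context {R : realType} {n : nat}.
Implicit Types (U A Om Nn : set 'rV[R]_n) (u v g phi psi : 'rV[R]_n -> R).
Implicit Types (i : 'I_n) (s q : R).

Local Notation mu := (lebesgue_rV R n).

(** Euclidean norm; the canonical norm of ['rV[R]_n] is the sup norm. *)
Definition enorm (x : 'rV[R]_n) : R := Num.sqrt (\sum_i x ord0 i ^+ 2).

Definition boundary A : set 'rV[R]_n := closure A `\` interior A.

(** * Smooth functions *)

Definition basis_rV i : 'rV[R]_n := delta_mx ord0 i.

Definition pderiv i u : 'rV[R]_n -> R := fun x => 'D_(basis_rV i) u x.

Definition smooth u : Prop := forall l : seq 'I_n,
  continuous (foldr pderiv u l) /\
  forall i x, derivable (foldr pderiv u l) x (basis_rV i).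

Definition tsupport u : set 'rV[R]_n := closure [set x | u x != 0].

(** [C_0^oo(U)] *)
Definition test_function U : set ('rV[R]_n -> R) :=
  [set phi | [/\ smooth phi, compact (tsupport phi) & tsupport phi `<=` U]].

(** The boundary of [A] is a smooth embedded hypersurface: around each of its
    points it is a regular level set.  [A] is not required to lie locally on one
    side of its boundary, so that two pieces of [A] may touch along it. *)
Definition smooth_boundary A : Prop := forall p, boundary A p ->
  exists V : set 'rV[R]_n, exists psi : 'rV[R]_n -> R,
    [/\ open V, V p, smooth psi,
        forall x, V x -> exists i, pderiv i psi x != 0 &
        V `&` boundary A = V `&` [set x | psi x = 0]].

(** * Sobolev spaces
    Functions stand for their classes modulo null sets.  *)

Definition L2 U u : Prop :=
  measurable_fun U u /\ (\int[mu]_(x in U) (u x ^+ 2)%:E < +oo)%E.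

Definition is_weak_pderiv U i u g : Prop := forall phi, test_function U phi ->
  (\int[mu]_(x in U) (u x * pderiv i phi x)%:E
   = - \int[mu]_(x in U) (g x * phi x)%:E)%E.

Definition H1 U u : Prop :=
  L2 U u /\ forall i, exists2 g, L2 U g & is_weak_pderiv U i u g.

(** A representative of the weak derivative, which is unique up to null sets. *)
Definition weak_pderiv U i u : 'rV[R]_n -> R :=
  xget (cst 0) [set g | L2 U g /\ is_weak_pderiv U i u g].

Definition H1_normsq U u : \bar R :=
  (\int[mu]_(x in U) (u x ^+ 2 + \sum_i weak_pderiv U i u x ^+ 2)%:E)%E.

(** [H^1_0(U)], the closure of [C_0^oo(U)] in [H^1(U)]; it only depends on the
    restriction of [u] to [U]. *)
Definition H10 U u : Prop := H1 U u /\
  exists2 phi : nat -> 'rV[R]_n -> R, (forall k, test_function U (phi k)) &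
    H1_normsq U (u \- phi k) @[k --> \oo] --> 0%E.

(** * The mixed local-nonlocal problem *)

Definition mixed_domain Om Nn : set 'rV[R]_n :=
  Om `|` Nn `|` (boundary Om `&` closure Nn).

Definition X12 U u : Prop :=
  [/\ H1 setT u, H10 U u & {ae mu, forall x, (~` U) x -> u x = 0}].

Definition Qset Om : set ('rV[R]_n * 'rV[R]_n) := setT `\` (~` Om `*` ~` Om).

Definition energy s Om u v : \bar R :=
  (\int[mu]_(x in Om) (\sum_i weak_pderiv setT i u x * weak_pderiv setT i v x)%:E
   + \int[mu \x mu]_(z in Qset Om)
       ((u z.1 - u z.2) * (v z.1 - v z.2)
        / enorm (z.1 - z.2) `^ (n%:R + 2 * s))%:E)%E.

(** [eta(u)^2] *)
Definition eta_sq s Om u : \bar R := energy s Om u u.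

Definition mixed_sobolev s q Om Nn : Prop :=
  exists2 C : R, 0 < C & forall v, X12 (mixed_domain Om Nn) v ->
    (C%:E * (\int[mu]_(x in Om) (`|v x| `^ (1 - q))%:E) `^ (2 / (1 - q))
     <= eta_sq s Om v)%E.

(** The integral being total, the integrability that is implicit in
    the right-hand side is required explicitly.  On the left-hand side it is
    automatic for [u] and [phi] in [H^1(R^n)]. *)
Definition weak_solution s q Om Nn u : Prop :=
  [/\ X12 (mixed_domain Om Nn) u,
      {ae mu, forall x, Om x -> 0 < u x} &
      forall phi, test_function Om phi ->
        mu.-integrable Om (fun x => (u x `^ (- q) * phi x)%:E) /\
        energy s Om u phi = (\int[mu]_(x in Om) (u x `^ (- q) * phi x)%:E)%E].

End pde.

(* Main.v *)
Require Import Defs.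
From HB Require Import structures.
From mathcomp Require Import all_boot all_order all_algebra.
From mathcomp Require Import all_classical all_reals all_analysis.
From mathcomp Require Import measurable_realfun.
From mathcomp Require Import ring lra.

Set Implicit Arguments.
Unset Strict Implicit.
Unset Printing Implicit Defensive.

Import Order.TTheory GRing.Theory Num.Theory.
Import numFieldNormedType.Exports.

Local Open Scope classical_set_scope.
Local Open Scope ring_scope.

(** Both sides of the equivalence hold, so that each is proved outright.

    The Sobolev inequality.  A function of the space vanishes off a bounded set,
    and [Qset Om] contains the product of [Om] with a cube [B] that lies far away.
    On [Om * B] the difference [v x - v y] is just [v x] and the kernel is bounded
    below, so the nonlocal part of the energy alone dominates the square of the
    [L2(Om)] norm ([nonlocal_poincare]).  Since [Om] has finite measure and
    [1 - q < 2], the integral of [|v|^(1-q)] is controlled by that norm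
    ([mixed_sobolev_holds]).

    Existence.  The equation is only tested with functions supported in [Om], so
    it can be solved by a function [u] that vanishes off [Om].  Put [p = 1 - q] and
    minimise [J(phi) = E(phi, phi) / 2 - int_Om phi^p / p], [E] being the energy,
    over the convex cone of nonnegative test functions, on which all the
    derivatives are classical.  [J] is bounded below by the Poincare inequality,
    and uniformly convex because [E] is quadratic and [t^p] concave; hence a
    sequence with [J(u_k) <= inf J + 4^-k] is Cauchy for the energy
    ([minimizing_cauchy]).  Its speed gives a limit [u] almost everywhere without
    extracting a subsequence ([rapidly_cauchy_limit]), and [u] lies in the space
    ([limit_X12]).

    The Euler-Lagrange equation is read off the approximants, [J] not being
    differentiable.  Moving from [u_k] to [u_k + 2^-k w] lowers [J] by at most [4^-k],
    which gives [int u^(-q) w <= E(u, w)] in the limit by Fatou's lemma; the left-hand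
    side would be infinite if [u] vanished on a set of positive measure, whence
    [u > 0] ([lower_limit], [limit_gt0]).  For the opposite inequality one has to
    decrease [u_k] while staying in the cone: the direction
    [- phi * u_k / (u_k + d)] does, and it replaces [phi] up to errors carrying the
    factor [d / (u_k + d)], which disappear as [d] tends to 0 because [u > 0]
    ([trunc_test_lower], [upper_inequality]).  Signed test functions are differences
    of nonnegative ones ([test_dominated]).

    What remains is calculus on [R^n]: translation invariance and Borel
    measurability, smooth bumps, integration by parts, uniqueness of weak
    derivatives, which identifies the representatives chosen by [weak_pderiv], the
    negligibility of a smooth hypersurface, and the finiteness of the Gagliardo
    energy of a test function. *)

(** * Lebesgue measure on [R^n]: translations, boxes, Borel sets *)

Section translation_1d.
Context {R : realType}.

Lemma lebesgue_measure_translate (a : R) (A : set (measurableTypeR R)) :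
  measurable A ->
  pushforward lebesgue_measure (fun x : measurableTypeR R => x + a : measurableTypeR R) A
  = lebesgue_measure A.
Proof.
move=> mA; have mf : measurable_fun setT (fun x : measurableTypeR R => x + a : measurableTypeR R).
  by apply: measurable_funD => //; exact: measurable_cst.
apply/esym/lebesgue_measure_unique => //= _ [[u v]] _ <-.
rewrite /pushforward (_ : _ @^-1` _ = `]u - a, v - a]%classic).
  rewrite !lebesgue_measure_itv/= !lte_fin ltrD2r; case: ifP => // _.
  by rewrite -!EFinD; congr EFin; ring.
by apply/seteqP; split => x /=; rewrite !in_itv/= ltrBlDr lerBrDr.
Qed.

End translation_1d.

Section translation.
Context {R : realType}.

Lemma measurable_translate_rV n (v : 'rV[R]_n) :
  measurable_fun setT (fun x : 'rV[R]_n => x + v).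
Proof.
apply: measurable_fun_rVP => i.
rewrite (_ : _ \o _ = (fun x => rV_coord i x + v ord0 i)).
  by apply: measurable_funD => //; exact: measurable_rV_coord.
by apply/funext => x; rewrite /= /rV_coord mxE.
Qed.

(** By Fubini, translating the first coordinate and translating the other ones are
    dealt with separately. *)
Lemma lebesgue_rV_translate n (v : 'rV[R]_n) (A : set 'rV[R]_n) : measurable A ->
  pushforward (lebesgue_rV R n) (fun x => x + v) A = lebesgue_rV R n A.
Proof.
elim: n v A => [|n IHn] v A mA.
  by rewrite /pushforward; congr (_ _); apply/funext => x; rewrite /preimage /= (thinmx0 v) addr0.
rewrite /= /lebesgue_rVS /pushforward.
pose B := (@cons_rV R n @^-1` A).
have mB : measurable (B : set (measurableTypeR R * _)).
  by rewrite -[X in measurable X]setTI; exact: measurable_cons_rV.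
pose v' := \row_j v ord0 (lift ord0 j).
rewrite /product_measure1.
set f := fun t : measurableTypeR R => lebesgue_rV R n (xsection B t).
transitivity (\int[@lebesgue_measure R]_t f ((t : R) + v ord0 ord0)%R)%E.
  apply: eq_integral => t _ /=.
  rewrite /f -[in RHS](IHn v'); last exact: measurable_xsection.
  rewrite /pushforward; congr (lebesgue_rV _ _ _).
  apply/seteqP; split => x /=; rewrite /xsection/= !inE /B /preimage/= /mkset;
    (suff -> : cons_rV (t, x) + v = cons_rV (t + v ord0 ord0, x + v') by []);
    apply/rowP => i; rewrite !mxE;
    by case: (unliftP ord0 i) => [j|] -> /=; rewrite ?mxE.
have mf : measurable_fun setT f by exact: measurable_fun_xsection.
have mt : measurable_fun setT (fun x : measurableTypeR R => x + v ord0 ord0 : measurableTypeR R).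
  by apply: measurable_funD => //; exact: measurable_cst.
have := @ge0_integral_pushforward _ _ _ _ R _ mt lebesgue_measure setT f measurableT mf.
rewrite preimage_setT => /(_ (fun _ _ => measure_ge0 _ _)) <-.
apply: eq_measure_integral => C mC _.
exact: lebesgue_measure_translate.
Qed.

Lemma ge0_integral_translate n (v : 'rV[R]_n) (f : 'rV[R]_n -> \bar R) :
  measurable_fun setT f -> (forall x, 0 <= f x)%E ->
  (\int[lebesgue_rV R n]_x f (x + v)%R = \int[lebesgue_rV R n]_x f x)%E.
Proof.
move=> mf f0.
have := @ge0_integral_pushforward _ _ _ _ R _ (measurable_translate_rV v) (lebesgue_rV R n) setT f measurableT mf.
rewrite preimage_setT => /(_ (fun x _ => f0 x)) <-.
apply: eq_measure_integral => [|? C mC _]; first exact: measurable_translate_rV.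
exact: lebesgue_rV_translate.
Qed.

Lemma integral_translate n (v : 'rV[R]_n) (f : 'rV[R]_n -> \bar R) :
  measurable_fun setT f ->
  (\int[lebesgue_rV R n]_x f (x + v)%R = \int[lebesgue_rV R n]_x f x)%E.
Proof.
move=> mf; rewrite integralE [RHS]integralE; congr (_ - _)%E.
- rewrite -(@ge0_integral_translate n v (f^\+)%E)//; last exact: measurable_funepos.
  by apply: eq_integral => x _; rewrite !funeposE.
- rewrite -(@ge0_integral_translate n v (f^\-)%E)//; last exact: measurable_funeneg.
  by apply: eq_integral => x _; rewrite !funenegE.
Qed.

End translation.

Section boxes.
Context {R : realType}.

Definition box_rV n (a b : 'rV[R]_n) : set 'rV[R]_n :=
  [set x | forall i, a ord0 i < x ord0 i < b ord0 i].

Lemma measurable_box_rV n (a b : 'rV[R]_n) : measurable (box_rV a b).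
Proof.
rewrite (_ : box_rV a b = \bigcap_i (rV_coord i @^-1` `]a ord0 i, b ord0 i[)).
  apply: fin_bigcap_measurable => // i _.
  by rewrite -[X in measurable X]setTI; exact: measurable_rV_coord.
by apply/seteqP; split => x /= H i => [_|]; move: (H i); rewrite /= in_itv//=; exact.
Qed.

Lemma lebesgue_box_rV n (a b : 'rV[R]_n) : (forall i, a ord0 i <= b ord0 i) ->
  lebesgue_rV R n (box_rV a b) = (\prod_i (b ord0 i - a ord0 i))%:E.
Proof.
elim: n a b => [|n IHn] a b ab.
  rewrite /= big_ord0 diracE mem_set// => i; exact: (False_ind _ (notF (ltn_ord i))).
rewrite /= /lebesgue_rVS /pushforward.
pose a' := \row_j a ord0 (lift ord0 j).
pose b' := \row_j b ord0 (lift ord0 j).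
rewrite (_ : _ @^-1` _ = `]a ord0 ord0, b ord0 ord0[%classic `*` box_rV a' b'); last first.
  apply/seteqP; split => -[t x]; rewrite /preimage /box_rV /mkset/=.
    move=> H; split; first by have := H ord0; rewrite mxE unlift_none/= in_itv.
    by move=> i; have := H (lift ord0 i); rewrite !mxE liftK.
  move=> [+ H] i; rewrite in_itv/= mxE => H0.
  by case: (unliftP ord0 i) => [j|] -> //=; have := H j; rewrite !mxE.
rewrite product_measure1E//; last exact: measurable_box_rV.
rewrite IHn; last by move=> i; rewrite !mxE.
rewrite [X in (X * _)%E](lebesgue_measure_itv `]a ord0 ord0, b ord0 ord0[)/= lte_fin big_ord_recl.
rewrite (_ : \prod_i (b' ord0 i - a' ord0 i) = \prod_(i < n) (b ord0 (lift ord0 i) - a ord0 (lift ord0 i))); last first.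
  by apply: eq_bigr => i _; rewrite !mxE.
case: ifPn => [_|]; first by rewrite -EFinB -EFinM.
rewrite -leNgt => ba; rewrite mul0e.
have -> : b ord0 ord0 = a ord0 ord0 by apply/le_anti; rewrite ba ab.
by rewrite subrr mul0r.
Qed.

(** For [r > 0] this is the ball of the sup norm, presented as a box so that its
    measure is a product. *)
Definition cube_rV n (c : 'rV[R]_n) (r : R) : set 'rV[R]_n :=
  box_rV (\row_i (c ord0 i - r)) (\row_i (c ord0 i + r)).

Lemma cube_rVE n (c : 'rV[R]_n) r x : cube_rV c r x <-> forall i, `|x ord0 i - c ord0 i| < r.
Proof.
split=> H i; have := H i; rewrite !mxE ltr_distl.
  by case/andP => -> ->.
by case/andP => -> ->.
Qed.

Lemma cube_rV_ball n (c : 'rV[R]_n) r : 0 < r -> cube_rV c r = ball c r.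
Proof.
move=> r0; apply/seteqP; split => x.
  move/cube_rVE => H; split => // i j; rewrite (ord1 i) -ball_normE/= /ball_/= distrC; exact: H.
move=> -[_ H]; apply/cube_rVE => i.
by have := H ord0 i; rewrite -ball_normE/= /ball_/= distrC.
Qed.

Lemma lebesgue_cube_rV n (c : 'rV[R]_n) r : 0 <= r ->
  lebesgue_rV R n (cube_rV c r) = ((r *+ 2) ^+ n)%:E.
Proof.
move=> r0; rewrite lebesgue_box_rV; last first.
  by move=> i; rewrite !mxE lerD2l ge0_cp.
congr EFin; rewrite (eq_bigr (fun=> r *+ 2)); first by rewrite prodr_const card_ord.
by move=> i _; rewrite !mxE mulr2n; ring.
Qed.

(** Countably many cubes suffice to describe the open sets.  The doubled cube is asked
    to lie in [V] because the small one is later used with a margin around it. *)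
Lemma rational_cube_base n (V : set 'rV[R]_n) (p : 'rV[R]_n) : open V -> V p ->
  exists (c : 'rV[rat]_n) (k : nat),
    [/\ cube_rV (map_mx ratr c) k.+1%:R^-1 p &
        cube_rV (map_mx ratr c) (2 * k.+1%:R^-1) `<=` V].
Proof.
move=> oV Vp; have [e e0 eV] : exists2 e : R, 0 < e & ball p e `<=` V.
  by have /nbhs_ballP[e /= e0 eV] : nbhs p V by [exact: open_nbhs_nbhs]; exists e.
(* [3 r], with [r = 1 / (k + 1)]: the centre is within [r] of [p], and the doubled cube within [2 r] of the centre. *)
have [k ke] : exists k : nat, 3 * k.+1%:R^-1 < e.
  have e30 : 0 < e / 3 by rewrite divr_gt0.
  near \oo => k; exists k.
  rewrite mulrC -ltr_pdivlMr//.
  by near: k; exact: near_infty_natSinv_lt (PosNum e30).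
have k0 : 0 < k.+1%:R^-1 :> R by rewrite invr_gt0.
set r := k.+1%:R^-1 in ke k0 *.
have /choice[c cP] i : exists c : rat, `|p ord0 i - ratr c| < r.
  have [|c] := rat_in_itvoo (x := p ord0 i - r) (y := p ord0 i + r).
    by rewrite ltrD2l gtrN.
  rewrite in_itv/= => /andP[h1 h2]; exists c.
  by rewrite distrC ltr_distl h1 h2.
exists (\row_i c i), k; split.
  by apply/cube_rVE => i; rewrite !mxE; exact: cP.
move=> x /cube_rVE xc; apply: eV.
rewrite -cube_rV_ball//; apply/cube_rVE => i.
have := xc i; have := cP i; rewrite !mxE => h1 h2.
rewrite -(subrKA (ratr (c i))) (le_lt_trans (ler_normD _ _))//.
rewrite [X in _ + X]distrC; apply: (lt_trans (ltrD h2 h1)).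
rewrite (le_lt_trans _ ke)// -/r; lra.
Unshelve. all: by end_near. Qed.

Definition boxes n : set (set 'rV[R]_n) := [set A | exists a b, A = box_rV a b].

Lemma box_rVI n (a b a' b' : 'rV[R]_n) : box_rV a b `&` box_rV a' b' =
  box_rV (\row_i Num.max (a ord0 i) (a' ord0 i)) (\row_i Num.min (b ord0 i) (b' ord0 i)).
Proof.
apply/seteqP; split => x.
  move=> [H H'] i; rewrite !mxE gt_max lt_min.
  by have /andP[-> ->] := H i; have /andP[-> ->] := H' i.
by move=> H; split => i; have := H i; rewrite !mxE gt_max lt_min => /andP[/andP[? ?] /andP[? ?]];
  apply/andP.
Qed.

Lemma boxes_setI_closed n : setI_closed (@boxes n).
Proof. by move=> _ _ [a [b ->]] [a' [b' ->]]; rewrite box_rVI; do 2 eexists. Qed.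

Lemma open_sigma_boxes n (V : set 'rV[R]_n) : open V -> <<s @boxes n >> V.
Proof.
move=> oV.
pose F (z : 'rV[rat]_n * nat) : set (g_sigma_algebraType (@boxes n)) :=
  if `[< cube_rV (map_mx ratr z.1) (2 * z.2.+1%:R^-1) `<=` V >]
  then cube_rV (map_mx ratr z.1) z.2.+1%:R^-1 else set0.
have -> : V = \bigcup_z F z.
  apply/seteqP; split => x.
    move=> Vx; have [c [k [cx cV]]] := rational_cube_base oV Vx.
    by exists (c, k) => //; rewrite /F/= asboolT.
  move=> [z _]; rewrite /F; case: asboolP => // zV zx; apply: zV.
  apply/cube_rVE => i; have /cube_rVE/(_ i) := zx => /lt_le_trans; apply.
  by rewrite ler_peMl ?invr_ge0// ler1n.
apply: (@countable_bigcupT_measurable _ (g_sigma_algebraType (@boxes n))) => [|z]; first exact: countableP.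
rewrite /F; case: ifPn => _; last exact: measurable0.
by apply: sub_sigma_algebra; do 2 eexists.
Qed.

Lemma open_measurable_rV n (V : set 'rV[R]_n) : open V -> measurable V.
Proof.
move/open_sigma_boxes; apply: smallest_sub V; first exact: sigma_algebra_measurable.
by move=> _ [a [b ->]]; exact: measurable_box_rV.
Qed.

Lemma closed_measurable_rV n (V : set 'rV[R]_n) : closed V -> measurable V.
Proof.
by move=> cV; rewrite -[V]setCK; apply: measurableC; apply: open_measurable_rV; exact: closed_openC.
Qed.

Lemma continuous_measurable_rV n (f : 'rV[R]_n -> R) :
  continuous f -> measurable_fun setT f.
Proof.
move=> cf; apply: (measurability _ (RGenOInfty.measurableE R)).
move=> _ [_ [a ->] <-]; rewrite setTI; apply: open_measurable_rV.
apply: open_comp; first by move=> + _; exact: cf.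
by rewrite set_itvE; exact: open_gt.
Qed.

End boxes.

(** * Smooth functions *)

Section smooth_closure.
Context {R : realType} {n : nat}.
Implicit Types (u v : 'rV[R]_n -> R) (i : 'I_n).

(** [smooth] quantifies over lists of derivatives, which is awkward for the product and
    inverse rules; this form is suited to induction on the order. *)
Fixpoint Ck k u : Prop :=
  continuous u /\
  if k is m.+1 then forall i, (forall x, derivable u x (basis_rV i)) /\ Ck m (pderiv i u)
  else True.

Lemma smooth_pderiv i u : smooth u -> smooth (pderiv i u).
Proof. by move=> su l; have := su (rcons l i); rewrite foldr_rcons. Qed.

Lemma smoothP u : smooth u <-> forall k, Ck k u.
Proof.
split=> [su k|Cu l].
  elim: k u su => [|k IHk] u su /=; split => //; try exact: (su [::]).1.
  by move=> i; split; [exact: (su [::]).2|exact/IHk/smooth_pderiv].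
elim/last_ind: l u Cu => [|l i IHl] u Cu.
  by split; [exact: (Cu 0%N).1|move=> i; exact: ((Cu 1%N).2 i).1].
by rewrite foldr_rcons; apply: IHl => k; exact: ((Cu k.+1).2 i).2.
Qed.

Lemma Ck_le k u : Ck k.+1 u -> Ck k u.
Proof.
elim: k u => [|k IHk] u [cu du]; split => // i.
by split; [exact: (du i).1|exact/IHk/(du i).2].
Qed.

Lemma pderiv_cst i (c : R) : pderiv i (fun=> c : R) = fun=> 0.
Proof. by apply/funext => x; rewrite /pderiv derive_cst. Qed.

Lemma Ck_cst k (c : R) : Ck k (fun=> c).
Proof.
elim: k c => [|k IHk] c /=; split => //; try exact: cst_continuous.
by move=> i; split => [x|]; [exact: derivable_cst|rewrite pderiv_cst].
Qed.

Lemma CkD k u v : Ck k u -> Ck k v -> Ck k (u \+ v).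
Proof.
elim: k u v => [|k IHk] u v Cu Cv.
  by split => // x; apply: continuousD; [exact: Cu.1|exact: Cv.1].
split => [x|i]; first by apply: continuousD; [exact: Cu.1|exact: Cv.1].
have [du Cdu] := Cu.2 i; have [dv Cdv] := Cv.2 i.
split => [x|]; first exact: derivableD.
rewrite (_ : pderiv i _ = pderiv i u \+ pderiv i v); first exact: IHk.
by apply/funext => x; rewrite /pderiv deriveD.
Qed.

Lemma pderivM i u v : (forall x, derivable u x (basis_rV i)) ->
  (forall x, derivable v x (basis_rV i)) ->
  pderiv i (u \* v) = (pderiv i u \* v) \+ (u \* pderiv i v).
Proof.
move=> du dv; apply/funext => x.
by rewrite /pderiv deriveM//= addrC; congr (_ + _); rewrite mulrC.
Qed.

Lemma CkM k u v : Ck k u -> Ck k v -> Ck k (u \* v).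
Proof.
elim: k u v => [|k IHk] u v Cu Cv.
  by split => // x; apply: continuousM; [exact: Cu.1|exact: Cv.1].
split => [x|i]; first by apply: continuousM; [exact: Cu.1|exact: Cv.1].
have [du Cdu] := Cu.2 i; have [dv Cdv] := Cv.2 i.
split => [x|]; first exact: derivableM.
rewrite pderivM//; apply: CkD; apply: IHk => //; exact: Ck_le.
Qed.

Lemma pderivV i u : (forall x, u x != 0) ->
  (forall x, derivable u x (basis_rV i)) ->
  pderiv i (fun x => (u x)^-1) =
  ((fun=> -1) \* ((fun x => (u x)^-1) \* (fun x => (u x)^-1))) \* pderiv i u.
Proof.
move=> u0 du; apply/funext => x.
by rewrite /pderiv deriveV//= mulN1r expr2 invfM.
Qed.

Lemma CkV k u : (forall x, u x != 0) -> Ck k u -> Ck k (fun x => (u x)^-1).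
Proof.
move=> u0; have cV : continuous u -> continuous (fun x => (u x)^-1).
  by move=> cu x; apply: continuousV => //; exact: cu.
elim: k => [|k IHk] Cu; split => //; try exact/cV/Cu.1.
move=> i; have [du Cdu] := Cu.2 i.
split => [x|]; first exact: derivableV.
rewrite pderivV//; have CV := IHk (Ck_le Cu).
by apply: CkM => //; apply: CkM; [exact: Ck_cst|exact: CkM].
Qed.

Lemma smooth_cst (c : R) : smooth ((fun=> c) : 'rV[R]_n -> R).
Proof. by apply/smoothP => k; exact: Ck_cst. Qed.

Lemma smoothD u v : smooth u -> smooth v -> smooth (u \+ v).
Proof. by move=> /smoothP su /smoothP sv; apply/smoothP => k; exact: CkD. Qed.

Lemma smoothM u v : smooth u -> smooth v -> smooth (u \* v).
Proof. by move=> /smoothP su /smoothP sv; apply/smoothP => k; exact: CkM. Qed.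

Lemma smoothV u : (forall x, u x != 0) -> smooth u -> smooth (fun x => (u x)^-1).
Proof. by move=> u0 /smoothP su; apply/smoothP => k; exact: CkV. Qed.

Lemma smooth_continuous u : smooth u -> continuous u.
Proof. by move=> su; exact: (su [::]).1. Qed.

Lemma smooth_derivable u i x : smooth u -> derivable u x (basis_rV i).
Proof. by move=> su; exact: (su [::]).2. Qed.

Lemma smooth_prod (I : Type) (r : seq I) (F : I -> 'rV[R]_n -> R) :
  (forall j, smooth (F j)) -> smooth (fun x => \prod_(j <- r) F j x).
Proof.
move=> sF; elim: r => [|j r IHr].
  by under eq_fun do rewrite big_nil; exact: smooth_cst.
by under eq_fun do rewrite big_cons; exact: smoothM.
Qed.

End smooth_closure.

Section line_derivative.
Context {R : realType} {n : nat}.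

Lemma is_derive_line (f : 'rV[R]_n -> R) (x v : 'rV[R]_n) (t d : R) :
  is_derive (t *: v + x) v f d <-> is_derive t (1 : R) (fun s : R => f (s *: v + x)) d.
Proof.
have E : (fun h : R => h^-1 *: ((f \o shift (t *: v + x)) (h *: v) - f (t *: v + x)))
  = (fun h : R => h^-1 *: (((fun s : R => f (s *: v + x)) \o shift t) (h *: (1 : R)) - f (t *: v + x))).
  apply/funext => h /=; congr (_ *: (f _ - _)).
  by rewrite addrA -scalerDl /GRing.scale/= mulr1.
by split => -[D1 D2]; split; move: D1 D2; rewrite /derivable /derive E.
Qed.

Lemma pderiv_line (f : 'rV[R]_n -> R) i (x : 'rV[R]_n) (t : R) :
  smooth f -> is_derive t (1 : R) (fun s : R => f (s *: basis_rV i + x))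
    (pderiv i f (t *: basis_rV i + x)).
Proof.
move=> sf; apply/is_derive_line; apply: DeriveDef => //.
exact: smooth_derivable.
Qed.

Lemma smooth_line_continuous (f : 'rV[R]_n -> R) (x v : 'rV[R]_n) :
  smooth f -> continuous (fun s : R => f (s *: v + x)).
Proof.
move=> /smooth_continuous cf t.
apply: (@continuous_comp _ _ _ (fun s : R => s *: v + x) f); last exact: cf.
by apply: continuousD; [exact: scalel_continuous|exact: cst_continuous].
Qed.

Lemma smooth_MVT (f : 'rV[R]_n -> R) i (x : 'rV[R]_n) (t : R) : smooth f ->
  exists2 c : R, `|c| <= `|t| &
    f (t *: basis_rV i + x) - f x = t * pderiv i f (c *: basis_rV i + x).
Proof.
move=> sf; set g := fun s : R => f (s *: basis_rV i + x).
have g0 : g 0 = f x by rewrite /g scale0r add0r.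
rewrite -g0 -/(g t).
have dg s : is_derive s (1 : R) g (pderiv i f (s *: basis_rV i + x)).
  exact: pderiv_line.
have cg : continuous g by exact: smooth_line_continuous.
have [t0|t0|->] := ltgtP t 0; last by exists 0; rewrite ?subrr ?mul0r.
- have [|c + E] := MVT t0 (fun s _ => dg s).
    exact: continuous_subspaceT.
  rewrite in_itv/= => /andP[tc c0].
  exists c; first by rewrite !ltr0_norm// lerN2 ltW.
  by rewrite -[LHS]opprB E; ring.
- have [|c + E] := MVT t0 (fun s _ => dg s).
    exact: continuous_subspaceT.
  rewrite in_itv/= => /andP[c0 ct].
  exists c; first by rewrite !gtr0_norm// ltW.
  by rewrite E; ring.
Qed.

End line_derivative.

(** * Smooth bumps supported in boxes *)

Section flat_functions.
Context {R : realType}.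

(** [t^-k * exp(-1/t)], extended by 0 to [t <= 0]: a family that is stable, up to linear
    combinations, under differentiation. *)
Definition flat k (t : R) : R := if 0 < t then t^-1 ^+ k * expR (- t^-1) else 0.

Lemma flat_ge0 k t : 0 <= flat k t.
Proof.
by rewrite /flat; case: ifPn => // t0; rewrite mulr_ge0 ?expR_ge0// exprn_ge0// invr_ge0 ltW.
Qed.

Lemma flat_gt0 k t : 0 < t -> 0 < flat k t.
Proof. by move=> t0; rewrite /flat t0 mulr_gt0 ?expR_gt0// exprn_gt0// invr_gt0. Qed.

Lemma flat_le0 k t : t <= 0 -> flat k t = 0.
Proof. by rewrite /flat ltNge => ->. Qed.

Lemma flat0_le1 t : flat 0 t <= 1.
Proof.
rewrite /flat; case: ifPn => // t0.
by rewrite expr0 mul1r -expR0 ler_expR oppr_le0 invr_ge0 ltW.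
Qed.

Lemma expRN_power_bound m (x : R) : 0 <= x -> x ^+ m * expR (- x) <= (m%:R) ^+ m.
Proof.
move=> x0; case: m => [|m]; first by rewrite !expr0 mul1r -expR0 ler_expR oppr_le0.
have m0 : 0 < m.+1%:R :> R by [].
rewrite expRN ler_pdivrMr ?expR_gt0//.
have {1}-> : expR x = expR (x / m.+1%:R) ^+ m.+1.
  by rewrite -expRM_natl mulrC divfK ?gt_eqF.
rewrite -exprMn lerXn2r ?nnegrE ?mulr_ge0 ?expR_ge0//.
rewrite mulrC -ler_pdivrMr// (le_trans _ (expR_ge1Dx _))//.
by rewrite lerDr.
Qed.

(** The exponential beats every power; this gives the derivative at 0. *)
Lemma flat_bound k t : flat k t <= (k.+1%:R) ^+ k.+1 * `|t|.
Proof.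
have [t0|t0] := leP t 0; first by rewrite flat_le0// mulr_ge0// exprn_ge0.
rewrite /flat t0 (gtr0_norm t0) -ler_pdivrMr//.
have := @expRN_power_bound k.+1 t^-1; rewrite invr_ge0 ltW// => /(_ isT); apply: le_trans.
by rewrite exprSr mulrAC.
Qed.

Lemma is_derive_flat k t :
  is_derive t (1 : R) (flat k) (flat k.+2 t - k%:R * flat k.+1 t).
Proof.
have [t0|t0|->] := ltgtP t 0.
- rewrite !flat_le0 ?ltW// mulr0 subrr.
  apply: (@near_eq_is_derive R R R (cst 0)).
  near=> s; rewrite flat_le0//= ltW//.
  by near: s; exact: lt_nbhsl.
- apply: (@near_eq_is_derive R R R (fun s => s^-1 ^+ k * expR (- s^-1))).
    near=> s; rewrite /flat ifT//.
    by near: s; exact: lt_nbhsr.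
  have tn0 : t != 0 by rewrite gt_eqF.
  have dV : is_derive t (1 : R) (fun s : R => s^-1) (- t ^- 2).
    have := @is_deriveV R id t 1 1 tn0 _; rewrite /GRing.scale/= mulr1; exact.
  have dX : is_derive t (1 : R) (fun s : R => s^-1 ^+ k) ((k%:R * t^-1 ^+ k.-1) *: - t ^- 2).
    by have := @is_deriveX R _ _ k t 1 _ dV; rewrite exprfctE.
  have dE : is_derive t (1 : R) (fun s : R => expR (- s^-1)) (expR (- t^-1) * t ^- 2).
    have dN := is_deriveN dV.
    have := @is_derive1_comp R expR (fun s => - s^-1) t _ _ (is_derive_expR _) dN.
    by rewrite opprK.
  have dM := is_deriveM dX dE.
  apply: (is_derive_eq dM).
  rewrite /flat t0 /GRing.scale/= [X in X = _](_ : _ = t^-1 ^+ k * t ^- 2 * expR (- t^-1)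
     - k%:R * (t^-1 ^+ k.-1 * t ^- 2) * expR (- t^-1)); last by ring.
  rewrite -!exprVn -exprD addn2.
  case: k {dX dM} => [|k]; first by rewrite !mul0r.
  by rewrite -exprD addn2/= -mulrA.
- rewrite !flat_le0// mulr0 subrr.
  have H : h^-1 *: ((flat k \o shift 0) (h *: (1 : R)) - flat k 0) @[h --> 0^'] --> (0 : R).
    have E (h : R) : h != 0 -> h^-1 *: ((flat k \o shift 0) (h *: (1 : R)) - flat k 0) = flat k.+1 h.
      move=> h0; rewrite /= addr0 [flat k 0]flat_le0// subr0 /GRing.scale/= mulr1.
      rewrite /flat; case: ifPn => [_|_]; last by rewrite mulr0.
      by rewrite exprS mulrA.
    apply/cvgr0Pnorm_le => e e0; near=> h.
    rewrite E; last by near: h; exact: nbhs_dnbhs_neq.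
    rewrite ger0_norm ?flat_ge0// (le_trans (flat_bound _ _))//.
    rewrite -ler_pdivlMl ?exprn_gt0//.
    near: h; apply: dnbhs0_le; rewrite mulr_gt0// invr_gt0 exprn_gt0//.
  apply: DeriveDef; first by apply/cvg_ex; exists 0.
  exact/cvg_lim.
Unshelve. all: by end_near. Qed.

Lemma flat_continuous k : continuous (flat k).
Proof.
move=> t; apply/differentiable_continuous/derivable1_diffP.
by have [] := is_derive_flat k t.
Qed.

End flat_functions.

Section sup_norm.
Context {R : realType} {n : nat}.

Lemma coord_le_norm (x : 'rV[R]_n) i : `|x ord0 i| <= `|x|.
Proof. by rewrite [leRHS]mx_normrE (le_bigmax _ (fun k => `|x k.1 k.2|) (ord0, i)). Qed.

Lemma norm_rV_le (x : 'rV[R]_n) c : 0 <= c -> (forall i, `|x ord0 i| <= c) -> `|x| <= c.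
Proof.
move=> c0 xc; rewrite [leLHS]mx_normrE; apply/bigmax_leP; split => // -[i j] _ /=.
by rewrite (ord1 i).
Qed.

End sup_norm.

Section box_bumps.
Context {R : realType} {n : nat}.
Implicit Types (a b x : 'rV[R]_n).

Lemma is_derive_flat_coord k (c d : R) (i j : 'I_n) x :
  is_derive x (basis_rV i) (fun y : 'rV[R]_n => flat k (c * y ord0 j + d))
    ((i == j)%:R * c * (flat k.+2 (c * x ord0 j + d) - k%:R * flat k.+1 (c * x ord0 j + d))).
Proof.
have := @is_derive_line R n (fun y : 'rV[R]_n => flat k (c * y ord0 j + d)) x (basis_rV i) 0.
rewrite scale0r add0r => ->.
rewrite (_ : (fun s : R => _) = (fun s : R => flat k (s * ((i == j)%:R * c) + (c * x ord0 j + d)))); last first.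
  apply/funext => s; rewrite !mxE eqxx/= eq_sym; congr flat.
  by ring.
set c' := (i == j)%:R * c; set d' := c * x ord0 j + d.
have dL : is_derive (0 : R) (1 : R) (fun s : R => s * c' + d') c'.
  have := @is_deriveD R R R (fun s : R => s * c') (cst d') 0 1 c' 0.
  rewrite addr0; apply.
  rewrite (_ : (fun s : R => s * c') = c' *: (id : R -> R)); last first.
    by apply/funext => s; rewrite /GRing.scale/= mulrC.
  have := @is_deriveZ R R R id c' 0 1 1 _.
  by rewrite /GRing.scale/= mulr1; exact.
have := @is_derive1_comp R (flat k) (fun s : R => s * c' + d') 0 _ _ (is_derive_flat k _) dL.
by rewrite mul0r add0r [X in is_derive _ _ _ X]mulrC.
Qed.

(** Each derivative is a combination of functions of the same family. *)
Lemma smooth_flat_coord k (c d : R) (j : 'I_n) :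
  smooth (fun y : 'rV[R]_n => flat k (c * y ord0 j + d)).
Proof.
have ck k' : continuous (fun y : 'rV[R]_n => flat k' (c * y ord0 j + d)).
  move=> y; apply: (@continuous_comp _ _ _ (fun y : 'rV[R]_n => c * y ord0 j + d) (flat k')).
    apply: continuousD; last exact: cst_continuous.
    by apply: continuousM; [exact: cst_continuous|exact: coord_continuous].
  exact: flat_continuous.
apply/smoothP => m; elim: m k => [|m IHm] k.
  by split.
split => //.
move=> i; split=> [x|]; first by have [] := is_derive_flat_coord k c d i j x.
rewrite (_ : pderiv i _ = (fun=> (i == j)%:R * c) \*
  ((fun y => flat k.+2 (c * y ord0 j + d)) \+ ((fun=> - k%:R) \* (fun y => flat k.+1 (c * y ord0 j + d))))).
  apply: CkM; first exact: Ck_cst.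
  by apply: CkD => //; apply: CkM => //; exact: Ck_cst.
apply/funext => x; rewrite /pderiv.
have -> := @derive_val _ _ _ _ _ _ _ (is_derive_flat_coord k c d i j x).
by rewrite /= mulNr.
Qed.

(** The factor [m] steepens the flanks: as [m] grows this increases to the indicator
    function of the box. *)
Definition box_bump a b (m : R) x : R :=
  \prod_i (flat 0 (m * x ord0 i + - (m * a ord0 i)) * flat 0 (- m * x ord0 i + m * b ord0 i)).

Lemma smooth_box_bump a b m : smooth (box_bump a b m).
Proof. by apply: smooth_prod => i; apply: smoothM; exact: smooth_flat_coord. Qed.

Lemma box_bump_ge0 a b m x : 0 <= box_bump a b m x.
Proof. by apply: prodr_ge0 => i _; rewrite mulr_ge0// flat_ge0. Qed.

Lemma box_bump_le1 a b m x : box_bump a b m x <= 1.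
Proof.
suff /andP[] : 0 <= box_bump a b m x <= 1 by [].
rewrite /box_bump; apply: (big_ind (fun y => 0 <= y <= 1)) => [|y z /andP[y0 y1] /andP[z0 z1]|i _].
- by rewrite ler01 lexx.
- by rewrite mulr_ge0//= mulr_ile1.
- by rewrite mulr_ge0 ?flat_ge0//= mulr_ile1 ?flat_ge0 ?flat0_le1.
Qed.

Lemma box_bump_gt0 a b m x : 0 < m -> box_rV a b x -> 0 < box_bump a b m x.
Proof.
move=> m0 abx; apply: prodr_gt0 => i _.
have /andP[ax xb] := abx i.
by rewrite mulr_gt0// flat_gt0//; [rewrite subr_gt0|rewrite mulNr addrC subr_gt0]; rewrite ltr_pM2l.
Qed.

Lemma box_bump_eq0 a b m x : 0 < m -> ~ box_rV a b x -> box_bump a b m x = 0.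
Proof.
move=> m0 abx; have [i abi] : exists i, ~~ (a ord0 i < x ord0 i < b ord0 i).
  by move/existsNP : abx => [i /negP ?]; exists i.
rewrite /box_bump (bigD1 i)//=.
move: abi; rewrite negb_and -!leNgt => /orP[h|h].
  by rewrite flat_le0 ?mul0r// subr_le0 ler_pM2l.
by rewrite [X in _ * X * _]flat_le0 ?mulr0 ?mul0r// mulNr addrC subr_le0 ler_pM2l.
Qed.

Lemma box_bump_cvg a b x : box_rV a b x -> box_bump a b k%:R x @[k --> \oo] --> (1 : R).
Proof.
move=> abx.
have flat_cvg c : 0 < c -> flat 0 (k%:R * c) @[k --> \oo] --> (1 : R).
  move=> c0; rewrite -[X in _ --> X]expR0.
  apply: (@cvg_trans _ (expR (- (k%:R * c)^-1) @[k --> \oo])).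
    apply: near_eq_cvg; near=> k; rewrite /flat expr0 mul1r ifT// mulr_gt0// ltr0n.
    by near: k; exact: nbhs_infty_gt.
  have H : - (k%:R * c)^-1 @[k --> \oo] --> (0 : R).
    rewrite -[X in _ --> X]oppr0; apply: cvgN.
    rewrite (_ : (fun k : nat => (k%:R * c)^-1) = (fun k : nat => k%:R^-1 * c^-1)); last first.
      by apply/funext => k; rewrite invfM.
    rewrite -[X in _ --> X](mul0r c^-1); apply: cvgM; last exact: cvg_cst.
    by apply/gtr0_cvgV0; [near=> k; rewrite ltr0n; near: k; exact: nbhs_infty_gt|exact: cvgr_idn].
  exact: (cvg_comp _ _ H (@continuous_expR R 0)).
rewrite /box_bump; elim: (index_enum _) => [|i r IHr].
  by rewrite (_ : (fun k : nat => _) = cst 1); [exact: cvg_cst|apply/funext => k; rewrite big_nil].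
have /andP[ax xb] := abx i.
rewrite (_ : (fun k : nat => _) = (fun k : nat => flat 0 (k%:R * (x ord0 i - a ord0 i)) *
    flat 0 (k%:R * (b ord0 i - x ord0 i)) *
    \prod_(j <- r) (flat 0 (k%:R * x ord0 j - k%:R * a ord0 j) *
                    flat 0 (- k%:R * x ord0 j + k%:R * b ord0 j)))); last first.
  apply/funext => k; rewrite big_cons; congr (flat 0 _ * flat 0 _ * _); ring.
rewrite -[X in _ --> X]mulr1; apply: cvgM => //.
by rewrite -[X in _ --> X]mulr1; apply: cvgM; apply: flat_cvg; rewrite subr_gt0.
Unshelve. all: by end_near. Qed.

Definition cbox_rV a b : set 'rV[R]_n := [set x | forall i, a ord0 i <= x ord0 i <= b ord0 i].

Lemma closed_cbox_rV a b : closed (cbox_rV a b).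
Proof.
rewrite (_ : cbox_rV a b = \bigcap_i ((fun x : 'rV[R]_n => x ord0 i) @^-1` `[a ord0 i, b ord0 i])).
  apply: closed_bigI => i _; apply: closed_comp => [x _|]; last exact: interval_closed.
  exact: coord_continuous.
by apply/seteqP; split => x /= H i => [_|]; move: (H i); rewrite /= in_itv//=; exact.
Qed.

Lemma compact_cbox_rV a b : compact (cbox_rV a b).
Proof.
apply: bounded_closed_compact; last exact: closed_cbox_rV.
exists (`|a| + `|b|); split => // M HM x abx /=.
rewrite (le_trans _ (ltW HM))//; apply: norm_rV_le => [|j]; first by rewrite addr_ge0.
have := coord_le_norm a j; have := coord_le_norm b j; have /andP[] := abx j.
rewrite !ler_norml => ? ? /andP[? ?] /andP[? ?].
by have := normr_ge0 a; have := normr_ge0 b; lra.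
Qed.

Lemma box_bump_test a b m (V : set 'rV[R]_n) : 0 < m -> cbox_rV a b `<=` V ->
  test_function V (box_bump a b m).
Proof.
move=> m0 abV.
have sub : tsupport (box_bump a b m) `<=` cbox_rV a b.
  rewrite /tsupport [X in _ `<=` X](closure_id _).1; last exact: closed_cbox_rV.
  apply: closureS => x /= bx0 i.
  have : box_rV a b x by apply: contrapT => /(box_bump_eq0 m0) bx; rewrite bx eqxx in bx0.
  by move=> /(_ i)/andP[/ltW-> /ltW->].
split; first exact: smooth_box_bump.
  apply: (subclosed_compact _ (@compact_cbox_rV a b)) => //; exact: closed_closure.
exact: subset_trans abV.
Qed.
End box_bumps.

(** * Square integrable functions *)

Section square_integrable.
Context d (T : measurableType d) (R : realType) (m : {measure set T -> \bar R}).
Variables (D : set T) (mD : measurable D).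
Implicit Types (f g h : T -> R).

Definition sqint f : Prop :=
  measurable_fun D f /\ (\int[m]_(x in D) (f x ^+ 2)%:E < +oo)%E.

Definition ip f g : R := \int[m]_(x in D) (f x * g x).

Lemma ipC f g : ip f g = ip g f.
Proof. by apply: eq_Rintegral => x _; rewrite mulrC. Qed.

Lemma measurable_fun_EFin_sqr f : measurable_fun D f ->
  measurable_fun D (fun x => (f x ^+ 2)%:E).
Proof. by move=> mf; apply/measurable_EFinP; exact: measurable_funX. Qed.

Lemma sqint_sqr_integrable f : sqint f -> m.-integrable D (EFin \o (fun x => f x ^+ 2)).
Proof.
move=> [mf foo]; apply/integrableP; split; first exact: measurable_fun_EFin_sqr.
rewrite (eq_integral (fun x => (f x ^+ 2)%:E))// => x _.
by rewrite /= ger0_norm ?sqr_ge0.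
Qed.

(** Products, dominated squares and powers below 2 are all integrable by this one
    domination. *)
Lemma sqint_le_integrable f g h : measurable_fun D h ->
  (forall x, D x -> `|h x| <= f x ^+ 2 + g x ^+ 2) -> sqint f -> sqint g ->
  m.-integrable D (EFin \o h).
Proof.
move=> mh hfg sf sg.
apply: (@le_integrable _ _ _ _ _ mD _ (EFin \o (fun x => f x ^+ 2 + g x ^+ 2))).
- exact/measurable_EFinP.
- by move=> x Dx; rewrite /= lee_fin (le_trans (hfg x Dx))// ler_norm.
- exact: (integrableD mD (sqint_sqr_integrable sf) (sqint_sqr_integrable sg)).
Qed.

Lemma sqint_mul_integrable f g : sqint f -> sqint g ->
  m.-integrable D (EFin \o (fun x => f x * g x)).
Proof.
move=> sf sg; apply: (sqint_le_integrable _ _ sf sg).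
  by apply: measurable_funM; [exact: sf.1|exact: sg.1].
move=> x _; rewrite normrM -[f x ^+ 2]real_normK ?num_real// -[g x ^+ 2]real_normK ?num_real//.
by move: `|f x| `|g x| => a b; nra.
Qed.

Lemma sqint_le f g h : measurable_fun D h ->
  (forall x, D x -> h x ^+ 2 <= f x ^+ 2 + g x ^+ 2) -> sqint f -> sqint g -> sqint h.
Proof.
move=> mh hfg sf sg; split => //.
have /integrableP[_] : m.-integrable D (EFin \o (fun x => h x ^+ 2)).
  apply: (sqint_le_integrable _ _ sf sg); first exact: measurable_funX.
  by move=> x Dx; rewrite ger0_norm ?sqr_ge0// hfg.
rewrite (eq_integral (fun x => (h x ^+ 2)%:E))// => x _.
by rewrite /= ger0_norm ?sqr_ge0.
Qed.

Lemma sqint0 : sqint (fun=> 0).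
Proof.
split; first exact: measurable_cst.
by rewrite (eq_integral (fun=> 0%E)) ?integral0// => x _; rewrite expr0n.
Qed.

Lemma sqintZ (c : R) f : sqint f -> sqint (fun x => c * f x).
Proof.
move=> sf; split; first by apply: measurable_funM => //; exact: sf.1.
rewrite (eq_integral (fun x => (c ^+ 2)%:E * (f x ^+ 2)%:E)%E); last first.
  by move=> x _; rewrite exprMn.
rewrite ge0_integralZl_EFin ?sqr_ge0//.
- by rewrite lte_mul_pinfty ?lee_fin ?sqr_ge0//; exact: sf.2.
- by move=> x _; rewrite lee_fin sqr_ge0.
- exact/measurable_fun_EFin_sqr/sf.1.
Qed.

Lemma sqintD f g : sqint f -> sqint g -> sqint (fun x => f x + g x).
Proof.
move=> sf sg; apply: (sqint_le _ _ (sqintZ 2 sf) (sqintZ 2 sg)).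
  by apply: measurable_funD; [exact: sf.1|exact: sg.1].
by move=> x _; nra.
Qed.

Lemma sqintN f : sqint f -> sqint (fun x => - f x).
Proof.
move=> sf; rewrite (_ : (fun x => - f x) = (fun x => -1 * f x)); first exact: sqintZ.
by apply/funext => x; rewrite mulN1r.
Qed.

Lemma sqintB f g : sqint f -> sqint g -> sqint (fun x => f x - g x).
Proof. by move=> sf sg; apply: sqintD => //; exact: sqintN. Qed.

Lemma sqint_bounded_mul (c f : T -> R) : measurable_fun D c ->
  (forall x, D x -> `|c x| <= 1) -> sqint f -> sqint (fun x => c x * f x).
Proof.
move=> mc c1 sf; apply: (sqint_le _ _ sf sqint0).
  by apply: measurable_funM => //; exact: sf.1.
move=> x Dx; rewrite expr0n addr0 exprMn ler_piMl ?sqr_ge0//.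
by rewrite -real_normK ?num_real// exprn_ile1// c1.
Qed.

Lemma ipDl f g h : sqint f -> sqint g -> sqint h ->
  ip (fun x => f x + g x) h = ip f h + ip g h.
Proof.
move=> sf sg sh; rewrite /ip -RintegralD//; try exact: sqint_mul_integrable.
by apply: eq_Rintegral => x _; rewrite mulrDl.
Qed.

Lemma ipZl (c : R) f h : sqint f -> sqint h ->
  ip (fun x => c * f x) h = c * ip f h.
Proof.
move=> sf sh; rewrite /ip -RintegralZl//; last exact: sqint_mul_integrable.
by apply: eq_Rintegral => x _; rewrite mulrA.
Qed.

Lemma ip_ge0 f : 0 <= ip f f.
Proof. by apply: Rintegral_ge0 => x _; rewrite -expr2 sqr_ge0. Qed.

Lemma ip_EFin f : sqint f -> (\int[m]_(x in D) (f x ^+ 2)%:E)%E = (ip f f)%:E.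
Proof.
move=> sf; rewrite /ip /Rintegral fineK; last first.
  by apply: integrable_fin_num => //; exact: sqint_mul_integrable.
by apply: eq_integral => x _; rewrite expr2.
Qed.

Lemma ip_EFin_mul f g : sqint f -> sqint g ->
  (\int[m]_(x in D) (f x * g x)%:E)%E = (ip f g)%:E.
Proof.
move=> sf sg; rewrite /ip /Rintegral fineK//.
by apply: integrable_fin_num => //; exact: sqint_mul_integrable.
Qed.

Lemma ip_sqrD (t : R) f g : sqint f -> sqint g ->
  ip (fun x => f x + t * g x) (fun x => f x + t * g x)
  = ip f f + 2 * t * ip f g + t ^+ 2 * ip g g.
Proof.
move=> sf sg; have stg := sqintZ t sg; have sfg := sqintD sf stg.
rewrite ipDl// ipZl// [ip f _]ipC [ip g _]ipC !ipDl// !ipZl//.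
by rewrite [ip g f]ipC; ring.
Qed.

(** Expand the square of [f - e g / l], for the sign [e] of the product. *)
Lemma ip_young (l : R) f g : 0 < l -> sqint f -> sqint g ->
  `|ip f g| <= l / 2 * ip f f + (2 * l)^-1 * ip g g.
Proof.
move=> l0 sf sg.
have h (e : R) : e ^+ 2 = 1 -> e * ip f g <= l / 2 * ip f f + (2 * l)^-1 * ip g g.
  move=> e1; have := ip_ge0 (fun x => f x + (- e * l^-1) * g x).
  rewrite ip_sqrD// => H.
  have : 0 <= l / 2 * (ip f f + 2 * (- e * l^-1) * ip f g + (- e * l^-1) ^+ 2 * ip g g).
    by rewrite mulr_ge0// divr_ge0 ?ltW.
  rewrite exprMn sqrrN e1 mul1r exprVn => K; rewrite -subr_ge0.
  suff -> : l / 2 * ip f f + (2 * l)^-1 * ip g g - e * ip f g =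
    l / 2 * (ip f f + 2 * (- e / l) * ip f g + (l ^+ 2)^-1 * ip g g) by [].
  by field; rewrite gt_eqF.
rewrite ler_norml; have := h 1; have := h (-1).
rewrite sqrrN expr1n => /(_ erefl) + /(_ erefl); rewrite mul1r mulN1r => ? ?.
by apply/andP; split; lra.
Qed.

(** The error is controlled by [ip_young] with the weight that balances its two terms. *)
Lemma ip_cvg (f : nat -> T -> R) g h (a : nat -> R) : (forall k, sqint (f k)) -> sqint g -> sqint h ->
  (forall k, ip (fun x => g x - f k x) (fun x => g x - f k x) <= a k) ->
  a k @[k --> \oo] --> (0 : R) ->
  ip (f k) h @[k --> \oo] --> ip g h.
Proof.
move=> sf sg sh fa a0; apply/cvgrPdist_le => e e0.
pose H := ip h h + 1; have H0 : 0 < H by rewrite ltr_wpDl// ip_ge0.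
have l0 : 0 < H / e by rewrite divr_gt0.
have d0 : 0 < e ^+ 2 / H by rewrite divr_gt0// exprn_gt0.
near=> k.
have -> : ip g h - ip (f k) h = ip (fun x => g x - f k x) h.
  rewrite ipDl//; last exact: sqintN.
  rewrite (_ : (fun x => - f k x) = (fun x => -1 * f k x)) ?ipZl ?mulN1r//.
  by apply/funext => x; rewrite mulN1r.
rewrite (le_trans (ip_young l0 _ sh))//; first exact: sqintB.
have ak : ip (fun x => g x - f k x) (fun x => g x - f k x) <= e ^+ 2 / H.
  rewrite (le_trans (fa k))//; near: k.
  by move/cvgrPdist_le : a0 => /(_ _ d0); apply: filterS => k; rewrite sub0r normrN; apply: le_trans; rewrite ler_norm.
have h1 : H / e / 2 * ip (fun x => g x - f k x) (fun x => g x - f k x) <= e / 2.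
  rewrite (le_trans (ler_wpM2l _ ak))//; first by rewrite divr_ge0// ltW.
  rewrite [leLHS](_ : _ = e / 2)//; field; by rewrite !gt_eqF.
have h2 : (2 * (H / e))^-1 * ip h h <= e / 2.
  rewrite mulrC ler_pdivrMr; last by rewrite mulr_gt0.
  rewrite (_ : e / 2 * (2 * (H / e)) = H); last by field; rewrite gt_eqF.
  by rewrite /H lerDl.
by rewrite (le_trans (lerD h1 h2))// -splitr.
Unshelve. all: by end_near. Qed.

(** Fatou's lemma for an almost everywhere limit, with a bound that converges instead of
    a limit inferior. *)
Lemma fatou_cvg (F : nat -> T -> \bar R) (G : T -> \bar R) (b : nat -> R) (c : R) :
  (forall k, measurable_fun D (F k)) -> (forall k x, D x -> (0 <= F k x)%E) ->
  measurable_fun D G -> (forall x, D x -> (0 <= G x)%E) ->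
  {ae m, forall x, D x -> F k x @[k --> \oo] --> G x} ->
  (forall k, (\int[m]_(x in D) F k x <= (b k)%:E)%E) ->
  b k @[k --> \oo] --> c ->
  (\int[m]_(x in D) G x <= c%:E)%E.
Proof.
move=> mF F0 mG G0 FG Fb bc.
rewrite (@ge0_ae_eq_integral _ _ _ _ _ _ (fun x => limn_einf (F^~ x)))//; last 3 first.
- rewrite (_ : (fun x => _) = (fun x => (- limn_esup (-%E \o F ^~ x))%E)).
    apply: measurableT_comp => //; apply: measurable_fun_limn_esup => k.
    exact: measurableT_comp.
  by apply/funext => x; rewrite limn_esupN oppeK.
- move=> x Dx; rewrite limn_einf_lim; apply: lime_ge.
    exact: is_cvg_einfs.
  by apply: nearW => k; apply: le_ereal_inf_tmp => _ [j _ <-]; exact: F0.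
- by apply: filterS FG => x FGx Dx; rewrite (cvg_limn_einf_sup (FGx Dx)).1.
apply: (le_trans (fatou _ _ _ _)) => //.
have <- : limn_einf (fun k => (b k)%:E) = c%:E.
  by apply: (cvg_limn_einf_sup _).1; apply: cvg_EFin => //; exact: nearW.
rewrite !limn_einf_lim; apply: lee_lim; try exact: is_cvg_einfs.
apply: nearW => k; apply: le_ereal_inf_tmp => _ [j /= kj <-].
apply: le_trans (Fb j); apply: ereal_inf_lbound; by exists j.
Qed.

End square_integrable.

Lemma sqintS d (T : measurableType d) (R : realType) (m : {measure set T -> \bar R})
    (D E : set T) (f : T -> R) : measurable D -> measurable E ->
  E `<=` D -> sqint m D f -> sqint m E f.
Proof.
move=> mD mE ED [mf foo]; split; first exact: measurable_funS mf.
apply: le_lt_trans foo; apply: ge0_subset_integral => //.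
  exact: measurable_fun_EFin_sqr.
by move=> x _; rewrite lee_fin sqr_ge0.
Qed.

Section rapidly_cauchy.
Context d (T : measurableType d) (R : realType) (m : {measure set T -> \bar R}).
Variables (D : set T) (mD : measurable D).

(** The upper limit exists at every point and is measurable, so that it serves as the
    representative of any almost everywhere limit. *)
Definition limsup_fun (f : nat -> T -> R) (x : T) : R :=
  fine (limn_esup (fun k => (f k x)%:E)).

Lemma measurable_limsup_fun (f : nat -> T -> R) :
  (forall k, measurable_fun D (f k)) -> measurable_fun D (limsup_fun f).
Proof.
move=> mf; apply: (@measurableT_comp _ _ _ _ _ _ (@fine R)); first exact: fine_measurable.
by apply: measurable_fun_limn_esup => k; exact/measurable_EFinP.
Qed.

Lemma limsup_fun_cvg (f : nat -> T -> R) x (l : R) :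
  f k x @[k --> \oo] --> l -> limsup_fun f x = l.
Proof.
move=> fl; rewrite /limsup_fun (cvg_limn_einf_sup (l := l%:E) _).2//.
by apply: cvg_EFin => //; exact: nearW.
Qed.

Lemma geometric_half_sum n : \sum_(0 <= k < n) (2^-1 : R) ^+ k <= 2.
Proof.
have -> : \sum_(0 <= k < n) (2^-1 : R) ^+ k = 2 - 2 * (2^-1 : R) ^+ n.
  elim: n => [|n IHn]; first by rewrite big_geq// expr0; lra.
  by rewrite big_nat_recr//= IHn exprS; field.
by rewrite gerBl mulr_ge0// exprn_ge0.
Qed.

(** By the arithmetic-geometric inequality [|v k|] is at most half of
    [2^k v_k^2 + 2^-k], which is summable. *)
Lemma square_summable_cvg (u : nat -> R) (S : R) :
  (forall n, \sum_(0 <= k < n) (2 ^+ k * (u k.+1 - u k) ^+ 2) <= S) ->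
  exists l : R, u k @[k --> \oo] --> l.
Proof.
move=> uS; pose v k := u k.+1 - u k.
have v_le k : `|v k| <= 2^-1 * (2 ^+ k * v k ^+ 2) + 2^-1 * (2^-1) ^+ k.
  have p0 : 0 < 2 ^+ k :> R by rewrite exprn_gt0.
  rewrite -subr_ge0 -[v k ^+ 2]real_normK ?num_real// exprVn.
  have -> : 2^-1 * (2 ^+ k * `|v k| ^+ 2) + 2^-1 * (2 ^+ k)^-1 - `|v k| =
    2^-1 * (2 ^+ k)^-1 * (2 ^+ k * `|v k| - 1) ^+ 2.
    by field; rewrite gt_eqF.
  by rewrite mulr_ge0 ?sqr_ge0// mulr_ge0// invr_ge0 ltW.
have cv : cvgn (series v).
  apply: normed_cvg; apply: nondecreasing_is_cvgn.
    by apply/nondecreasing_series => k _ _; exact: normr_ge0.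
  exists (2^-1 * S + 2^-1 * 2) => _ [n _ <-].
  rewrite /series/= (le_trans (ler_sum _ (fun k _ => v_le k)))//.
  by rewrite big_split/= -!mulr_sumr lerD// ler_wpM2l// geometric_half_sum.
exists (u 0%N + limn (series v)).
rewrite (_ : (fun k => u k) = (fun k => u 0%N + series v k)).
  by apply: cvgD => //; exact: cvg_cst.
by apply/funext => k; rewrite /series/= telescope_sumr// addrC subrK.
Qed.

(** Squared distances of order [4^-k] remain summable after multiplication by [2^k], so
    that almost everywhere [square_summable_cvg] applies to the sequence itself. *)
Lemma rapidly_cauchy_limit (f : nat -> T -> R) (C : R) : 0 <= C ->
  (forall k, measurable_fun D (f k)) ->
  (forall j k, (\int[m]_(x in D) ((f j x - f k x) ^+ 2)%:E
                <= (C * (4^-1 ^+ j + 4^-1 ^+ k))%:E)%E) ->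
  {ae m, forall x, D x -> f k x @[k --> \oo] --> limsup_fun f x} /\
  forall k, (\int[m]_(x in D) ((limsup_fun f x - f k x) ^+ 2)%:E
             <= (C * 4^-1 ^+ k)%:E)%E.
Proof.
move=> C0 mf fC.
have msq j k : measurable_fun D (fun x => ((f j x - f k x) ^+ 2)%:E).
  by apply/measurable_EFinP; apply: measurable_funX; exact: measurable_funB.
pose s k x := (2 ^+ k * (f k.+1 x - f k x) ^+ 2)%:E : \bar R.
have s0 k x : (0 <= s k x)%E by rewrite lee_fin mulr_ge0 ?sqr_ge0// exprn_ge0.
have ms k : measurable_fun D (s k).
  apply/measurable_EFinP; apply: measurable_funM => //.
  by apply: measurable_funX; exact: measurable_funB.
pose S x := (\sum_(0 <= k <oo) s k x)%E.
have intS : (\int[m]_(x in D) S x < +oo)%E.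
  rewrite integral_nneseries//.
  apply: (@le_lt_trans _ _ (4 * C)%:E); last exact: ltry.
  apply: lime_le.
    by apply: is_cvg_nneseries => k _ _; exact: integral_ge0.
  apply: nearW => n.
  apply: (@le_trans _ _ (\sum_(0 <= k < n) (2 * C * 2^-1 ^+ k)%:E)%E).
    apply: lee_sum => k _.
    rewrite (eq_integral (fun x => (2 ^+ k)%:E * ((f k.+1 x - f k x) ^+ 2)%:E)%E)//.
    rewrite ge0_integralZl_EFin ?exprn_ge0//; last by move=> x _; rewrite lee_fin sqr_ge0.
    apply: (@le_trans _ _ ((2 ^+ k)%:E * (C * (4^-1 ^+ k.+1 + 4^-1 ^+ k))%:E)%E).
      by apply: lee_wpmul2l; [rewrite lee_fin exprn_ge0|exact: fC].
    rewrite -EFinM lee_fin exprS mulrCA.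
    have -> : 2 ^+ k * (4^-1 * 4^-1 ^+ k + 4^-1 ^+ k) = 5 / 4 * 2^-1 ^+ k :> R.
      rewrite [in RHS](_ : 2^-1 = 2 * 4^-1 :> R); last by field.
      by rewrite exprMn; move: (2 ^+ k) (4^-1 ^+ k) => a b; field.
    rewrite mulrA ler_wpM2r ?exprn_ge0//; lra.
  rewrite sumEFin lee_fin -mulr_sumr.
  rewrite (le_trans (ler_wpM2l _ (geometric_half_sum n))) ?mulr_ge0//.
  by rewrite le_eqVlt; apply/orP; left; apply/eqP; ring.
have mS : measurable_fun D S.
  by apply: ge0_emeasurable_sum => k *; [exact: s0|exact: ms].
have iS : m.-integrable D S.
  apply/integrableP; split => //.
  rewrite (eq_integral S)// => x _; rewrite gee0_abs//.
  by apply: nneseries_ge0 => k _ _.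
have aef : {ae m, forall x, D x -> f k x @[k --> \oo] --> limsup_fun f x}.
  apply: filterS (integrable_ae mD iS) => x Sx Dx.
  have [l fl] : exists l : R, f k x @[k --> \oo] --> l.
    apply: (@square_summable_cvg (f ^~ x) (fine (S x))) => n.
    rewrite -lee_fin fineK; last exact: Sx.
    rewrite -sumEFin.
    by apply: nneseries_lim_ge => k *; exact: s0.
  by rewrite (limsup_fun_cvg fl).
split => // k.
apply: (@fatou_cvg _ _ _ m D mD (fun j x => ((f j x - f k x) ^+ 2)%:E) _
  (fun j => C * (4^-1 ^+ j + 4^-1 ^+ k))) => //.
- by move=> j x _; rewrite lee_fin sqr_ge0.
- apply/measurable_EFinP; apply: measurable_funX; apply: measurable_funB => //.
  exact: measurable_limsup_fun.
- by move=> x _; rewrite lee_fin sqr_ge0.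
- apply: filterS aef => x fx Dx.
  apply: cvg_EFin; first exact: nearW.
  apply: (@cvg_comp _ _ _ (fun j => f j x - f k x) (fun y => y ^+ 2)).
    by apply: cvgB; [exact: fx|exact: cvg_cst].
  exact: exprn_continuous.
- rewrite -[X in _ --> X]/(C * 4^-1 ^+ k) -[in X in _ --> X](add0r (4^-1 ^+ k)).
  apply: cvgM; first exact: cvg_cst.
  apply: cvgD; last exact: cvg_cst.
  by apply: cvg_expr; rewrite ger0_norm// invf_lt1// ltr1n.
Qed.

End rapidly_cauchy.

(** * Test functions and integration by parts *)

Section test_functions.
Context {R : realType} {n : nat}.
Local Notation mu := (lebesgue_rV R n).
Implicit Types (V W : set 'rV[R]_n) (u phi psi : 'rV[R]_n -> R).

Lemma closure_sub_closed (A B : set 'rV[R]_n) : closed B -> A `<=` B -> closure A `<=` B.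
Proof. by move=> /closure_id {2}-> /closureS. Qed.

Lemma test_sub V W phi : V `<=` W -> test_function V phi -> test_function W phi.
Proof. by move=> VW [sp cp pV]; split => //; exact: subset_trans VW. Qed.

Lemma tsupport_neq0 phi x : phi x != 0 -> tsupport phi x.
Proof. by move=> p0; apply: subset_closure. Qed.

Lemma notin_tsupport phi x : ~ tsupport phi x -> phi x = 0.
Proof. by move=> px; apply/eqP/negP => /negP/tsupport_neq0. Qed.

Lemma test_eq0 V phi x : test_function V phi -> ~ V x -> phi x = 0.
Proof. by move=> [_ _ pV] Vx; apply: notin_tsupport => /pV. Qed.

(** Whatever does not enlarge the support preserves test functions. *)
Lemma test_supported V phi u : test_function V phi -> smooth u ->
  (forall x, u x != 0 -> tsupport phi x) -> test_function V u.
Proof.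
move=> [sp cp pV] su uphi.
have sub : tsupport u `<=` tsupport phi.
  by apply: closure_sub_closed; [exact: closed_closure|exact: uphi].
split => //; last exact: subset_trans pV.
by apply: (subclosed_compact _ cp) => //; exact: closed_closure.
Qed.

Lemma test_smooth V phi : test_function V phi -> smooth phi.
Proof. by case. Qed.

Lemma test_continuous V phi : test_function V phi -> continuous phi.
Proof. by move=> /test_smooth/smooth_continuous. Qed.

Lemma test_mulr V phi u : test_function V phi -> smooth u ->
  test_function V (phi \* u).
Proof.
move=> tp su; apply: (test_supported tp).
  by apply: smoothM => //; exact: test_smooth tp.
by move=> x /=; rewrite mulf_eq0 negb_or => /andP[/tsupport_neq0].
Qed.

Lemma test_scale V phi (c : R) : test_function V phi -> test_function V (fun x => c * phi x).
Proof.
move=> tp; rewrite (_ : (fun x => _) = phi \* (fun=> c)); last by apply/funext => x; rewrite mulrC.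
by apply: test_mulr => //; exact: smooth_cst.
Qed.

Lemma test_add V phi psi : test_function V phi -> test_function V psi ->
  test_function V (phi \+ psi).
Proof.
move=> [sp cp pV] [sq cq qV].
have sub : tsupport (phi \+ psi) `<=` tsupport phi `|` tsupport psi.
  apply: closure_sub_closed; first by apply: closedU; exact: closed_closure.
  move=> x /= pqx.
  apply: contrapT => /not_orP[/notin_tsupport px /notin_tsupport qx].
  by rewrite px qx addr0 eqxx in pqx.
split; first exact: smoothD.
  apply: (subclosed_compact _ (compactU cp cq)) => //; exact: closed_closure.
by move=> x /sub[/pV|/qV].
Qed.

Lemma test0 V : test_function V (fun=> 0).
Proof.
have s0 : tsupport (fun _ : 'rV[R]_n => 0 : R) = set0.
  rewrite /tsupport (_ : mkset _ = set0) ?closure0//.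
  by apply/seteqP; split => // x /=; rewrite eqxx.
by split; rewrite ?s0//; [exact: smooth_cst|exact: compact0].
Qed.

Lemma pderiv_supported i phi x : pderiv i phi x != 0 -> tsupport phi x.
Proof.
move=> p0; apply: contrapT => px; move: p0; rewrite /pderiv.
rewrite (@near_eq_derive _ _ _ _ (fun=> 0 : R)); first by rewrite derive_cst eqxx.
have oS : open (~` tsupport phi) by apply: closed_openC; exact: closed_closure.
near=> y; apply: notin_tsupport; near: y.
exact: open_nbhs_nbhs.
Unshelve. all: by end_near. Qed.

Lemma test_pderiv V i phi : test_function V phi -> test_function V (pderiv i phi).
Proof.
move=> tp; apply: (test_supported tp); first exact/smooth_pderiv/(test_smooth tp).
exact: pderiv_supported.
Qed.

Lemma test_bounded V phi : test_function V phi ->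
  exists2 M : R, 0 < M & forall x, `|phi x| <= M.
Proof.
move=> tp; have [sp cp pV] := tp.
have : compact (phi @` tsupport phi).
  by apply: continuous_compact => //; apply: continuous_subspaceT; exact: test_continuous tp.
move=> /compact_bounded[N [_ N1x]].
exists (`|N| + 1); first by rewrite ltr_wpDl.
move=> x; have [px|/notin_tsupport ->] := pselect (tsupport phi x).
  by apply: (N1x (`|N| + 1)); [rewrite (le_lt_trans (ler_norm _))// ltrDl|exists x].
by rewrite normr0 addr_ge0.
Qed.

Lemma test_cube V phi : test_function V phi ->
  exists2 r : R, 0 < r & forall x, ~ cube_rV 0 r x -> phi x = 0.
Proof.
move=> [_ /compact_bounded[N [_ N1x]] _].
exists (`|N| + 2); first by rewrite ltr_wpDl.
move=> x xr; apply: notin_tsupport => px; apply: xr; apply/cube_rVE => i.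
rewrite mxE subr0 (le_lt_trans (coord_le_norm _ _))//.
rewrite (@le_lt_trans _ _ (`|N| + 1))// ?ltrD2l ?ltr1n//.
by apply: N1x => //; rewrite (le_lt_trans (ler_norm _))// ltrDl.
Qed.

Lemma test_measurable V phi : test_function V phi -> measurable_fun setT phi.
Proof. by move=> tp; apply: continuous_measurable_rV; exact: test_continuous tp. Qed.

Lemma lebesgue_cube_fin (c : 'rV[R]_n) (r : R) : (mu (cube_rV c r) < +oo)%E.
Proof.
have [r0|r0] := leP 0 r; first by rewrite lebesgue_cube_rV// ltry.
have [n0|n0] := eqVneq n 0%N.
  move: c; rewrite n0 => c /=; rewrite diracE; case: (_ \in _); exact: ltry.
rewrite (_ : cube_rV c r = set0) ?measure0//.
apply/seteqP; split => // x /cube_rVE H.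
have n1 : (0 < n)%N by rewrite lt0n.
have := H (Ordinal n1); rewrite ltNge => /negP[].
by rewrite (le_trans (ltW r0)).
Qed.

Lemma bounded_cube_integrable (f : 'rV[R]_n -> R) (M r : R) (c : 'rV[R]_n) :
  measurable_fun setT f -> (forall x, `|f x| <= M) ->
  (forall x, ~ cube_rV c r x -> f x = 0) -> mu.-integrable setT (EFin \o f).
Proof.
move=> mf fM f0; have mc : measurable (cube_rV c r) by exact: measurable_box_rV.
have : mu.-integrable (cube_rV c r) (EFin \o f).
  apply: measurable_bounded_integrable => //; first exact: lebesgue_cube_fin.
    exact: measurable_funS mf.
  by exists M; split; [exact: num_real|move=> K MK x _; exact: le_trans (fM x) (ltW MK)].
move=> /(integrable_mkcond (EFin \o f) mc); apply: eq_integrable => // x _.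
by rewrite patchE; case: ifPn => // /negP xc; rewrite /= f0// => /mem_set.
Qed.

Lemma bounded_cube_sqint (f : 'rV[R]_n -> R) (M r : R) (c : 'rV[R]_n) :
  measurable_fun setT f -> (forall x, `|f x| <= M) ->
  (forall x, ~ cube_rV c r x -> f x = 0) -> sqint mu setT f.
Proof.
move=> mf fM f0; split => //.
have /integrableP[_] : mu.-integrable setT (EFin \o (fun x => f x ^+ 2)).
  apply: (@bounded_cube_integrable _ (M ^+ 2) r c).
  - exact: measurable_funX.
  - by move=> x; rewrite normrX lerXn2r ?nnegrE ?(le_trans _ (fM x)).
  - by move=> x /f0 ->; rewrite expr0n.
congr (_ < _)%E; apply: eq_integral => x _.
by rewrite /= ger0_norm ?sqr_ge0.
Qed.

Lemma test_sqint V phi (D : set 'rV[R]_n) : measurable D -> test_function V phi -> sqint mu D phi.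
Proof.
move=> mD tp; have [M M0 pM] := test_bounded tp; have [r r0 pr] := test_cube tp.
apply: (@sqintS _ _ _ _ setT) => //.
by apply: (bounded_cube_sqint (test_measurable tp) pM pr).
Qed.

Lemma test_integrable V phi (D : set 'rV[R]_n) : measurable D -> test_function V phi ->
  mu.-integrable D (EFin \o phi).
Proof.
move=> mD tp; have [M M0 pM] := test_bounded tp; have [r r0 pr] := test_cube tp.
apply: (@integrableS _ _ _ _ setT) => //.
by apply: (bounded_cube_integrable (test_measurable tp) pM pr).
Qed.

(** The difference quotients integrate to 0 by translation invariance, and converge
    boundedly to the derivative on a fixed cube. *)
Lemma integral_pderiv V i phi : test_function V phi ->
  (\int[mu]_x (pderiv i phi x)%:E = 0)%E.
Proof.
move=> tp; have td := test_pderiv i tp.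
have [M M0 dM] := test_bounded td; have [r r0 pr] := test_cube tp.
pose h k : R := k.+1%:R^-1.
have h0 k : 0 < h k by rewrite invr_gt0.
have h1 k : h k <= 1 by rewrite invf_le1// ler1n.
pose f k x := ((phi (h k *: basis_rV i + x) - phi x) / h k)%:E.
have mt k : measurable_fun setT (fun x => phi (h k *: basis_rV i + x)).
  apply: (@measurableT_comp _ _ _ _ _ _ phi _ (fun x => h k *: basis_rV i + x)).
    exact: test_measurable tp.
  rewrite (_ : (fun x => _) = (fun x : 'rV[R]_n => x + h k *: basis_rV i)).
    exact: measurable_translate_rV.
  by apply/funext => x; rewrite addrC.
have mf k : measurable_fun setT (f k).
  apply/measurable_EFinP; apply: measurable_funM => //; apply: measurable_funB => //.
  exact: test_measurable tp.
have If k : (\int[mu]_x f k x = 0)%E.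
  have i1 : mu.-integrable setT (fun x => (phi x)%:E) by exact: test_integrable tp.
  have i2 : mu.-integrable setT (fun x => (phi (h k *: basis_rV i + x))%:E).
    apply/integrableP; split; first exact/measurable_EFinP.
    move/integrableP : i1 => [m1]; apply: le_lt_trans.
    rewrite le_eqVlt; apply/orP; left; apply/eqP.
    rewrite -(@ge0_integral_translate R n (h k *: basis_rV i) (fun x => `|(phi x)%:E|)%E)//.
      by apply: eq_integral => x _; rewrite addrC.
    exact: measurableT_comp.
  rewrite (eq_integral (fun x => (h k)^-1%:E * ((phi (h k *: basis_rV i + x))%:E - (phi x)%:E))%E); last first.
    by move=> x _; rewrite /f mulrC.
  rewrite integralZl//; last exact: integrableB.
  rewrite integralB//.
  rewrite [X in (X - _)%E](_ : _ = \int[mu]_x (phi x)%:E)%E.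
    by rewrite subee ?mule0//; exact: integrable_fin_num.
  rewrite -(@integral_translate R n (h k *: basis_rV i) (fun x => (phi x)%:E))//.
    by apply: eq_integral => x _; rewrite addrC.
  exact: measurable_int i1.
pose g : 'rV[R]_n -> \bar R := EFin \o (fun x => M * \1_(cube_rV 0 (r + 1)) x).
have mc : measurable (cube_rV (0 : 'rV[R]_n) (r + 1)) by exact: measurable_box_rV.
have ig : mu.-integrable setT g.
  apply: (@bounded_cube_integrable _ M (r + 1) 0).
  - by apply: measurable_funM => //; exact: measurable_indic.
  - move=> x; rewrite indicE; case: (_ \in _); rewrite ?mulr1 ?mulr0 ?normr0; last exact: ltW.
    by rewrite gtr0_norm.
  - by move=> x xc; rewrite indicE memNset// mulr0.
have [| | |_ _ H] := @dominated_convergence _ _ _ mu setT measurableT f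
    (fun x => (pderiv i phi x)%:E) g mf _ _ ig _.
  - by apply/measurable_EFinP; exact: test_measurable td.
  - apply: aeW => x _; apply: cvg_EFin; first exact: nearW.
    have dx : (fun t : R => t^-1 *: ((phi \o shift x) (t *: basis_rV i) - phi x)) t @[t --> 0^'] --> pderiv i phi x.
      by have D := @smooth_derivable _ _ _ i x (test_smooth tp); rewrite /pderiv /derive; exact: D.
    have /cvgr_dnbhsP/(_ h) H := dx.
    rewrite (_ : fine \o _ = (fun k => (h k)^-1 *: ((phi \o shift x) (h k *: basis_rV i) - phi x))); last first.
      by apply/funext => k; rewrite /GRing.scale/= mulrC.
    by apply: H; split; [move=> k; rewrite gt_eqF|exact: cvg_harmonic].
  - apply: aeW => x k _; rewrite /f /g /= lee_fin indicE.
    have [xc|xc] := boolP (x \in cube_rV 0 (r + 1)).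
      (* The mean value theorem bounds the difference quotients by [M]. *)
      have [c _ ->] := smooth_MVT i x (h k) (test_smooth tp).
      by rewrite mulrAC divff ?gt_eqF// mul1r mulr1.
    rewrite mulr0 !pr ?subrr ?mul0r ?normr0//.
    + move=> /cube_rVE H; move/negP : xc; apply; apply/mem_set/cube_rVE => j.
      by rewrite (lt_trans (H j))// ltrDl.
    + move=> /cube_rVE H; move/negP : xc; apply; apply/mem_set/cube_rVE => j.
      have := H j; rewrite !mxE !subr0 eqxx/= => Hj.
      rewrite -(addKr (h k * (j == i)%:R) (x ord0 j)) addrC (le_lt_trans (ler_normB _ _))//.
      rewrite ltr_leD//; case: (j == i); rewrite ?mulr1 ?mulr0 ?normr0 ?ler01//.
      by rewrite gtr0_norm.
move: H; rewrite (_ : [sequence _]_n = cst 0%E); last by apply/funext => k; exact: If.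
by move=> /cvg_lim <-//; rewrite lim_cst.
Qed.

(** Apply [integral_pderiv] to the product. *)
Lemma integration_by_parts_test V i u phi : smooth u -> test_function V phi ->
  (\int[mu]_x (u x * pderiv i phi x)%:E = - \int[mu]_x (pderiv i u x * phi x)%:E)%E.
Proof.
move=> su tp.
have tpu : test_function V (phi \* u) by exact: test_mulr.
have t1 : test_function V (pderiv i phi \* u) by apply: test_mulr => //; exact: test_pderiv.
have t2 : test_function V (phi \* pderiv i u) by apply: test_mulr => //; exact: smooth_pderiv.
have i1 := test_integrable measurableT t1.
have i2 := test_integrable measurableT t2.
have := integral_pderiv i tpu.
rewrite pderivM; last 2 first.
- by move=> x; exact/smooth_derivable/(test_smooth tp).
- by move=> x; exact: smooth_derivable.
rewrite (eq_integral (fun x => ((pderiv i phi \* u) x)%:E + ((phi \* pderiv i u) x)%:E)%E)//.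
rewrite integralD// => H.
have fB := integrable_fin_num measurableT i2.
rewrite (eq_integral (fun x => ((pderiv i phi \* u) x)%:E)); last by move=> x _; rewrite /= mulrC.
rewrite [X in _ = (- X)%E](eq_integral (fun x => ((phi \* pderiv i u) x)%:E)); last first.
  by move=> x _; rewrite /= mulrC.
by rewrite -[RHS]add0e -H addeK.
Qed.

End test_functions.

(** * The fundamental lemma of the calculus of variations *)

Section almost_everywhere_locally.
Context {R : realType} {n : nat}.
Local Notation mu := (lebesgue_rV R n).

(** The rational cubes on which the property holds a.e. are countably many and cover [W]. *)
Lemma ae_locally (W : set 'rV[R]_n) (P : 'rV[R]_n -> Prop) :
  (forall p, W p -> exists V : set 'rV[R]_n,
     [/\ open V, V p & {ae mu, forall x, V x -> P x}]) ->
  {ae mu, forall x, W x -> P x}.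
Proof.
move=> H.
pose cub (z : 'rV[rat]_n * nat) : set 'rV[R]_n := cube_rV (map_mx ratr z.1) z.2.+1%:R^-1.
pose good z := {ae mu, forall x, cub z x -> P x}.
have aeQ : {ae mu, forall x (k : nat), if unpickle k is Some z then good z -> cub z x -> P x else True}.
  apply: ae_foralln => k; case: (unpickle k) => [z|]; last exact: aeW.
  have [gz|gz] := pselect (good z).
    by apply: filterS gz => x Px _.
  by apply: aeW => x /gz.
apply: filterS aeQ => x Hx Wx.
have [V [oV Vx aeV]] := H x Wx.
have [c [k [cx cV]]] := rational_cube_base oV Vx.
have := Hx (pickle (c, k)); rewrite pickleK; apply => //.
apply: filterS aeV => y Py cy; apply: Py; apply: cV.
apply/cube_rVE => i; have /cube_rVE/(_ i) := cy => /lt_le_trans; apply.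
by rewrite ler_peMl ?invr_ge0// ler1n.
Qed.

End almost_everywhere_locally.

Section sqint_finite_measure.
Context d (T : measurableType d) (R : realType) (m : {measure set T -> \bar R}).
Variables (D : set T) (mD : measurable D) (Dfin : (m D < +oo)%E).

Lemma sqint_cst (c : R) : sqint m D (fun=> c).
Proof.
split; first exact: measurable_cst.
rewrite (eq_integral (cst (c ^+ 2)%:E))// integral_cst//.
by rewrite lte_mul_pinfty// lee_fin sqr_ge0.
Qed.

Lemma sqint_integrable (f : T -> R) : sqint m D f -> m.-integrable D (EFin \o f).
Proof.
move=> sf; have := sqint_mul_integrable mD sf (sqint_cst 1).
by apply: eq_integrable => // x _; rewrite /= mulr1.
Qed.

End sqint_finite_measure.

Section fundamental_lemma.
Context {R : realType} {n : nat}.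
Local Notation mu := (lebesgue_rV R n).
Implicit Types (a b : 'rV[R]_n).

Lemma measurable_rV_boxes : measurable = <<s @boxes R n >> :> set (set 'rV[R]_n).
Proof.
apply/seteqP; split; last first.
  apply: smallest_sub; first exact: sigma_algebra_measurable.
  by move=> _ [a [b ->]]; exact: measurable_box_rV.
apply: smallest_sub; first exact: smallest_sigma_algebra.
rewrite -bigcup_seq /=; apply: bigcup_sub => i _ _ [B mB <-].
have : measurable_fun setT (@rV_coord R n i : g_sigma_algebraType (@boxes R n) -> R).
  apply: (measurability _ (RGenOInfty.measurableE R)).
  move=> _ [_ [a ->] <-]; rewrite setTI; apply: open_sigma_boxes.
  apply: open_comp; first by move=> + _; exact: coord_continuous.
  by rewrite set_itvE; exact: open_gt.
by move=> /(_ measurableT _ mB).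
Qed.

(** The bumps of a box converge boundedly to its indicator function. *)
Lemma integral_box_eq0 (W : set 'rV[R]_n) (g : 'rV[R]_n -> R) a b :
  open W -> sqint mu W g ->
  (forall phi, test_function W phi -> \int[mu]_(x in W) (g x * phi x)%:E = 0)%E ->
  cbox_rV a b `<=` W -> (mu (box_rV a b) < +oo)%E ->
  (\int[mu]_(x in box_rV a b) (g x)%:E = 0)%E.
Proof.
move=> oW sg gW abW muab.
have mW := open_measurable_rV oW.
have mab := measurable_box_rV a b.
have bW : box_rV a b `<=` W.
  by move=> x H; apply: abW => i; have /andP[/ltW-> /ltW->] := H i.
have sg' : sqint mu (box_rV a b) g by apply: sqintS sg.
have ig : mu.-integrable (box_rV a b) (EFin \o g) by exact: sqint_integrable.
pose F k x := (g x * box_bump a b k.+1%:R x)%:E.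
have mF k : measurable_fun (box_rV a b) (F k).
  apply/measurable_EFinP; apply: measurable_funM; first exact: sg'.1.
  apply: measurable_funS measurableT _ _ => //.
  by apply: continuous_measurable_rV; apply: smooth_continuous; exact: smooth_box_bump.
have F0 k : (\int[mu]_(x in box_rV a b) F k x = 0)%E.
  rewrite -[RHS](gW (box_bump a b k.+1%:R)); last exact: box_bump_test.
  rewrite integral_mkcond [RHS]integral_mkcond; apply: eq_integral => x _.
  rewrite !patchE; case: ifPn => [xab|/negP xab].
    by rewrite ifT//; apply/mem_set/bW/set_mem.
  case: ifPn => // _; rewrite /F box_bump_eq0 ?mulr0// => xb.
  by apply: xab; exact/mem_set.
have [| | | |_ _ H] := @dominated_convergence _ _ _ mu _ mab F (EFin \o g) (EFin \o (fun x => `|g x|)) mF _ _ _ _.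
- exact: measurable_int ig.
- apply: aeW => x xab; apply: cvg_EFin; first exact: nearW.
  rewrite -[X in _ --> X]mulr1; apply: cvgM; first exact: cvg_cst.
  by have := box_bump_cvg xab; rewrite -cvg_shiftS.
- exact: integrable_norm.
- apply: aeW => x k _; rewrite /F/= lee_fin normrM ler_piMr//.
  by rewrite ger0_norm ?box_bump_ge0// box_bump_le1.
move: H; rewrite (_ : [sequence _]_k = cst 0%E); last by apply/funext => k; exact: F0.
by move=> /cvg_lim <-//; rewrite lim_cst.
Qed.

(** The intersections of boxes with a small cube form a pi-system generating the Borel
    sets, on which [g] integrates to 0 by [integral_box_eq0]; hence [g] integrates to 0 on
    every measurable part of the cube. *)
Lemma fundamental_lemma (W : set 'rV[R]_n) (g : 'rV[R]_n -> R) :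
  open W -> sqint mu W g ->
  (forall phi, test_function W phi -> \int[mu]_(x in W) (g x * phi x)%:E = 0)%E ->
  {ae mu, forall x, W x -> g x = 0}.
Proof.
move=> oW sg gW; apply: ae_locally => p Wp.
have [c [k [cp cW]]] := rational_cube_base oW Wp.
set c' := map_mx _ _ in cp cW; set r := k.+1%:R^-1 in cp cW.
have r0 : 0 < r by rewrite invr_gt0.
exists (cube_rV c' r); split => //.
  by rewrite cube_rV_ball//; exact: ball_open.
pose B := cube_rV c' r.
have mB : measurable B by exact: measurable_box_rV.
have mW := open_measurable_rV oW.
have BW : B `<=` W.
  move=> x /cube_rVE H; apply: cW; apply/cube_rVE => i.
  by rewrite (lt_trans (H i))// ltr_pMl// ltr1n.
have sB : sqint mu B g by apply: sqintS sg.
have iB : mu.-integrable B (EFin \o g) by apply: sqint_integrable => //; exact: lebesgue_cube_fin.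
have Pbox A : @boxes R n A -> (\int[mu]_(x in A `&` B) (g x)%:E = 0)%E.
  move=> [a [b ->]]; rewrite /B /cube_rV box_rVI; apply: integral_box_eq0 oW sg gW _ _.
    move=> x H; apply: cW; apply/cube_rVE => i.
    have := H i; rewrite !mxE ge_max le_min => /andP[/andP[_ ?] /andP[_ ?]].
    by rewrite ltr_distl; apply/andP; split; lra.
  apply: le_lt_trans (lebesgue_cube_fin c' r).
  apply: le_measure; rewrite ?inE; try exact: measurable_box_rV.
  by rewrite -box_rVI; exact: subIsetr.
have PA A : measurable A -> (\int[mu]_(x in A `&` B) (g x)%:E = 0)%E.
  rewrite measurable_rV_boxes; move: A.
  apply: (@dynkin_induction _ _ _ (fun A => (\int[mu]_(x in A `&` B) (g x)%:E = 0)%E)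
    measurable_rV_boxes (@boxes_setI_closed R n)).
  - rewrite setTI -[B]setIid; apply: Pbox; by do 2 eexists.
  - exact: Pbox.
  - move=> S mS PS.
    have : (\int[mu]_(x in (S `&` B) `|` (~` S `&` B)) (g x)%:E = 0)%E.
      by rewrite -setIUl setUv setTI -[B]setIid; apply: Pbox; do 2 eexists.
    rewrite integral_setU; last 4 first.
    + exact: measurableI.
    + by apply: measurableI => //; exact: measurableC.
    + rewrite -setIUl setUv setTI; exact: measurable_int iB.
    + by apply/disj_setPS => x [[Sx _] [nSx _]].
    by rewrite PS add0e.
  - move=> F mF tF PF; rewrite setI_bigcupl integral_bigcup.
    + by rewrite eseries0// => k' _ _; exact: PF.
    + by apply: trivIset_setIr.
    + by move=> k'; exact: measurableI.
    + apply: integrableS iB => //; last by move=> x [k' _ []].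
      by apply: bigcup_measurable => k' _; exact: measurableI.
have := @integral_ae_eq _ _ _ mu B mB (cst 0%E) (EFin \o g) iB (measurable_cst _) _.
move=> H; have {H} : ae_eq mu B (EFin \o g) (cst 0%E).
  apply: H => E EB mE; rewrite integral0 -[RHS](PA E)//.
  by rewrite (setIidl EB).
by apply: filterS => x gx Bx; have [] := gx Bx.
Qed.

End fundamental_lemma.

(** * Smooth hypersurfaces are negligible *)

Section null_boundary.
Context {R : realType} {n : nat}.
Local Notation mu := (lebesgue_rV R n).

(** Infinitely many disjoint sets of the same measure do not fit in a cube. *)
Lemma disjoint_translates_null (Z : set 'rV[R]_n) (v : nat -> 'rV[R]_n) (r : R) :
  measurable Z ->
  (forall k, (fun x => x + v k) @^-1` Z `<=` cube_rV 0 r) ->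
  trivIset setT (fun k => (fun x => x + v k) @^-1` Z) -> mu Z = 0%E.
Proof.
move=> mZ Zr tZ.
pose F k := (fun x => x + v k) @^-1` Z.
have mF k : measurable (F k).
  by rewrite -[F k]setTI; exact: measurable_translate_rV.
have FE k : mu (F k) = mu Z by exact: lebesgue_rV_translate.
have mUF : measurable (\bigcup_k F k) by exact: bigcup_measurable.
have Ufin : (mu (\bigcup_k F k) < +oo)%E.
  apply: le_lt_trans (lebesgue_cube_fin 0 r); apply: le_measure; rewrite ?inE//.
    exact: measurable_box_rV.
  by apply: bigcup_sub => k _; exact: Zr.
have Zfin : mu Z \is a fin_num.
  rewrite ge0_fin_numE// (le_lt_trans _ Ufin)// -(FE 0%N).
  by apply: le_measure; rewrite ?inE//; exact: (bigcup_sup (i := 0%N)).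
pose z := fine (mu Z).
have H k : (z *+ k <= fine (mu (\bigcup_k F k))).
  rewrite -lee_fin fineK ?ge0_fin_numE// measure_bigcup//.
  rewrite (eq_eseriesl (Q := xpredT)); last by move=> j; rewrite in_setT.
  rewrite (_ : (z *+ k)%:E = \sum_(0 <= j < k) mu (F j))%E.
    by apply: nneseries_lim_ge => j *; exact: measure_ge0.
  under eq_bigr do rewrite FE -(fineK Zfin).
  by rewrite sumEFin sumr_const_nat subn0.
apply/eqP; rewrite eq_le measure_ge0 andbT leNgt; apply/negP => Z0.
have z0 : 0 < z by rewrite fine_gt0// Z0/= ltey_eq Zfin.
have := H (Num.bound (fine (mu (\bigcup_k F k)) / z)).
rewrite leNgt => /negP; apply; rewrite -mulr_natl -ltr_pdivrMr//.
by rewrite archi_boundP// divr_ge0 ?fine_ge0 ?measure_ge0// ltW.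
Qed.

(** Where a partial derivative does not vanish, a function is injective along that
    coordinate, so that the translates of its zero set along it are disjoint. *)
Lemma level_set_null (psi : 'rV[R]_n -> R) i (p : 'rV[R]_n) :
  smooth psi -> pderiv i psi p != 0 ->
  exists V : set 'rV[R]_n, [/\ open V, V p & {ae mu, forall x, V x -> psi x != 0}].
Proof.
move=> spsi dp.
have cd : continuous (pderiv i psi) by exact/smooth_continuous/smooth_pderiv.
have oS : open ((pderiv i psi) @^-1` [set y | y != 0]).
  by apply: open_comp => [x _|]; [exact: cd|exact: open_neq].
have [e e0 eS] : exists2 e : R, 0 < e & ball p e `<=` (pderiv i psi) @^-1` [set y | y != 0].
  have /nbhs_ballP[e /= e0 eV] : nbhs p ((pderiv i psi) @^-1` [set y | y != 0]).
    exact: open_nbhs_nbhs.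
  by exists e.
(* A quarter: points of the cube are moved below by less than its side [2 * e3], and have to stay in the ball of radius [e]. *)
pose e3 := e / 4; have e30 : 0 < e3 by rewrite divr_gt0.
pose Z := cube_rV p e3 `&` [set x | psi x = 0].
exists (cube_rV p e3); split.
- by rewrite cube_rV_ball//; exact: ball_open.
- by apply/cube_rVE => j; rewrite subrr normr0.
have mZ : measurable Z.
  apply: measurableI; first exact: measurable_box_rV.
  apply: closed_measurable_rV; apply: (@closed_comp _ _ psi [set 0]).
    by move=> x _; exact: (smooth_continuous spsi).
  exact: closed_eq.
suff Z0 : mu Z = 0%E.
  exists Z; split => // x /= /not_implyP[xV /negP/negPn/eqP px]; split => //.
apply: (@disjoint_translates_null _ (fun k => k.+1%:R^-1 *: basis_rV i) (`|p| + e3 + 1)) => //.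
- move=> k x [/cube_rVE xp _]; apply/cube_rVE => j.
  have := xp j; rewrite !mxE eqxx/= subr0 => xj.
  have pj := coord_le_norm p j.
  have kj : `|k.+1%:R^-1 * (j == i)%:R| <= 1 :> R.
    case: (j == i); rewrite ?mulr1 ?mulr0 ?normr0 ?ler01//.
    by rewrite ger0_norm ?invr_ge0// invf_le1// ler1n.
  move: xj pj kj; rewrite ltr_distl !ler_norml ltr_norml.
  set y := k.+1%:R^-1 * _ => /andP[? ?] /andP[? ?] /andP[? ?].
  by apply/andP; split; lra.
- apply/trivIsetP => k l _ _ kl; apply/seteqP; split => // x [[/cube_rVE xk /= px] [/cube_rVE xl /= pl]].
  set y := x + k.+1%:R^-1 *: basis_rV i in xk px.
  set z := x + l.+1%:R^-1 *: basis_rV i in xl pl.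
  pose t : R := l.+1%:R^-1 - k.+1%:R^-1.
  have zE : z = t *: basis_rV i + y.
    by rewrite /z /y /t scalerBl; rewrite [RHS]addrCA subrK.
  have [c ct] := smooth_MVT i y t spsi.
  rewrite -zE pl px subrr => /esym/eqP; rewrite mulf_eq0 => /orP[|].
    rewrite subr_eq0 => /eqP/(can_inj invrK)/eqP; rewrite eqr_nat => /eqP[lk].
    by rewrite lk eqxx in kl.
  apply/negP; apply: (eS (c *: basis_rV i + y)).
  rewrite -cube_rV_ball//; apply/cube_rVE => j.
  have te : `|t| < 2 * e3.
    have -> : t = z ord0 i - y ord0 i by rewrite zE !mxE !eqxx/= mulr1 addrK.
    move: (xk i) (xl i) e30; rewrite ltr_norml; move: (z ord0 i) (y ord0 i) (p ord0 i) (e3) => a b c' d.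
    by rewrite !ltr_distl => /andP[? ?] /andP[? ?] ?; apply/andP; split; lra.
  have := xk j; rewrite !mxE !eqxx/= => yj.
  rewrite -addrA (le_lt_trans (ler_normD _ _))//.
  have cj : `|c * (j == i)%:R| <= `|t|.
    by case: (j == i); rewrite ?mulr1// mulr0 normr0.
  rewrite (le_lt_trans (lerD cj (lexx _)))// (lt_trans (ltrD te yj))//.
  rewrite /e3; lra.
Qed.

Lemma boundary_null (A : set 'rV[R]_n) : smooth_boundary A ->
  {ae mu, forall x, ~ boundary A x}.
Proof.
move=> sA.
have : {ae mu, forall x, boundary A x -> ~ boundary A x}.
  apply: ae_locally => p Ap.
  have [V [psi [oV Vp spsi dpsi VA]]] := sA p Ap.
  have [i di] := dpsi p Vp.
  have [V' [oV' V'p aeV']] := level_set_null spsi di.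
  exists (V `&` V'); split => //; first exact: openI.
  apply: filterS aeV' => x V'x [Vx /V'x px] Ax.
  have : (V `&` boundary A) x by [].
  by rewrite VA => -[_ /= p0]; rewrite p0 eqxx in px.
by apply: filterS => x H Ax; exact: (H Ax).
Qed.

End null_boundary.

(** * Weak derivatives *)

Section weak_derivatives.
Context {R : realType} {n : nat}.
Local Notation mu := (lebesgue_rV R n).
Implicit Types (U W : set 'rV[R]_n) (u g phi : 'rV[R]_n -> R).

Lemma integral_test_restrict U phi (f : 'rV[R]_n -> R) : test_function U phi ->
  (\int[mu]_(x in U) (f x * phi x)%:E = \int[mu]_x (f x * phi x)%:E)%E.
Proof.
move=> tp; rewrite integral_mkcond; apply: eq_integral => x _.
rewrite patchE; case: ifPn => // /negP xU.
by rewrite (test_eq0 tp) ?mulr0// => Ux; apply: xU; exact/mem_set.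
Qed.

Lemma is_weak_pderiv_restrict U i u g : is_weak_pderiv setT i u g -> is_weak_pderiv U i u g.
Proof.
move=> ug phi tp; rewrite integral_test_restrict; last exact: test_pderiv.
by rewrite integral_test_restrict// ug//; exact: test_sub tp.
Qed.

(** [U] need not be open: it may contain a negligible part of its boundary, as the mixed
    domain does. *)
Lemma weak_pderiv_unique U W i u g g' : measurable U -> open W -> W `<=` U ->
  {ae mu, forall x, U x -> W x} -> L2 U g -> L2 U g' ->
  is_weak_pderiv U i u g -> is_weak_pderiv U i u g' ->
  {ae mu, forall x, U x -> g x = g' x}.
Proof.
move=> mU oW WU aeW sg sg' ug ug'.
have mW := open_measurable_rV oW.
have sW : sqint mu W g by exact: (sqintS mU mW WU sg).
have sW' : sqint mu W g' by exact: (sqintS mU mW WU sg').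
have : {ae mu, forall x, W x -> g x - g' x = 0}.
  apply: (fundamental_lemma oW); first exact: sqintB.
  move=> phi tp; have tpU := test_sub WU tp.
  have sphi := test_sqint mW tp.
  have := ug _ tpU; rewrite (ug' _ tpU).
  rewrite (integral_test_restrict g tpU) (integral_test_restrict g' tpU).
  rewrite -(integral_test_restrict g tp) -(integral_test_restrict g' tp).
  have i1 := sqint_mul_integrable mW sW sphi.
  have i2 := sqint_mul_integrable mW sW' sphi.
  move=> /oppe_inj H.
  rewrite (eq_integral (fun x => (g x * phi x)%:E - (g' x * phi x)%:E)%E); last first.
    by move=> x _; rewrite mulrBl EFinB.
  by rewrite integralB// H subee//; exact: integrable_fin_num i1.
move=> H; apply: filterS2 aeW H => x UWx H Ux.
by apply/eqP; rewrite -subr_eq0; apply/eqP/H/UWx.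
Qed.

Lemma weak_pderivE U W i u g : measurable U -> open W -> W `<=` U ->
  {ae mu, forall x, U x -> W x} -> L2 U g -> is_weak_pderiv U i u g ->
  {ae mu, forall x, U x -> weak_pderiv U i u x = g x} /\ L2 U (weak_pderiv U i u).
Proof.
move=> mU oW WU aeW sg ug.
have [s1 s2] : L2 U (weak_pderiv U i u) /\ is_weak_pderiv U i u (weak_pderiv U i u).
  by apply: (@xgetPex _ _ [set g | L2 U g /\ is_weak_pderiv U i u g]); exists g.
by split => //; exact: (weak_pderiv_unique mU oW WU aeW s1 sg s2 ug).
Qed.

Lemma test_weak_pderiv V i phi : test_function V phi -> is_weak_pderiv setT i phi (pderiv i phi).
Proof. by move=> tphi psi tpsi; apply: integration_by_parts_test tpsi; exact: test_smooth tphi. Qed.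

End weak_derivatives.

(** * Concave powers *)

Section power_inequalities.
Context {R : realType}.
Implicit Types (p x y a b t : R).

(** Dividing by [y^p] this is [r^p <= 1 - p + p r], the convexity of the exponential. *)
Lemma powR_tangent p x y : 0 < p -> p < 1 -> 0 <= x -> 0 < y ->
  x `^ p <= y `^ p + p * y `^ (p - 1) * (x - y).
Proof.
move=> p0 p1 x0 y0.
have yp : y `^ (p - 1) = y `^ p / y.
  by rewrite powRB ?(gt_eqF y0) ?implybT// powRr1// ltW.
have -> : y `^ p + p * y `^ (p - 1) * (x - y) = y `^ p * (1 - p + p * (x / y)).
  by rewrite yp; field; rewrite gt_eqF.
rewrite -[x in x `^ p](@divfK _ y) ?gt_eqF// powRM ?divr_ge0 ?(ltW y0)//.
rewrite mulrC ler_pM2l ?powR_gt0//.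
have : 0 <= x / y by rewrite divr_ge0// ltW.
move: (x / y) => r; rewrite le_eqVlt => /predU1P[<-|r0].
  by rewrite powR0 ?gt_eqF// mulr0 addr0 subr_ge0 ltW.
rewrite /powR gt_eqF//.
have := @convex_expR R (Itv01 (ltW p0) (ltW p1)) (ln r) 0.
by rewrite !convRE/= expR0 lnK ?posrE// mulr0 addr0 mulr1 [leRHS]addrC.
Qed.

(** The sum of the two tangent inequalities at the midpoint. *)
Lemma powR_midpoint p a b : 0 < p -> p < 1 -> 0 <= a -> 0 <= b ->
  2^-1 * a `^ p + 2^-1 * b `^ p <= (2^-1 * a + 2^-1 * b) `^ p.
Proof.
move=> p0 p1 a0 b0; set c := 2^-1 * a + 2^-1 * b.
have : 0 <= c by rewrite addr_ge0 ?mulr_ge0.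
rewrite le_eqVlt => /predU1P[c0|c0].
  have -> : a = 0 by apply/le_anti; rewrite a0 andbT; move: c0; rewrite /c; lra.
  have -> : b = 0 by apply/le_anti; rewrite b0 andbT; move: c0; rewrite /c; lra.
  by rewrite powR0 ?gt_eqF// !mulr0 addr0 powR_ge0.
have := powR_tangent p0 p1 a0 c0; have := powR_tangent p0 p1 b0 c0.
set k := p * _; set d := c `^ p => h1 h2.
have : k * (b - c) + k * (a - c) = 0 by rewrite /c; field.
lra.
Qed.

(** Below [T] the power is monotone; above [T] the quotient [t^(p-2)] decreases. *)
Lemma powR_le_sqr p T t : 0 < p -> p < 1 -> 0 < T -> 0 <= t ->
  t `^ p <= T `^ p + T `^ (p - 2) * t ^+ 2.
Proof.
move=> p0 p1 T0 t0; have [tT|Tt] := leP t T.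
  by rewrite ler_wpDr ?mulr_ge0 ?powR_ge0 ?sqr_ge0// ge0_ler_powR ?nnegrE ?(ltW p0) ?(ltW T0).
have tp : 0 < t by exact: lt_trans Tt.
rewrite ler_wpDl ?powR_ge0//.
rewrite -powR_mulrn// [leLHS](_ : _ = t `^ (p - 2) * t `^ 2%:R); last first.
  by rewrite -powRD ?(gt_eqF tp) ?implybT// subrK.
rewrite ler_wpM2r ?powR_ge0//.
rewrite -[p - 2]opprB !powRN lef_pV2 ?posrE ?powR_gt0// ge0_ler_powR ?nnegrE ?(ltW T0) ?(ltW tp) ?(ltW Tt)//.
lra.
Qed.

Lemma powR_cvg_pos p a (u : nat -> R) : 0 < a -> u k @[k --> \oo] --> a ->
  u k `^ p @[k --> \oo] --> a `^ p.
Proof.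
move=> a0 ua.
have H : {for a, continuous (fun y => y `^ p)}.
  apply/differentiable_continuous/derivable1_diffP; apply: derivable_powR.
  by rewrite in_itv/= a0.
exact: (cvg_comp _ _ ua H).
Qed.

Lemma powR_cvg_nneg p a (u : nat -> R) : 0 < p -> (forall k, 0 <= u k) ->
  u k @[k --> \oo] --> a -> u k `^ p @[k --> \oo] --> a `^ p.
Proof.
move=> p0 u0 ua.
have : 0 <= a.
  by rewrite -(cvg_lim _ ua)//; apply: limr_ge; [apply/cvg_ex; exists a|exact: nearW].
rewrite le_eqVlt => /predU1P[a0|a0]; last exact: powR_cvg_pos.
move: ua; rewrite -a0 powR0 ?gt_eqF// => ua.
apply/cvgr0Pnorm_le => e e0.
have d0 : 0 < e `^ p^-1 by rewrite powR_gt0.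
move/cvgr0Pnorm_le : ua => /(_ _ d0); apply: filterS => k.
rewrite (ger0_norm (u0 k)) ger0_norm ?powR_ge0// => uk.
have : u k `^ p <= (e `^ p^-1) `^ p.
  by rewrite ge0_ler_powR ?nnegrE ?powR_ge0 ?(ltW p0).
by rewrite -powRrM mulVf ?gt_eqF// powRr1// ltW.
Qed.

End power_inequalities.

(** * The nonlocal kernel *)

Section euclidean_norm.
Context {R : realType} {n : nat}.
Implicit Types x y : 'rV[R]_n.

Lemma coord_le_enorm x i : `|x ord0 i| <= enorm x.
Proof.
rewrite /enorm -sqrtr_sqr ler_wsqrtr// (bigD1 i)//= lerDl.
by apply: sumr_ge0 => j _; exact: sqr_ge0.
Qed.

Lemma norm_le_enorm x : `|x| <= enorm x.
Proof. by apply: norm_rV_le => [|i]; [exact: sqrtr_ge0|exact: coord_le_enorm]. Qed.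

Lemma enorm_le_norm x : enorm x <= n%:R * `|x|.
Proof.
have nx : 0 <= n%:R * `|x| by rewrite mulr_ge0.
rewrite -[leRHS]ger0_norm// -sqrtr_sqr ler_wsqrtr//.
apply: (@le_trans _ _ (\sum_(i < n) `|x| ^+ 2)).
  apply: ler_sum => i _; rewrite -[leLHS]real_normK ?num_real//.
  by rewrite lerXn2r ?nnegrE// coord_le_norm.
rewrite sumr_const card_ord exprMn -[leLHS]mulr_natl ler_wpM2r ?sqr_ge0//.
by rewrite -natrX ler_nat; case: (n) => // k; rewrite leq_pmull.
Qed.

End euclidean_norm.

Section nonlocal_kernel.
Context {R : realType} {n : nat}.
Local Notation mu := (lebesgue_rV R n).
Implicit Types (x y : 'rV[R]_n) (z : 'rV[R]_n * 'rV[R]_n).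
Implicit Types (u v phi : 'rV[R]_n -> R).

(** The square root of the kernel of the fractional Laplacian, so that the nonlocal
    energy becomes an inner product of functions [ndiff]. *)
Definition kern (s : R) z : R := enorm (z.1 - z.2) `^ (- ((n%:R + 2 * s) / 2)).

Definition ndiff (s : R) u z : R := (u z.1 - u z.2) * kern s z.

Lemma kern_ge0 s z : 0 <= kern s z. Proof. exact: powR_ge0. Qed.

Lemma kern_sqr s z : 0 < s -> kern s z * kern s z = (enorm (z.1 - z.2) `^ (n%:R + 2 * s))^-1.
Proof.
move=> s0; rewrite /kern powRN -invfM -powRD; first by rewrite -splitr.
by rewrite -splitr gt_eqF// ltr_wpDl// mulr_gt0.
Qed.

Lemma ndiffM s u v z : 0 < s -> ndiff s u z * ndiff s v z =
  (u z.1 - u z.2) * (v z.1 - v z.2) / enorm (z.1 - z.2) `^ (n%:R + 2 * s).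
Proof. by move=> s0; rewrite -kern_sqr// /ndiff; ring. Qed.

Lemma measurable_enorm_sub : measurable_fun setT (fun z => enorm (z.1 - z.2)).
Proof.
pose sq z : R := \sum_i (z.1 - z.2) ord0 i ^+ 2.
have msq : measurable_fun setT sq.
  apply: measurable_sum => i; apply: measurable_funX.
  rewrite (_ : (fun z => _) = (fun z => rV_coord i z.1 - rV_coord i z.2)).
    by apply: measurable_funB; apply: measurableT_comp => //; exact: measurable_rV_coord.
  by apply/funext => z; rewrite /rV_coord !mxE.
apply: (@measurableT_comp _ _ _ _ _ _ (@Num.sqrt R) _ sq) => //.
by apply: continuous_measurable_fun; exact: sqrt_continuous.
Qed.

Lemma measurable_kern s : measurable_fun setT (kern s).
Proof. exact: (measurableT_comp (measurable_powR _) measurable_enorm_sub). Qed.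

Lemma measurable_ndiff s u : measurable_fun setT u -> measurable_fun setT (ndiff s u).
Proof.
move=> mu'; apply: measurable_funM; last exact: measurable_kern.
by apply: measurable_funB; apply: measurableT_comp.
Qed.

(** The integral is a geometric series. *)
Lemma dyadic_integrable (c r : nat -> R) (A t : R) :
  (forall j, 0 <= c j) -> (forall j, 0 <= r j) -> 0 <= t -> t < 1 -> 0 <= A ->
  (forall j, c j * (r j *+ 2) ^+ n <= A * t ^+ j) ->
  (\int[mu]_x (\sum_(0 <= j <oo) (c j * \1_(cube_rV 0 (r j)) x)%:E) < +oo)%E.
Proof.
move=> c0 r0 t0 t1 A0 crA.
have mc j : measurable (cube_rV (0 : 'rV[R]_n) (r j)) by exact: measurable_box_rV.
have m1 j : measurable_fun setT (fun x : 'rV[R]_n => (\1_(cube_rV 0 (r j)) x : R)%:E).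
  by apply/measurable_EFinP; exact: measurable_indic.
rewrite integral_nneseries//; last 2 first.
- by move=> j; apply/measurable_EFinP; apply: measurable_funM => //; exact: measurable_indic.
- by move=> j x _; rewrite lee_fin mulr_ge0.
have cvA : cvgn (series (geometric A t)).
  by apply: is_cvg_geometric_series; rewrite ger0_norm.
apply: (@le_lt_trans _ _ (limn (series (geometric A t)))%:E); last exact: ltry.
apply: lime_le; first by apply: is_cvg_nneseries => j _ _; apply: integral_ge0 => x _; rewrite lee_fin mulr_ge0.
apply: nearW => k.
apply: (@le_trans _ _ (\sum_(0 <= j < k) (A * t ^+ j)%:E)%E).
  apply: lee_sum => j _.
  rewrite (eq_integral (fun x => (c j)%:E * (\1_(cube_rV 0 (r j)) x)%:E)%E)//.
  rewrite ge0_integralZl_EFin//.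
  by rewrite integral_indic// setIT [X in (_ * X)%E](lebesgue_cube_rV 0 (r0 j)) -EFinM lee_fin.
rewrite sumEFin lee_fin; apply: (@nondecreasing_cvgn_le _ (series (geometric A t))) => //.
by apply/nondecreasing_series => j _ _; rewrite /geometric/= mulr_ge0// exprn_ge0.
Qed.

(** The squared difference of a bounded Lipschitz function multiplies the kernel by at
    most a constant times the minimum of 1 and [|x|^2]. *)
Definition radial_weight (s : R) x : R :=
  Num.min 1 (`|x| ^+ 2) * `|x| `^ (- (n%:R + 2 * s)).

Lemma measurable_norm_rV : measurable_fun setT (fun x : 'rV[R]_n => `|x|).
Proof. by apply: continuous_measurable_rV => x; exact: norm_continuous. Qed.

Lemma measurable_radial_weight s : measurable_fun setT (radial_weight s).
Proof.
apply: measurable_funM.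
  by apply: measurable_minr => //; apply: measurable_funX; exact: measurable_norm_rV.
exact: (measurableT_comp (measurable_powR _) measurable_norm_rV).
Qed.

Lemma radial_weight_ge0 s x : 0 <= radial_weight s x.
Proof. by rewrite /radial_weight mulr_ge0 ?powR_ge0// le_min ler01 sqr_ge0. Qed.

Lemma powR_expn (a p : R) j : 0 <= a -> (a ^+ j) `^ p = (a `^ p) ^+ j.
Proof.
by move=> a0; rewrite -powR_mulrn// powRAC powR_mulrn// powR_ge0.
Qed.

Lemma dyadic_shell_small (y : R) : 0 < y -> y < 1 ->
  exists j : nat, 2^-1 ^+ j.+1 <= y < 2^-1 ^+ j.
Proof.
move=> y0 y1.
have ex : exists j : nat, 2^-1 ^+ j <= y.
  have : 2^-1 ^+ j @[j --> \oo] --> (0 : R).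
    by apply: cvg_expr; rewrite ger0_norm// invf_lt1// ltr1n.
  move/cvgr0Pnorm_le => /(_ _ y0) [j _ /(_ j (leqnn j))] /=.
  by rewrite ger0_norm ?exprn_ge0//; exists j.
case: (ex_minnP ex) => -[|j] Hj Hmin; first by rewrite expr0 leNgt y1 in Hj.
exists j; rewrite Hj/= ltNge; apply/negP => /Hmin; by rewrite ltnn.
Qed.

Lemma dyadic_shell_large (y : R) : 1 <= y ->
  exists j : nat, 2 ^+ j <= y < 2 ^+ j.+1.
Proof.
move=> y1.
have ex : exists j : nat, y < 2 ^+ j.
  exists (Num.bound y); rewrite (lt_le_trans (archi_boundP _))//; first exact: le_trans y1.
  by rewrite -natrX ler_nat ltnW// ltn_expl.
case: (ex_minnP ex) => -[|j] Hj Hmin; first by rewrite expr0 ltNge y1 in Hj.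
exists j; rewrite Hj andbT leNgt; apply/negP => /Hmin; by rewrite ltnn.
Qed.

Lemma powRV (a p : R) : 0 <= a -> a^-1 `^ p = (a `^ p)^-1.
Proof. by move=> a0; rewrite -powR_inv1// powRAC powR_inv1// powR_ge0. Qed.

Lemma nneseries_term_le (f : nat -> \bar R) j : (forall k, 0 <= f k)%E ->
  (f j <= \sum_(0 <= k <oo) f k)%E.
Proof.
move=> f0; apply: (@le_trans _ _ (\sum_(0 <= k < j.+1) f k)%E).
  by rewrite big_nat_recr//= leeDr// sume_ge0.
by apply: nneseries_lim_ge => k *; exact: f0.
Qed.

Lemma integralD_lty (f g : 'rV[R]_n -> \bar R) :
  measurable_fun setT f -> measurable_fun setT g ->
  (forall x, 0 <= f x)%E -> (forall x, 0 <= g x)%E ->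
  (\int[mu]_x f x < +oo -> \int[mu]_x g x < +oo -> \int[mu]_x (f x + g x) < +oo)%E.
Proof.
by move=> mf mg f0 g0 fi gi; rewrite ge0_integralD// lte_add_pinfty.
Qed.

Lemma norm_lt_cube x (r : R) : `|x| < r -> cube_rV 0 r x.
Proof.
by move=> xr; apply/cube_rVE => i; rewrite mxE subr0 (le_lt_trans (coord_le_norm _ _)).
Qed.

(** Dyadic shells of radius [2^-j] and [2^j] contribute [2^(-(2-2s)j)] and [2^(-2sj)]. *)
Lemma integral_radial_weight s : (2 <= n)%N -> 0 < s -> s < 1 ->
  (\int[mu]_x (radial_weight s x)%:E < +oo)%E.
Proof.
move=> n2 s0 s1; pose p : R := n%:R + 2 * s.
have n2R : 2 <= n%:R :> R by rewrite ler_nat.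
have p20 : 0 <= p - 2 by rewrite /p; lra.
pose c1 j : R := (2 ^+ j.+1) `^ (p - 2); pose r1 j : R := 2^-1 ^+ j.
pose c2 j : R := (2 ^+ j) `^ (- p); pose r2 j : R := 2 ^+ j.+1.
pose S1 x := (\sum_(0 <= j <oo) (c1 j * \1_(cube_rV (0 : 'rV[R]_n) (r1 j)) x)%:E)%E.
pose S2 x := (\sum_(0 <= j <oo) (c2 j * \1_(cube_rV (0 : 'rV[R]_n) (r2 j)) x)%:E)%E.
have pow2_gt1 e : 0 < e -> 1 < 2 `^ e :> R.
  move=> e0; have : 1 `^ e < 2 `^ e :> R by rewrite gt0_ltr_powR ?nnegrE// ltr1n.
  by rewrite powR1.
have pow2_lt1 e : 0 < e -> 2 `^ (- e) < 1 :> R.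
  by move=> e0; rewrite powRN invf_lt1 ?pow2_gt1// (lt_trans ltr01)// pow2_gt1.
pose a : R := 2 ^+ n; have a0 : a != 0 by rewrite expf_neq0.
have aE j : (2^-1 ^+ j) ^+ n = a^-1 ^+ j by rewrite -exprM mulnC exprM exprVn.
have aE' j : (2 ^+ j) ^+ n = a ^+ j by rewrite -exprM mulnC exprM.
have i1 : (\int[mu]_x S1 x < +oo)%E.
  apply: (@dyadic_integrable _ _ (2 `^ (p - 2) * a) (2 `^ (- (2 - 2 * s)))) => //.
  - by move=> j; exact: powR_ge0.
  - by move=> j; rewrite exprn_ge0.
  - by apply: pow2_lt1; lra.
  - by rewrite mulr_ge0 ?powR_ge0// /a exprn_ge0.
  - move=> j; rewrite /c1 /r1 powR_expn// exprS -(mulr_natr (2^-1 ^+ j)) exprMn aE -/a.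
    have -> : 2 `^ (p - 2) = a * 2 `^ (- (2 - 2 * s)) :> R.
      rewrite /a -powR_mulrn// -powRD ?pnatr_eq0 ?implybT//.
      by congr powR; rewrite /p; ring.
    rewrite exprMn [leLHS](_ : _ = a * 2 `^ (- (2 - 2 * s)) * a * 2 `^ (- (2 - 2 * s)) ^+ j * (a * a^-1) ^+ j).
      by rewrite divff// expr1n mulr1.
    by rewrite exprMn; ring.
have i2 : (\int[mu]_x S2 x < +oo)%E.
  apply: (@dyadic_integrable _ _ (a * a) (2 `^ (- (2 * s)))) => //.
  - by move=> j; exact: powR_ge0.
  - by move=> j; rewrite exprn_ge0.
  - by apply: pow2_lt1; lra.
  - by rewrite mulr_ge0// /a exprn_ge0.
  - move=> j; rewrite /c2 /r2 powR_expn// -(mulr_natr (2 ^+ j.+1)) [2 ^+ j.+1]exprS !exprMn aE' -/a.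
    have -> : 2 `^ (- p) = a^-1 * 2 `^ (- (2 * s)) :> R.
      rewrite /a -powR_mulrn// -powRN -powRD ?pnatr_eq0 ?implybT//.
      by congr powR; rewrite /p; ring.
    rewrite exprMn [leLHS](_ : _ = a * a * 2 `^ (- (2 * s)) ^+ j * (a * a^-1) ^+ j).
      by rewrite divff// expr1n mulr1.
    by rewrite exprMn; ring.
have mS c r : (forall j, 0 <= c j) ->
    measurable_fun setT (fun x => (\sum_(0 <= j <oo) (c j * \1_(cube_rV (0 : 'rV[R]_n) (r j)) x)%:E)%E).
  move=> c0; apply: ge0_emeasurable_sum => j; first by move=> x _ _; rewrite lee_fin mulr_ge0.
  move=> _; apply/measurable_EFinP; apply: measurable_funM => //.
  by apply: measurable_indic; exact: measurable_box_rV.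
have mS1 : measurable_fun setT S1 by apply: mS => j; exact: powR_ge0.
have mS2 : measurable_fun setT S2 by apply: mS => j; exact: powR_ge0.
have S10 x : (0 <= S1 x)%E.
  by apply: nneseries_ge0 => j _ _; rewrite lee_fin mulr_ge0// powR_ge0.
have S20 x : (0 <= S2 x)%E.
  by apply: nneseries_ge0 => j _ _; rewrite lee_fin mulr_ge0// powR_ge0.
apply: (@le_lt_trans _ _ (\int[mu]_x (S1 x + S2 x))%E); last first.
  exact: integralD_lty.
apply: ge0_le_integral => //.
- by move=> x _; rewrite lee_fin radial_weight_ge0.
- by apply/measurable_EFinP; exact: measurable_radial_weight.
- exact: emeasurable_funD.
move=> x _.
have : 0 <= `|x| by [].
rewrite le_eqVlt => /predU1P[x0|x0].
  by rewrite /radial_weight -x0 expr0n min_r// mul0r adde_ge0.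
have [x1|x1] := ltP `|x| 1.
  have [j /andP[h1 h2]] := dyadic_shell_small x0 x1.
  apply: (@le_trans _ _ (S1 x)); last by rewrite leeDl.
  apply: (@le_trans _ _ (c1 j * \1_(cube_rV (0 : 'rV[R]_n) (r1 j)) x)%:E); last first.
    by apply: (@nneseries_term_le (fun j => (c1 j * \1_(cube_rV (0 : 'rV[R]_n) (r1 j)) x)%:E) j) => k;
      rewrite lee_fin mulr_ge0// powR_ge0.
  rewrite lee_fin indicE mem_set ?mulr1; last exact: norm_lt_cube.
  rewrite /radial_weight (@le_trans _ _ (`|x| ^+ 2 * `|x| `^ (- p)))//.
    by rewrite ler_wpM2r ?powR_ge0// ge_min lexx orbT.
  rewrite -powR_mulrn// -powRD ?(gt_eqF x0) ?implybT//.
  rewrite (_ : 2%:R - p = - (p - 2)); last by ring.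
  have -> : c1 j = ((2^-1 ^+ j.+1) `^ (p - 2))^-1 by rewrite exprVn powRV ?exprn_ge0// invrK.
  rewrite powRN.
  by rewrite lef_pV2 ?posrE ?powR_gt0 ?exprn_gt0// ge0_ler_powR ?nnegrE ?exprn_ge0.
have [j /andP[h1 h2]] := dyadic_shell_large x1.
apply: (@le_trans _ _ (S2 x)); last by rewrite leeDr.
apply: (@le_trans _ _ (c2 j * \1_(cube_rV (0 : 'rV[R]_n) (r2 j)) x)%:E); last first.
  by apply: (@nneseries_term_le (fun j => (c2 j * \1_(cube_rV (0 : 'rV[R]_n) (r2 j)) x)%:E) j) => k;
    rewrite lee_fin mulr_ge0// powR_ge0.
rewrite lee_fin indicE mem_set ?mulr1; last exact: norm_lt_cube.
rewrite /radial_weight (@le_trans _ _ (1 * `|x| `^ (- p)))//.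
  by rewrite ler_wpM2r ?powR_ge0// ge_min lexx.
rewrite /c2 mul1r !powRN lef_pV2 ?posrE ?powR_gt0 ?exprn_gt0//.
by rewrite ge0_ler_powR ?nnegrE ?exprn_ge0// /p; lra.
Qed.

End nonlocal_kernel.

Section gagliardo_test.
Context {R : realType} {n : nat}.
Local Notation mu := (lebesgue_rV R n).
Implicit Types (phi : 'rV[R]_n -> R).

(** Change the coordinates one at a time and use the mean value theorem. *)
Lemma test_lipschitz (V : set 'rV[R]_n) phi : test_function V phi ->
  exists2 L : R, 0 <= L & forall x y, `|phi x - phi y| <= L * `|x - y|.
Proof.
move=> tp.
have /choice[M MP] i : exists M : R, 0 < M /\ forall x, `|pderiv i phi x| <= M.
  by have [M M0 MP] := test_bounded (test_pderiv i tp); exists M.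
exists (\sum_i M i); first by apply: sumr_ge0 => i _; rewrite ltW// (MP i).1.
move=> x y.
pose path k : 'rV[R]_n := \row_i (if (i < k)%N then x ord0 i else y ord0 i).
have p0 : path 0%N = y by apply/rowP => i; rewrite mxE.
have pn : path n = x by apply/rowP => i; rewrite mxE ltn_ord.
rewrite -{1}pn -{1}p0 -(telescope_sumr (fun k => phi (path k)) (leq0n n)) big_mkord.
rewrite (le_trans (ler_norm_sum _ _ _))// mulr_suml; apply: ler_sum => i _.
have -> : path i.+1 = (x ord0 i - y ord0 i) *: basis_rV i + path i.
  apply/rowP => j; rewrite !mxE eqxx/= ltnS leq_eqVlt.
  have [->|ji] := eqVneq j i; first by rewrite eqxx ltnn/= mulr1 subrK.
  by rewrite mulr0 add0r (_ : (nat_of_ord j == i) = false)//; exact/negbTE.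
have [c _ ->] := smooth_MVT i (path i) (x ord0 i - y ord0 i) (test_smooth tp).
rewrite normrM mulrC ler_pM//; first exact: (MP i).2.
by have := coord_le_norm (x - y) i; rewrite !mxE.
Qed.

Lemma measurable_sub_rV : measurable_fun setT (fun z : 'rV[R]_n * 'rV[R]_n => z.1 - z.2).
Proof.
apply: measurable_fun_rVP => i.
rewrite (_ : _ \o _ = (fun z => rV_coord i z.1 - rV_coord i z.2)).
  by apply: measurable_funB; apply: measurableT_comp => //; exact: measurable_rV_coord.
by apply/funext => z; rewrite /= /rV_coord !mxE.
Qed.

Lemma radial_weight_sym s (x y : 'rV[R]_n) : radial_weight s (x - y) = radial_weight s (y - x).
Proof. by rewrite /radial_weight distrC. Qed.

(** After a translation the inner integral does not depend on the outer variable. *)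
Lemma integral_weight_cube (s r : R) : (2 <= n)%N -> 0 < s -> s < 1 ->
  (\int[mu \x mu]_z (\1_(cube_rV 0 r) z.1 * radial_weight s (z.1 - z.2))%:E < +oo)%E /\
  (\int[mu \x mu]_z (\1_(cube_rV 0 r) z.2 * radial_weight s (z.1 - z.2))%:E < +oo)%E.
Proof.
move=> n2 s0 s1.
have mc : measurable (cube_rV (0 : 'rV[R]_n) r) by exact: measurable_box_rV.
have mI : measurable_fun setT (fun x : 'rV[R]_n => \1_(cube_rV 0 r) x : R) by exact: measurable_indic.
have mw : measurable_fun setT (fun z : 'rV[R]_n * 'rV[R]_n => radial_weight s (z.1 - z.2)).
  exact: (measurableT_comp (measurable_radial_weight s) measurable_sub_rV).
pose I := (\int[mu]_x (radial_weight s x)%:E)%E.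
have Ioo : (I < +oo)%E by exact: integral_radial_weight.
have I0 : (0 <= I)%E by apply: integral_ge0 => x _; rewrite lee_fin radial_weight_ge0.
have mwE : measurable_fun setT (fun x : 'rV[R]_n => (radial_weight s x)%:E).
  by apply/measurable_EFinP; exact: measurable_radial_weight.
have cE : (\int[mu]_x ((\1_(cube_rV 0 r) x)%:E * I) < +oo)%E.
  rewrite ge0_integralZr//; last exact/measurable_EFinP.
  by rewrite integral_indic// setIT lte_mul_pinfty// ?lebesgue_cube_fin// ge0_fin_numE// lebesgue_cube_fin.
have inner (x : 'rV[R]_n) : (\int[mu]_y (radial_weight s (y - x))%:E = I)%E.
  by rewrite (@ge0_integral_translate R n (- x) (fun y => (radial_weight s y)%:E))// => y;
    rewrite lee_fin radial_weight_ge0.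
have mwx (x : 'rV[R]_n) : measurable_fun setT (fun y : 'rV[R]_n => (radial_weight s (y - x))%:E).
  apply/measurable_EFinP.
  exact: (measurableT_comp (measurable_radial_weight s) (measurable_translate_rV (- x))).
have innerZ (c : R) (x : 'rV[R]_n) : 0 <= c ->
    (\int[mu]_y (c%:E * (radial_weight s (y - x)%R)%:E) = c%:E * I)%E.
  move=> c0; rewrite -(inner x); apply: ge0_integralZl_EFin => //.
  by move=> y _; rewrite lee_fin radial_weight_ge0.
split.
- rewrite fubini_tonelli1; last 2 first.
  + apply/measurable_EFinP; apply: measurable_funM => //.
    exact: (measurableT_comp mI measurable_fst).
  + by move=> z; rewrite lee_fin mulr_ge0// radial_weight_ge0.
  rewrite /fubini_F (eq_integral (fun x => (\1_(cube_rV 0 r) x)%:E * I)%E)// => x _ /=.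
  rewrite (eq_integral (fun y : 'rV[R]_n => (\1_(cube_rV 0 r) x)%:E * (radial_weight s (y - x)%R)%:E)%E).
    exact: innerZ.
  by move=> y _; rewrite radial_weight_sym.
- rewrite fubini_tonelli2; last 2 first.
  + apply/measurable_EFinP; apply: measurable_funM => //.
    exact: (measurableT_comp mI measurable_snd).
  + by move=> z; rewrite lee_fin mulr_ge0// radial_weight_ge0.
  rewrite /fubini_G (eq_integral (fun x => (\1_(cube_rV 0 r) x)%:E * I)%E)// => x _ /=.
  rewrite (eq_integral (fun y : 'rV[R]_n => (\1_(cube_rV 0 r) x)%:E * (radial_weight s (y - x)%R)%:E)%E)//.
  exact: innerZ.
Qed.

(** The Lipschitz bound is used near the diagonal and boundedness away from it; the
    integrand vanishes unless one of the two points lies in a cube around the support. *)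
Lemma test_ndiff_sqint (V : set 'rV[R]_n) (s : R) phi : (2 <= n)%N -> 0 < s -> s < 1 ->
  test_function V phi -> sqint (mu \x mu)%E setT (ndiff s phi).
Proof.
move=> n2 s0 s1 tp; split; first exact: (measurable_ndiff s (test_measurable tp)).
have [M M0 pM] := test_bounded tp; have [r r0 pr] := test_cube tp.
have [L L0 pL] := test_lipschitz tp.
pose C := L ^+ 2 + (2 * M) ^+ 2.
have C0 : 0 <= C by rewrite addr_ge0 ?sqr_ge0.
pose w1 (z : 'rV[R]_n * 'rV[R]_n) := (\1_(cube_rV 0 r) z.1 * radial_weight s (z.1 - z.2))%:E.
pose w2 (z : 'rV[R]_n * 'rV[R]_n) := (\1_(cube_rV 0 r) z.2 * radial_weight s (z.1 - z.2))%:E.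
have [i1 i2] := integral_weight_cube r n2 s0 s1.
have mc : measurable (cube_rV (0 : 'rV[R]_n) r) by exact: measurable_box_rV.
have mI : measurable_fun setT (fun x : 'rV[R]_n => \1_(cube_rV 0 r) x : R) by exact: measurable_indic.
have mw : measurable_fun setT (fun z : 'rV[R]_n * 'rV[R]_n => radial_weight s (z.1 - z.2)).
  exact: (measurableT_comp (measurable_radial_weight s) measurable_sub_rV).
have mw1 : measurable_fun setT w1.
  by apply/measurable_EFinP; apply: measurable_funM => //; exact: (measurableT_comp mI measurable_fst).
have mw2 : measurable_fun setT w2.
  by apply/measurable_EFinP; apply: measurable_funM => //; exact: (measurableT_comp mI measurable_snd).
have w10 z : (0 <= w1 z)%E by rewrite lee_fin mulr_ge0// radial_weight_ge0.
have w20 z : (0 <= w2 z)%E by rewrite lee_fin mulr_ge0// radial_weight_ge0.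
have i12 : (\int[mu \x mu]_z (C%:E * (w1 z + w2 z)) < +oo)%E.
  rewrite ge0_integralZl_EFin//; [|by move=> z _; rewrite adde_ge0|exact: emeasurable_funD].
  by rewrite ge0_integralD// lte_mul_pinfty// lte_add_pinfty.
apply: le_lt_trans i12; apply: ge0_le_integral => //.
- by move=> z _; rewrite lee_fin sqr_ge0.
- by apply: measurable_fun_EFin_sqr; exact: (measurable_ndiff s (test_measurable tp)).
- by apply: emeasurable_funM => //; exact: emeasurable_funD.
move=> [x y] _; rewrite /w1 /w2 /= -EFinD -EFinM lee_fin -mulrDl.
rewrite expr2 ndiffM//= -expr2.
have [->|xy] := eqVneq x y.
  by rewrite subrr expr0n mul0r mulr_ge0// mulr_ge0 ?radial_weight_ge0// addr_ge0.
have d0 : 0 < `|x - y| by rewrite normr_gt0 subr_eq0.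
have [xc|xc] := pselect (cube_rV 0 r x \/ cube_rV 0 r y); last first.
  move/not_orP : xc => [/pr -> /pr ->].
  by rewrite subrr expr0n mul0r mulr_ge0// mulr_ge0 ?radial_weight_ge0// addr_ge0.
apply: (@le_trans _ _ (C * radial_weight s (x - y))); last first.
  rewrite ler_wpM2l// ler_peMl ?radial_weight_ge0//.
  by case: xc => xc; rewrite !indicE (mem_set xc) ?lerDl ?lerDr.
rewrite /radial_weight mulrA ler_pM ?sqr_ge0 ?invr_ge0 ?powR_ge0//.
  have hM : `|phi x - phi y| <= 2 * M.
    by rewrite (le_trans (ler_normB _ _))// mulr2n mulrDl mul1r lerD.
  rewrite -real_normK ?num_real// minEle; case: ifPn => _.
    by rewrite mulr1 /C ler_wpDl ?sqr_ge0// lerXn2r ?nnegrE ?mulr_ge0// ltW.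
  rewrite /C (@le_trans _ _ (L ^+ 2 * `|x - y| ^+ 2))//.
    by rewrite -exprMn lerXn2r ?nnegrE ?mulr_ge0.
  by rewrite ler_wpM2r ?sqr_ge0// lerDl sqr_ge0.
rewrite powRN lef_pV2 ?posrE ?powR_gt0//; last first.
  by rewrite (lt_le_trans d0)// norm_le_enorm.
rewrite ge0_ler_powR ?nnegrE ?norm_le_enorm//; first by rewrite addr_ge0// mulr_ge0// ltW.
exact: sqrtr_ge0.
Qed.

End gagliardo_test.

(** * The Poincare and Sobolev inequalities *)

Section product_ae.
Context d1 d2 (T1 : measurableType d1) (T2 : measurableType d2) (R : realType).
Variables (m1 : {sigma_finite_measure set T1 -> \bar R}) (m2 : {sigma_finite_measure set T2 -> \bar R}).

Lemma ae_prod_fst (P : T1 -> Prop) : {ae m1, forall x, P x} ->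
  {ae (m1 \x m2)%E, forall z, P z.1}.
Proof.
move=> [A [mA A0 PA]]; exists (A `*` setT); split; first exact: measurableX.
  by transitivity (m1 A * m2 setT)%E; [exact: product_measure1E|rewrite A0 mul0e].
by move=> z Pz; split => //; exact: PA.
Qed.

Lemma ae_prod_snd (P : T2 -> Prop) : {ae m2, forall x, P x} ->
  {ae (m1 \x m2)%E, forall z, P z.2}.
Proof.
move=> [A [mA A0 PA]]; exists (setT `*` A); split; first exact: measurableX.
  by transitivity (m1 setT * m2 A)%E; [exact: product_measure1E|rewrite A0 mule0].
by move=> z Pz; split => //; exact: PA.
Qed.

End product_ae.

Section mixed_domain_facts.
Context {R : realType} {n : nat}.
Local Notation mu := (lebesgue_rV R n).
Variables (Om Nn : set 'rV[R]_n).
Hypotheses (oOm : open Om) (oNn : open Nn) (bON : bounded_set (Om `|` Nn)).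
Hypothesis sON : smooth_boundary (Om `|` Nn).

Let U := mixed_domain Om Nn.

Lemma boundary_measurable (A : set 'rV[R]_n) : measurable (boundary A).
Proof.
apply: measurableD; first by apply: closed_measurable_rV; exact: closed_closure.
by apply: open_measurable_rV; exact: open_interior.
Qed.

Lemma mixed_domain_measurable : measurable U.
Proof.
apply: measurableU; first by apply: measurableU; exact: open_measurable_rV.
apply: measurableI; first exact: boundary_measurable.
by apply: closed_measurable_rV; exact: closed_closure.
Qed.

(** The interface between the two regions lies in the boundary of their union, which is a
    smooth hypersurface. *)
Lemma mixed_domain_ae : {ae mu, forall x, U x -> (Om `|` Nn) x}.
Proof.
apply: filterS (boundary_null sON) => x nb [//|[_ cN]].
apply: contrapT => nON; apply: nb; split.
  by apply: closureS cN => y Ny; right.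
by move/interior_subset.
Qed.

Lemma mixed_domain_bounded : exists2 M : R, 0 < M & forall x, U x -> `|x| <= M.
Proof.
have [N [_ NP]] := bON.
pose M := `|N| + 1.
have MP x : (Om `|` Nn) x -> `|x| <= M.
  by apply: NP; rewrite (le_lt_trans (ler_norm _))// ltrDl.
have cl : closed [set x : 'rV[R]_n | `|x| <= M].
  apply: (@closed_comp _ _ (fun x : 'rV[R]_n => `|x|) [set y | y <= M]); last exact: closed_le.
  by move=> x _; exact: norm_continuous.
exists M; first by rewrite ltr_wpDl.
move=> x [/MP//|[[cO _] _]].
have : closure Om `<=` [set x : 'rV[R]_n | `|x| <= M].
  by apply: closure_sub_closed => // y Oy; apply: MP; left.
exact.
Qed.

Lemma Om_sub_mixed : Om `<=` U.
Proof. by move=> x Ox; left; left. Qed.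

Lemma Om_measurable : measurable Om.
Proof. exact: open_measurable_rV. Qed.

Lemma Om_finite : (mu Om < +oo)%E.
Proof.
have [M M0 UM] := mixed_domain_bounded.
apply: le_lt_trans (lebesgue_cube_fin 0 (M + 1)).
apply: le_measure; rewrite ?inE; [exact: Om_measurable|exact: measurable_box_rV|].
move=> x /Om_sub_mixed/UM xM; apply: norm_lt_cube; by rewrite (le_lt_trans xM)// ltrDl.
Qed.

Lemma Qset_measurable : measurable (Qset Om).
Proof.
by apply: measurableD => //; apply: measurableX; apply: measurableC; exact: Om_measurable.
Qed.

(** On [Om] times a cube on which [v] vanishes, the difference of the values is the value
    on [Om], and the kernel is bounded below by boundedness. *)
Lemma nonlocal_poincare (s : R) : (0 < n)%N -> 0 < s ->
  exists2 c : R, 0 < c & forall v : 'rV[R]_n -> R, measurable_fun setT v ->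
    {ae mu, forall x, (~` U) x -> v x = 0} ->
    (c%:E * \int[mu]_(x in Om) (v x ^+ 2)%:E
     <= \int[mu \x mu]_(z in Qset Om) (ndiff s v z ^+ 2)%:E)%E.
Proof.
move=> n0 s0; have [M M0 UM] := mixed_domain_bounded.
pose i0 := Ordinal n0.
(* Cube of half side 1 around [(M + 2, ..., M + 2)]: its points have coordinates above [M]. *)
pose c0 : 'rV[R]_n := \row_i (M + 2).
pose B := cube_rV c0 1.
have mB : measurable B by exact: measurable_box_rV.
have BU x : B x -> ~ U x.
  move=> /cube_rVE/(_ i0); rewrite mxE ltr_distl => /andP[h1 _] /UM.
  apply/negP; rewrite -ltNge (lt_le_trans _ (coord_le_norm x i0))//.
  by rewrite (lt_le_trans _ (ler_norm _))//; lra.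
have BM x : B x -> `|x| <= M + 3.
  move=> /cube_rVE H; apply: norm_rV_le => [|i]; first by rewrite addr_ge0// ltW.
  have := H i; rewrite mxE ltr_distl => /andP[h1 h2].
  by rewrite ler_norml; apply/andP; split; lra.
pose p : R := n%:R + 2 * s.
have p0 : 0 < p by rewrite ltr_wpDl// mulr_gt0.
pose K : R := n%:R * (M + M + 3).
have K0 : 0 < K by rewrite mulr_gt0 ?ltr0n// addr_gt0// addr_gt0.
pose c := (K `^ p)^-1.
have cpos : 0 < c by rewrite invr_gt0 powR_gt0.
have muB : mu B = (2 ^+ n)%:E by rewrite lebesgue_cube_rV.
exists (2 ^+ n * c); first by rewrite mulr_gt0// exprn_gt0.
move=> v mv v0.
have mO := Om_measurable; have mQ := Qset_measurable.
have mOB : measurable (Om `*` B) by exact: measurableX.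
have OBQ : Om `*` B `<=` Qset Om by move=> z [Oz _]; split => // -[].
have mn2 : measurable_fun setT (fun z => (ndiff s v z ^+ 2)%:E).
  by apply: measurable_fun_EFin_sqr; exact: measurable_ndiff.
have mv2 : measurable_fun setT (fun z : 'rV[R]_n * 'rV[R]_n => (c * v z.1 ^+ 2)%:E).
  apply/measurable_EFinP; apply: measurable_funM => //; apply: measurable_funX.
  exact: (measurableT_comp mv measurable_fst).
apply: (@le_trans _ _ (\int[mu \x mu]_(z in Om `*` B) (c * v z.1 ^+ 2)%:E)%E).
  rewrite le_eqVlt; apply/orP; left; apply/eqP.
  pose h (x : 'rV[R]_n) := (c * (\1_Om x * v x ^+ 2))%:E.
  have h0 x : (0 <= h x)%E by rewrite lee_fin mulr_ge0 ?(ltW cpos)// mulr_ge0// sqr_ge0.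
  rewrite [in RHS]integral_mkcond fubini_tonelli1; last 2 first.
  - by apply/(measurable_restrictT _ _).1 => //; exact: measurable_funS mv2.
  - by move=> z; rewrite patchE; case: ifPn => // _; rewrite lee_fin mulr_ge0 ?sqr_ge0 ?(ltW cpos).
  rewrite /fubini_F [RHS](eq_integral (fun x => h x * (2 ^+ n)%:E)%E); last first.
    move=> x _ /=.
    rewrite (eq_integral (fun y => h x * (\1_B y)%:E)%E); last first.
      move=> y _; rewrite patchE /h in_setX -EFinM /= !indicE.
      by case: (x \in Om); case: (y \in B); rewrite /= ?mul1r ?mul0r ?mulr1 ?mulr0.
    rewrite ge0_integralZl//; last by apply/measurable_EFinP; exact: measurable_indic.
    by rewrite integral_indic// setIT; congr (_ * _)%E; exact: muB.
  have mh : measurable_fun setT h.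
    apply/measurable_EFinP; apply: measurable_funM => //; apply: measurable_funM.
      exact: measurable_indic.
    exact: measurable_funX.
  rewrite ge0_integralZr// [RHS]muleC.
  rewrite EFinM -muleA; congr (_ * _)%E.
  rewrite -ge0_integralZl_EFin ?(ltW cpos)//; last 2 first.
  - by move=> x _; rewrite lee_fin sqr_ge0.
  - by apply: measurable_fun_EFin_sqr; exact: measurable_funS mv.
  rewrite [LHS]integral_mkcond; apply: eq_integral => x _; rewrite patchE /h indicE.
  by case: (x \in Om); rewrite ?mul1r ?mul0r ?mulr0 ?mule0.
apply: (@le_trans _ _ (\int[mu \x mu]_(z in Om `*` B) (ndiff s v z ^+ 2)%:E)%E); last first.
  apply: ge0_subset_integral => //; first exact: measurable_funS mn2.
  by move=> z _; rewrite lee_fin sqr_ge0.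
apply: ae_ge0_le_integral => //.
- by move=> z _; rewrite lee_fin mulr_ge0 ?sqr_ge0 ?(ltW cpos).
- exact: measurable_funS mv2.
- by move=> z _; rewrite lee_fin sqr_ge0.
- exact: measurable_funS mn2.
apply: filterS (ae_prod_snd mu v0) => -[x y] /= v0y [Ox By]; rewrite lee_fin.
rewrite [leRHS]expr2 ndiffM//= v0y; last exact: BU.
rewrite subr0 -expr2 mulrC ler_wpM2l ?sqr_ge0//.
have xy : x != y by apply/eqP => xy; apply: (BU _ By); rewrite -xy; exact: Om_sub_mixed.
have d0 : 0 < enorm (x - y).
  by rewrite (lt_le_trans _ (norm_le_enorm _))// normr_gt0 subr_eq0.
rewrite /c lef_pV2 ?posrE ?powR_gt0// ge0_ler_powR ?nnegrE ?(ltW p0) ?(ltW d0) ?(ltW K0)//.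
rewrite (le_trans (enorm_le_norm _))// ler_wpM2l// (le_trans (ler_normB _ _))//.
rewrite -addrA lerD// ?BM//; exact/UM/Om_sub_mixed.
Qed.

Lemma nonlocal_energyE (s : R) (u v : 'rV[R]_n -> R) : 0 < s ->
  (\int[mu \x mu]_(z in Qset Om) ((u z.1 - u z.2) * (v z.1 - v z.2)
     / enorm (z.1 - z.2) `^ (n%:R + 2 * s))%:E
   = \int[mu \x mu]_(z in Qset Om) (ndiff s u z * ndiff s v z)%:E)%E.
Proof. by move=> s0; apply: eq_integral => z _; rewrite ndiffM. Qed.

(** Bound the power by [powR_le_sqr] with [T] close to the [L2] norm of [v], the choice
    for which both terms have the homogeneity of the left-hand side. *)
Lemma mixed_sobolev_holds (s q : R) : (0 < n)%N -> 0 < s -> 0 < q -> q < 1 ->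
  mixed_sobolev s q Om Nn.
Proof.
move=> n0 s0 q0 q1; have [c c0 cP] := nonlocal_poincare n0 s0.
have mO := Om_measurable; have Ofin := Om_finite.
set p := 1 - q; have p0 : 0 < p by rewrite subr_gt0.
have p1 : p < 1 by rewrite gtrBl.
pose m0 := fine (mu Om).
have m00 : 0 <= m0 by rewrite fine_ge0.
have muE : mu Om = m0%:E by rewrite fineK// ge0_fin_numE.
have m01 : 0 < m0 + 1 by rewrite ltr_wpDl.
pose K := (m0 + 1) `^ (2 / p).
have K0 : 0 < K by rewrite powR_gt0.
exists (c / K); first by rewrite divr_gt0.
move=> v [[[mv vfin] _] _ v0].
have sv : sqint mu Om v by apply: (sqintS measurableT mO) => //; split.
set I := ip mu Om v v.
have IE : (\int[mu]_(x in Om) (v x ^+ 2)%:E)%E = I%:E by exact: ip_EFin.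
have I0 : 0 <= I by exact: ip_ge0.
have mvp : measurable_fun Om (fun x => (`|v x| `^ p)%:E).
  apply/measurable_EFinP; apply: (measurableT_comp (measurable_powR _)).
  by apply: measurableT_comp => //; exact: sv.1.
have key T : 0 < T -> I <= T ^+ 2 ->
    (\int[mu]_(x in Om) (`|v x| `^ p)%:E <= ((m0 + 1) * T `^ p)%:E)%E.
  move=> T0 IT.
  apply: (@le_trans _ _ (\int[mu]_(x in Om) ((T `^ p)%:E + (T `^ (p - 2))%:E * (v x ^+ 2)%:E))%E).
    apply: ge0_le_integral => //.
    - apply: emeasurable_funD => //; apply: emeasurable_funM => //.
      by apply: measurable_fun_EFin_sqr; exact: sv.1.
    - move=> x _; rewrite -EFinM -EFinD lee_fin -[v x ^+ 2]real_normK ?num_real//.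
      exact: powR_le_sqr.
  rewrite ge0_integralD//; last 3 first.
  - by move=> x _; rewrite lee_fin powR_ge0.
  - by move=> x _; rewrite mule_ge0// lee_fin ?powR_ge0 ?sqr_ge0.
  - apply: emeasurable_funM => //.
    by apply: measurable_fun_EFin_sqr; exact: sv.1.
  rewrite ge0_integralZl_EFin ?powR_ge0//; last 2 first.
  - by move=> x _; rewrite lee_fin sqr_ge0.
  - by apply: measurable_fun_EFin_sqr; exact: sv.1.
  rewrite integral_cst// IE [X in (_ * X + _)%E]muE -!EFinM -EFinD lee_fin mulrDl mul1r.
  rewrite mulrC lerD2l (@le_trans _ _ (T `^ (p - 2) * T ^+ 2))// ?ler_wpM2l ?powR_ge0//.
  by rewrite -powR_mulrn ?(ltW T0)// -powRD ?(gt_eqF T0) ?implybT// subrK.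
set A := (\int[mu]_(x in Om) (`|v x| `^ p)%:E)%E in key *.
have A0 : (0 <= A)%E by apply: integral_ge0 => x _; rewrite lee_fin powR_ge0.
have Afin : A \is a fin_num.
  rewrite ge0_fin_numE// (le_lt_trans (key (Num.sqrt (I + 1)) _ _)) ?ltry//.
    by rewrite sqrtr_gt0 ltr_wpDl.
  by rewrite sqr_sqrtr ?lerDl// addr_ge0.
have cIQ : ((c * I)%:E <= \int[mu \x mu]_(z in Qset Om) (ndiff s v z * ndiff s v z)%:E)%E.
  by rewrite EFinM -IE; exact: cP.
apply: (@le_trans _ _ (c * I)%:E); last first.
  rewrite /eta_sq /energy nonlocal_energyE//; apply: (le_trans cIQ); rewrite leeDr//.
  apply: integral_ge0 => x _; rewrite lee_fin; apply: sumr_ge0 => i _.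
  by rewrite -expr2 sqr_ge0.
rewrite -(fineK Afin) poweR_EFin -EFinM lee_fin.
(* The slack [e] keeps [T] positive when the norm vanishes. *)
apply/ler_addgt0Pr => e e0.
pose T := Num.sqrt (I + e / c).
have Ie : 0 < I + e / c by rewrite ltr_wpDl// divr_gt0.
have T0 : 0 < T by rewrite sqrtr_gt0.
have T2 : T ^+ 2 = I + e / c by rewrite sqr_sqrtr// ltW.
have := key _ T0; rewrite T2 lerDl divr_ge0 ?(ltW e0) ?(ltW c0)// => /(_ isT).
rewrite -(fineK Afin) lee_fin => AT.
have fA0 : 0 <= fine A by rewrite fine_ge0.
have : fine A `^ (2 / p) <= K * T ^+ 2.
  apply: (@le_trans _ _ (((m0 + 1) * T `^ p) `^ (2 / p))).
    by rewrite ge0_ler_powR ?nnegrE ?divr_ge0 ?(ltW p0) ?mulr_ge0 ?(ltW m01) ?powR_ge0.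
  rewrite powRM ?(ltW m01) ?powR_ge0// -powRrM mulrCA divff ?gt_eqF// mulr1.
  by rewrite powR_mulrn// ltW.
rewrite T2 => H; rewrite (@le_trans _ _ (c / K * (K * (I + e / c))))//.
  by rewrite ler_wpM2l// divr_ge0 ?(ltW c0) ?(ltW K0).
rewrite [leLHS](_ : _ = c * I + e)//; field.
by rewrite !gt_eqF.
Qed.

End mixed_domain_facts.

(** * The functional and its minimising sequences *)

Section real_arithmetic.
Variable R : realFieldType.
Implicit Types X Y Z A B D m : R.

Lemma midpoint_arith p X Y Z A B D : 0 < p -> 2^-1 * X + 2^-1 * Y <= Z ->
  4^-1 * (A + 2 * B + D) / 2 - Z / p <=
  2^-1 * (A / 2 - X / p) + 2^-1 * (D / 2 - Y / p)
  - 8^-1 * (A + 2 * -1 * B + (-1) ^+ 2 * D).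
Proof.
move=> p0; rewrite -(ler_pM2r (_ : 0 < p^-1)) ?invr_gt0// mulrDl -!mulrA; lra.
Qed.

Lemma cauchy_arith m X Y Z A a b : m <= Z -> X <= m + a -> Y <= m + b ->
  Z <= 2^-1 * X + 2^-1 * Y - 8^-1 * A -> A <= 4 * (a + b).
Proof. lra. Qed.

End real_arithmetic.

Section test_energies.
Context {R : realType} {n : nat}.
Local Notation mu := (lebesgue_rV R n).
Variables (s p : R) (Om : set 'rV[R]_n).
Implicit Types (u v w phi psi : 'rV[R]_n -> R).

(** The gradients are arguments, because those of the limit function will only be weak. *)
Definition energy_form (g h : 'I_n -> 'rV[R]_n -> R) u v : R :=
  \sum_i ip mu Om (g i) (h i) + ip (mu \x mu)%E (Qset Om) (ndiff s u) (ndiff s v).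

Definition test_energy phi psi : R := energy_form (pderiv^~ phi) (pderiv^~ psi) phi psi.

Definition functional phi : R :=
  test_energy phi phi / 2 - (\int[mu]_(x in Om) (phi x `^ p)) / p.

Definition nonneg_test phi : Prop := test_function Om phi /\ forall x, 0 <= phi x.

Hypotheses (oOm : open Om) (Ofin : (mu Om < +oo)%E).
Hypotheses (n2 : (2 <= n)%N) (s0 : 0 < s) (s1 : s < 1) (p0 : 0 < p) (p1 : p < 1).

Let mO : measurable Om. Proof. exact: open_measurable_rV. Qed.

Let mQ : measurable (Qset Om).
Proof. by apply: measurableD => //; apply: measurableX; exact: measurableC. Qed.

Lemma test_sqint_ndiff phi : test_function Om phi ->
  sqint (mu \x mu)%E (Qset Om) (ndiff s phi).
Proof. by move=> tp; exact: (sqintS measurableT mQ (@subsetT _ _) (test_ndiff_sqint n2 s0 s1 tp)). Qed.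

Lemma test_sqint_pderiv i phi : test_function Om phi -> sqint mu Om (pderiv i phi).
Proof. by move=> tp; exact: (test_sqint mO (test_pderiv i tp)). Qed.

Lemma pderiv_lin i (t : R) phi psi : smooth phi -> smooth psi ->
  pderiv i (fun x => phi x + t * psi x) = fun x => pderiv i phi x + t * pderiv i psi x.
Proof.
move=> sp sq; have st : smooth (fun x => t * psi x) by apply: smoothM => //; exact: smooth_cst.
apply/funext => x; rewrite /pderiv.
rewrite (@deriveD _ _ _ phi (fun x => t * psi x)); [|exact: smooth_derivable|exact: smooth_derivable].
congr (_ + _); rewrite (@deriveM _ _ (cst t) psi); [|exact: derivable_cst|exact: smooth_derivable].
by rewrite derive_cst scaler0 addr0.
Qed.

Lemma ndiff_lin (t : R) u v :
  ndiff s (fun x => u x + t * v x) = fun z => ndiff s u z + t * ndiff s v z.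
Proof. by apply/funext => z; rewrite /ndiff; ring. Qed.

Lemma test_lin (t : R) phi psi : test_function Om phi -> test_function Om psi ->
  test_function Om (fun x => phi x + t * psi x).
Proof. by move=> tp tq; apply: (test_add tp); exact: test_scale. Qed.

Lemma energy_form_sqrD (t : R) (g h : 'I_n -> 'rV[R]_n -> R) u v :
  (forall i, sqint mu Om (g i)) -> (forall i, sqint mu Om (h i)) ->
  sqint (mu \x mu)%E (Qset Om) (ndiff s u) -> sqint (mu \x mu)%E (Qset Om) (ndiff s v) ->
  energy_form (fun i x => g i x + t * h i x) (fun i x => g i x + t * h i x)
    (fun x => u x + t * v x) (fun x => u x + t * v x)
  = energy_form g g u u + 2 * t * energy_form g h u v + t ^+ 2 * energy_form h h v v.
Proof.
move=> sg sh su sv; rewrite /energy_form ndiff_lin (ip_sqrD mQ t su sv).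
under eq_bigr do rewrite (ip_sqrD mO t (sg _) (sh _)).
rewrite 2!big_split/= -!mulr_sumr; ring.
Qed.

Lemma test_energy_sqrD (t : R) phi psi : test_function Om phi -> test_function Om psi ->
  let f := fun x => phi x + t * psi x in
  test_energy f f = test_energy phi phi + 2 * t * test_energy phi psi + t ^+ 2 * test_energy psi psi.
Proof.
move=> tp tq f.
have E : pderiv^~ f = fun i x => pderiv i phi x + t * pderiv i psi x.
  by apply/funext => i; apply: pderiv_lin; [exact: (test_smooth tp)|exact: (test_smooth tq)].
rewrite /test_energy E; apply: energy_form_sqrD.
- by move=> i; exact: test_sqint_pderiv.
- by move=> i; exact: test_sqint_pderiv.
- exact: test_sqint_ndiff.
- exact: test_sqint_ndiff.
Qed.

Lemma test_energy_ge0 phi : 0 <= test_energy phi phi.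
Proof. by rewrite addr_ge0 ?ip_ge0//; apply: sumr_ge0 => i _; exact: ip_ge0. Qed.

Lemma pow_integrable u : (forall x, Om x -> 0 <= u x) -> sqint mu Om u ->
  mu.-integrable Om (EFin \o (fun x => u x `^ p)).
Proof.
move=> u0 su; apply: (sqint_le_integrable mO _ _ su (sqint_cst mO Ofin 1)).
  by apply: (measurableT_comp (measurable_powR _)); exact: su.1.
move=> x Ox; rewrite ger0_norm ?powR_ge0// expr1n addrC.
have := powR_le_sqr p0 p1 (ltr01 : 0 < 1 :> R) (u0 x Ox).
by rewrite !powR1 mul1r.
Qed.

Variable c : R.
Hypothesis c0 : 0 < c.
Hypothesis cP : forall phi, test_function Om phi ->
  c * ip mu Om phi phi <= ip (mu \x mu)%E (Qset Om) (ndiff s phi) (ndiff s phi).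

Lemma poincare_test_energy phi : test_function Om phi -> c * ip mu Om phi phi <= test_energy phi phi.
Proof.
move=> tp; rewrite (le_trans (cP tp))// lerDr; apply: sumr_ge0 => i _; exact: ip_ge0.
Qed.

(** The power term is absorbed in a quarter of the energy: take [T] in [powR_le_sqr] such
    that the coefficient of the square is [c p / 4]. *)
Lemma functional_coercive : exists b : R, forall phi, nonneg_test phi ->
  test_energy phi phi / 4 - b <= functional phi.
Proof.
pose T : R := (c * p / 4) `^ (p - 2)^-1.
have cp : 0 < c * p / 4 by rewrite divr_gt0// mulr_gt0.
have T0 : 0 < T by rewrite powR_gt0.
have TE : T `^ (p - 2) = c * p / 4.
  by rewrite -powRrM mulVf ?powRr1 ?(ltW cp)// subr_eq0 lt_eqF// (lt_trans p1)// ltr1n.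
exists (T `^ p * fine (mu Om) / p) => phi [tp phi0].
have sp : sqint mu Om phi by exact: test_sqint tp.
have ip1 := pow_integrable (fun x _ => phi0 x) sp.
have iT : mu.-integrable Om (EFin \o (fun x => T `^ (p - 2) * (phi x * phi x))).
  exact: (integrableZl mO _ (sqint_mul_integrable mO sp sp)).
have iC : mu.-integrable Om (EFin \o (fun x => T `^ p)).
  exact: sqint_integrable (sqint_cst mO Ofin _).
have G_le : \int[mu]_(x in Om) (phi x `^ p) <= T `^ p * fine (mu Om) + T `^ (p - 2) * ip mu Om phi phi.
  rewrite /ip -RintegralZl//; last exact: sqint_mul_integrable.
  rewrite -Rintegral_cst// -RintegralD//; apply: le_Rintegral => //.
    exact: (integrableD mO iC iT).
  by move=> x _; rewrite -expr2; exact: powR_le_sqr.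
have := poincare_test_energy tp; rewrite /functional; rewrite TE in G_le.
have : (\int[mu]_(x in Om) (phi x `^ p)) / p <= T `^ p * fine (mu Om) / p + c / 4 * ip mu Om phi phi.
  rewrite ler_pdivrMr// mulrDl divfK ?gt_eqF// (le_trans G_le)// lerD2l.
  by rewrite [leLHS](_ : _ = c / 4 * ip mu Om phi phi * p)//; ring.
lra.
Qed.

(** The parallelogram law for the energy and [powR_midpoint] for the power. *)
Lemma functional_midpoint phi psi : nonneg_test phi -> nonneg_test psi ->
  functional (fun x => 2^-1 * phi x + 2^-1 * psi x) <=
  2^-1 * functional phi + 2^-1 * functional psi
  - 8^-1 * test_energy (fun x => phi x + -1 * psi x) (fun x => phi x + -1 * psi x).
Proof.
move=> [tp phi0] [tq psi0].
have th : test_function Om (fun x => 2^-1 * phi x) by exact: test_scale.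
have Emid : test_energy (fun x => 2^-1 * phi x + 2^-1 * psi x) (fun x => 2^-1 * phi x + 2^-1 * psi x)
   = 4^-1 * (test_energy phi phi + 2 * test_energy phi psi + test_energy psi psi).
  have tpq : test_function Om (fun x => phi x + 1 * psi x) by exact: test_lin.
  have := test_energy_sqrD (- 2^-1) tpq tpq; rewrite (test_energy_sqrD 1 tp tq).
  rewrite (_ : (fun x => phi x + 1 * psi x + - 2^-1 * (phi x + 1 * psi x)) =
               (fun x => 2^-1 * phi x + 2^-1 * psi x)); first by move=> ->; field.
  by apply/funext => x; field.
rewrite (test_energy_sqrD (-1) tp tq).
have G_ge : 2^-1 * \int[mu]_(x in Om) (phi x `^ p) + 2^-1 * \int[mu]_(x in Om) (psi x `^ p)
    <= \int[mu]_(x in Om) ((2^-1 * phi x + 2^-1 * psi x) `^ p).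
  have i1 := pow_integrable (fun x _ => phi0 x) (test_sqint mO tp).
  have i2 := pow_integrable (fun x _ => psi0 x) (test_sqint mO tq).
  have i3 : mu.-integrable Om (EFin \o (fun x => (2^-1 * phi x + 2^-1 * psi x) `^ p)).
    apply: pow_integrable; last exact/(test_sqint mO)/test_lin.
    by move=> x _; rewrite addr_ge0 ?mulr_ge0.
  have j1 := integrableZl mO 2^-1 i1.
  have j2 := integrableZl mO 2^-1 i2.
  rewrite -!RintegralZl// -RintegralD//; apply: le_Rintegral => //.
    exact: (integrableD mO j1 j2).
  by move=> x _; exact: powR_midpoint.
rewrite /functional Emid.
exact: midpoint_arith.
Qed.

Lemma minimizing_sequence : exists (m : R) (u : nat -> 'rV[R]_n -> R),
  [/\ forall phi, nonneg_test phi -> m <= functional phi,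
      forall k, nonneg_test (u k) &
      forall k, functional (u k) <= m + 4^-1 ^+ k].
Proof.
have [b bP] := functional_coercive.
pose S := [set functional phi | phi in nonneg_test].
have S0 : S !=set0 by exists (functional (fun=> 0)), (fun=> 0) => //; split => //; exact: test0.
have lS : has_lbound S.
  exists (- b) => _ [phi Cp <-]; rewrite (le_trans _ (bP _ Cp))//.
  by rewrite lerDr divr_ge0// test_energy_ge0.
have hS : has_inf S by [].
have /choice[u uP] k : exists phi, nonneg_test phi /\ functional phi <= inf S + 4^-1 ^+ k.
  have e0 : 0 < 4^-1 ^+ k :> R by rewrite exprn_gt0.
  have [_ [phi Cp <-] /ltW H] := inf_adherent e0 hS.
  by exists phi.
exists (inf S), u; split => [phi Cp|k|k]; [|exact: (uP k).1|exact: (uP k).2].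
by apply: ge_inf => //; exists phi.
Qed.

(** The midpoint of [u j] and [u k] cannot do better than [m]. *)
Lemma minimizing_cauchy (m : R) (u : nat -> 'rV[R]_n -> R) :
  (forall phi, nonneg_test phi -> m <= functional phi) ->
  (forall k, nonneg_test (u k)) -> (forall k, functional (u k) <= m + 4^-1 ^+ k) ->
  forall j k, test_energy (fun x => u j x + -1 * u k x) (fun x => u j x + -1 * u k x)
    <= 4 * (4^-1 ^+ j + 4^-1 ^+ k).
Proof.
move=> mJ Cu Ju j k.
apply: cauchy_arith (Ju j) (Ju k) (functional_midpoint (Cu j) (Cu k)); apply: mJ.
split; first by apply: test_lin; [apply: test_scale|]; exact: (Cu _).1.
by move=> x; rewrite addr_ge0// mulr_ge0// (Cu _).2.
Qed.

End test_energies.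

(** * The limit of a minimising sequence *)

Section minimizing_limit.
Context {R : realType} {n : nat}.
Local Notation mu := (lebesgue_rV R n).
Local Notation mu2 := ((lebesgue_rV R n) \x (lebesgue_rV R n))%E.
Variables (s c : R) (Om : set 'rV[R]_n).
Hypotheses (oOm : open Om) (n2 : (2 <= n)%N) (s0 : 0 < s) (s1 : s < 1) (c0 : 0 < c).
Hypothesis cP : forall phi, test_function Om phi ->
  c * ip mu Om phi phi <= ip mu2 (Qset Om) (ndiff s phi) (ndiff s phi).
Variable u_ : nat -> 'rV[R]_n -> R.
Hypothesis u_test : forall k, nonneg_test Om (u_ k).
Hypothesis u_cauchy : forall j k,
  test_energy s Om (fun x => u_ j x + -1 * u_ k x) (fun x => u_ j x + -1 * u_ k x)
  <= 4 * (4^-1 ^+ j + 4^-1 ^+ k).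

Definition limit_grad (i : 'I_n) : 'rV[R]_n -> R := limsup_fun (fun k => pderiv i (u_ k)).

Local Notation u := (limsup_fun u_).
Local Notation g := limit_grad.

Let mO : measurable Om. Proof. exact: open_measurable_rV. Qed.

Let mQ : measurable (Qset Om).
Proof. by apply: measurableD => //; apply: measurableX; exact: measurableC. Qed.

Let tu k : test_function Om (u_ k). Proof. exact: (u_test k).1. Qed.

Let tdiff j k : test_function Om (fun x => u_ j x + -1 * u_ k x).
Proof. exact: test_lin. Qed.

Lemma limit_off x : ~ Om x -> u x = 0.
Proof.
move=> nO; apply: limsup_fun_cvg.
rewrite (_ : (fun k => _) = fun=> 0); first exact: cvg_cst.
by apply/funext => k; exact: test_eq0 (tu k) nO.
Qed.

Lemma limit_grad_off i x : ~ Om x -> g i x = 0.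
Proof.
move=> nO; apply: limsup_fun_cvg.
rewrite (_ : (fun k => _) = fun=> 0); first exact: cvg_cst.
by apply/funext => k; exact: test_eq0 (test_pderiv i (tu k)) nO.
Qed.

Lemma limit_measurable : measurable_fun setT u.
Proof. by apply: measurable_limsup_fun => // k; exact: test_measurable (tu k). Qed.

Lemma limit_grad_measurable i : measurable_fun setT (g i).
Proof. by apply: measurable_limsup_fun => // k; exact: test_measurable (test_pderiv i (tu k)). Qed.

Lemma limit_ge0 x : 0 <= u x.
Proof.
apply: fine_ge0; rewrite limn_esup_lim; apply: lime_ge; first exact: is_cvg_esups.
apply: nearW => k; apply: (@le_trans _ _ (u_ k x)%:E).
  by rewrite lee_fin; exact: (u_test k).2.
by apply: ereal_sup_ubound; exists k => /=.
Qed.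

Lemma ip_le_energy phi : test_function Om phi -> ip mu Om phi phi <= test_energy s Om phi phi / c.
Proof. by move=> tp; rewrite ler_pdivlMr// mulrC; exact: poincare_test_energy. Qed.

Lemma ip_pderiv_le_energy i phi : ip mu Om (pderiv i phi) (pderiv i phi) <= test_energy s Om phi phi.
Proof.
rewrite /test_energy /energy_form; apply: (@le_trans _ _ (\sum_j ip mu Om (pderiv j phi) (pderiv j phi))).
  by rewrite (bigD1 i)//= lerDl; apply: sumr_ge0 => j _; exact: ip_ge0.
by rewrite lerDl ip_ge0.
Qed.

Lemma ip_ndiff_le_energy phi : ip mu2 (Qset Om) (ndiff s phi) (ndiff s phi) <= test_energy s Om phi phi.
Proof. by rewrite /test_energy /energy_form lerDr; apply: sumr_ge0 => j _; exact: ip_ge0. Qed.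

Lemma limit_cvg_Om :
  {ae mu, forall x, Om x -> u_ k x @[k --> \oo] --> u x} /\
  forall k, (\int[mu]_(x in Om) ((u x - u_ k x) ^+ 2)%:E <= (4 / c * 4^-1 ^+ k)%:E)%E.
Proof.
apply: rapidly_cauchy_limit => //; first by rewrite divr_ge0// ltW.
  by move=> k; exact: measurable_funS (test_measurable (tu k)).
move=> j k; rewrite (eq_integral (fun x => ((u_ j x + -1 * u_ k x) ^+ 2)%:E)); last first.
  by move=> x _; rewrite mulN1r.
rewrite (ip_EFin mO (test_sqint mO (tdiff j k))) lee_fin.
apply: (le_trans (ip_le_energy (tdiff j k))).
by rewrite mulrAC ler_pM2r ?invr_gt0//; exact: u_cauchy.
Qed.

Lemma limit_grad_cvg_Om i :
  {ae mu, forall x, Om x -> pderiv i (u_ k) x @[k --> \oo] --> g i x} /\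
  forall k, (\int[mu]_(x in Om) ((g i x - pderiv i (u_ k) x) ^+ 2)%:E <= (4 * 4^-1 ^+ k)%:E)%E.
Proof.
apply: rapidly_cauchy_limit => //.
  by move=> k; exact: measurable_funS (test_measurable (test_pderiv i (tu k))).
move=> j k; rewrite (eq_integral (fun x => (pderiv i (fun x => u_ j x + -1 * u_ k x) x ^+ 2)%:E)); last first.
  move=> x _; rewrite pderiv_lin; [|exact: (test_smooth (tu j))|exact: (test_smooth (tu k))].
  by rewrite mulN1r.
rewrite (ip_EFin mO (test_sqint mO (test_pderiv i (tdiff j k)))) lee_fin.
exact: (le_trans (ip_pderiv_le_energy i _) (u_cauchy j k)).
Qed.

Lemma limit_cvg : {ae mu, forall x, u_ k x @[k --> \oo] --> u x}.
Proof.
apply: filterS limit_cvg_Om.1 => x H; have [/H//|nO] := pselect (Om x).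
rewrite limit_off// (_ : (fun k => _) = fun=> 0); first exact: cvg_cst.
by apply/funext => k; exact: test_eq0 (tu k) nO.
Qed.

Lemma sqint_of_dist d (T : measurableType d) (m : {measure set T -> \bar R}) (D : set T)
    (f h : T -> R) (b : R) : measurable D -> measurable_fun D f -> sqint m D h ->
  (\int[m]_(x in D) ((f x - h x) ^+ 2)%:E <= b%:E)%E ->
  sqint m D f /\ ip m D (fun x => f x - h x) (fun x => f x - h x) <= b.
Proof.
move=> mD mf sh fb.
have sd : sqint m D (fun x => f x - h x).
  split; first by apply: measurable_funB => //; exact: sh.1.
  by apply: le_lt_trans fb _; exact: ltry.
split; last by move: fb; rewrite (ip_EFin mD sd) lee_fin.
rewrite (_ : f = fun x => (f x - h x) + h x); first exact: sqintD.
by apply/funext => x; rewrite subrK.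
Qed.

Lemma limit_sqint : sqint mu Om u.
Proof.
have [|//] := sqint_of_dist mO _ (test_sqint mO (tu 0)) (limit_cvg_Om.2 0%N).
exact: measurable_funS limit_measurable.
Qed.

Lemma limit_dist k : ip mu Om (fun x => u x - u_ k x) (fun x => u x - u_ k x) <= 4 / c * 4^-1 ^+ k.
Proof.
have [|//] := sqint_of_dist mO _ (test_sqint mO (tu k)) (limit_cvg_Om.2 k).
exact: measurable_funS limit_measurable.
Qed.

Lemma limit_grad_sqint i : sqint mu Om (g i).
Proof.
have [|//] := sqint_of_dist mO _ (test_sqint mO (test_pderiv i (tu 0))) ((limit_grad_cvg_Om i).2 0%N).
exact: measurable_funS (limit_grad_measurable i).
Qed.

Lemma limit_grad_dist i k :
  ip mu Om (fun x => g i x - pderiv i (u_ k) x) (fun x => g i x - pderiv i (u_ k) x) <= 4 * 4^-1 ^+ k.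
Proof.
have [|//] := sqint_of_dist mO _ (test_sqint mO (test_pderiv i (tu k))) ((limit_grad_cvg_Om i).2 k).
exact: measurable_funS (limit_grad_measurable i).
Qed.

Lemma limit_cvg_pair : {ae mu2, forall z, u_ k z.1 @[k --> \oo] --> u z.1 /\
  u_ k z.2 @[k --> \oo] --> u z.2}.
Proof. exact: filterS2 (ae_prod_fst mu limit_cvg) (ae_prod_snd mu limit_cvg). Qed.

Lemma ndiff_cvg : {ae mu2, forall z, ndiff s (u_ k) z @[k --> \oo] --> ndiff s u z}.
Proof.
apply: filterS limit_cvg_pair => z [z1 z2]; rewrite /ndiff.
by apply: cvgM; [exact: cvgB|exact: cvg_cst].
Qed.

Lemma geo4_cvg (C a : R) : C * (4^-1 ^+ j + a) @[j --> \oo] --> C * a.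
Proof.
rewrite -[in X in _ --> X](add0r a).
apply: cvgM; first exact: cvg_cst.
apply: cvgD; last exact: cvg_cst.
by apply: cvg_expr; rewrite ger0_norm// invf_lt1// ltr1n.
Qed.

(** The differences converge a.e. because the functions do; the rate of the Cauchy
    sequence is inherited by Fatou's lemma. *)
Lemma ndiff_cvg_int k :
  (\int[mu2]_(z in Qset Om) ((ndiff s u z - ndiff s (u_ k) z) ^+ 2)%:E <= (4 * 4^-1 ^+ k)%:E)%E.
Proof.
have mn f : measurable_fun setT f -> measurable_fun (Qset Om) (ndiff s f).
  by move=> mf; apply: measurable_funTS; exact: measurable_ndiff.
apply: (@fatou_cvg _ _ _ mu2 _ mQ (fun j z => ((ndiff s (u_ j) z - ndiff s (u_ k) z) ^+ 2)%:E) _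
  (fun j => 4 * (4^-1 ^+ j + 4^-1 ^+ k))).
- move=> j; apply: measurable_fun_EFin_sqr; apply: measurable_funB.
    exact: mn (test_measurable (tu j)).
  exact: mn (test_measurable (tu k)).
- by move=> j z _; rewrite lee_fin sqr_ge0.
- apply: measurable_fun_EFin_sqr; apply: measurable_funB.
    exact: mn limit_measurable.
  exact: mn (test_measurable (tu k)).
- by move=> z _; rewrite lee_fin sqr_ge0.
- apply: filterS ndiff_cvg => z H _.
  apply: cvg_EFin; first exact: nearW.
  apply: (@cvg_comp _ _ _ (fun j => ndiff s (u_ j) z - ndiff s (u_ k) z) (fun y => y ^+ 2)).
    by apply: cvgB; [exact: H|exact: cvg_cst].
  exact: exprn_continuous.
- move=> j.
  rewrite (eq_integral (fun z => (ndiff s (fun x => u_ j x + -1 * u_ k x) z ^+ 2)%:E)); last first.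
    by move=> z _; rewrite ndiff_lin mulN1r.
  rewrite (ip_EFin mQ (test_sqint_ndiff oOm n2 s0 s1 (tdiff j k))) lee_fin.
  exact: (le_trans (ip_ndiff_le_energy _) (u_cauchy j k)).
- exact: geo4_cvg.
Qed.

Lemma limit_ndiff_sqint : sqint mu2 (Qset Om) (ndiff s u).
Proof.
have [|//] := sqint_of_dist mQ _ (test_sqint_ndiff oOm n2 s0 s1 (tu 0)) (ndiff_cvg_int 0%N).
by apply: measurable_funTS; apply: measurable_ndiff; exact: limit_measurable.
Qed.

Lemma limit_ndiff_dist k :
  ip mu2 (Qset Om) (fun z => ndiff s u z - ndiff s (u_ k) z)
    (fun z => ndiff s u z - ndiff s (u_ k) z) <= 4 * 4^-1 ^+ k.
Proof.
have [|//] := sqint_of_dist mQ _ (test_sqint_ndiff oOm n2 s0 s1 (tu k)) (ndiff_cvg_int k).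
by apply: measurable_funTS; apply: measurable_ndiff; exact: limit_measurable.
Qed.

Lemma geo4_cvg0 (C : R) : C * 4^-1 ^+ j @[j --> \oo] --> (0 : R).
Proof.
rewrite -[X in _ --> X](mulr0 C); apply: cvgM; first exact: cvg_cst.
by apply: cvg_expr; rewrite ger0_norm// invf_lt1// ltr1n.
Qed.

(** Strong convergence of the gradients and of the differences implies the weak one. *)
Lemma test_energy_cvg phi : test_function Om phi ->
  test_energy s Om (u_ k) phi @[k --> \oo] --> energy_form s Om g (pderiv^~ phi) u phi.
Proof.
move=> tp; rewrite /test_energy /energy_form; apply: cvgD.
  apply: cvg_big => [|i _]; first exact: add_continuous.
  apply: (ip_cvg mO _ (limit_grad_sqint i) (test_sqint mO (test_pderiv i tp))
    (limit_grad_dist i) (geo4_cvg0 _)).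
  by move=> k; exact: test_sqint (test_pderiv i (tu k)).
apply: (ip_cvg mQ _ limit_ndiff_sqint (test_sqint_ndiff oOm n2 s0 s1 tp)
  limit_ndiff_dist (geo4_cvg0 _)).
by move=> k; exact: test_sqint_ndiff (tu k).
Qed.

End minimizing_limit.

(** * Perturbations of the minimising sequence *)

Section blow_up.
Context {R : realType}.

(** Used at the zeros of the limit, which [lower_limit] thereby excludes. *)
Lemma powR_cvg_pinfty (a : R) (y : nat -> R) : a < 0 -> (forall k, 0 < y k) ->
  y k @[k --> \oo] --> (0 : R) -> (y k `^ a)%:E @[k --> \oo] --> +oo%E.
Proof.
move=> a0 y0 yc; apply/cvgeryP/cvgryPge => A.
pose B := `|A| + 1; have B0 : 0 < B by rewrite ltr_wpDl.
pose d := B `^ a^-1; have d0 : 0 < d by rewrite powR_gt0.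
move/cvgr0Pnorm_le : yc => /(_ _ d0); apply: filterS => k.
rewrite gtr0_norm ?y0// => yd.
apply: (@le_trans _ _ B); first by rewrite (le_trans (ler_norm _))// lerDl.
have -> : B = (d `^ (- a))^-1.
  by rewrite -powRN opprK -powRrM mulVf ?lt_eqF// powRr1// ltW.
have -> : y k `^ a = (y k `^ (- a))^-1 by rewrite -powRN opprK.
rewrite lef_pV2 ?posrE ?powR_gt0//.
by apply: ge0_ler_powR; rewrite ?nnegrE ?oppr_ge0 ?(ltW a0) ?(ltW d0) ?(ltW (y0 k)).
Qed.

Lemma quasi_min_arith (p t m a b c P Q e : R) :
  m <= (a + 2 * t * b + t ^+ 2 * c) / 2 - Q / p -> a / 2 - P / p <= m + e ->
  (Q - P) / p <= t * b + t ^+ 2 / 2 * c + e.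
Proof. rewrite mulrBl; nra. Qed.

Lemma lerD_lin3 (a b S1 A1 B1 C1 S2 A2 B2 C2 : R) :
  S1 <= A1 + a * B1 + b * C1 -> S2 <= A2 + a * B2 + b * C2 ->
  S1 + S2 <= (A1 + A2) + a * (B1 + B2) + b * (C1 + C2).
Proof. by rewrite !mulrDr; lra. Qed.

Lemma lerD_lin2 (a b S1 B1 C1 S2 B2 C2 : R) :
  S1 <= a * B1 + b * C1 -> S2 <= a * B2 + b * C2 ->
  S1 + S2 <= a * (B1 + B2) + b * (C1 + C2).
Proof. by rewrite !mulrDr; lra. Qed.

End blow_up.

Section damped_square.
Context d (T : measurableType d) (R : realType) (mu : {measure set T -> \bar R}).
Variables (D : set T) (mD : measurable D).
Implicit Types (f h w z : T -> R).

Lemma ip_damped_cvg (a_ : nat -> T -> R) (a h : T -> R) :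
  (forall k, measurable_fun D (a_ k)) -> (forall k x, D x -> `|a_ k x| <= 1) ->
  measurable_fun D a -> {ae mu, forall x, D x -> a_ k x @[k --> \oo] --> a x} ->
  sqint mu D h ->
  ip mu D (fun x => a_ k x * h x) (fun x => a_ k x * h x) @[k --> \oo]
    --> ip mu D (fun x => a x * h x) (fun x => a x * h x).
Proof.
move=> ma_ a1 ma aa sh.
pose F k x := ((a_ k x * h x) * (a_ k x * h x))%:E.
pose G x := ((a x * h x) * (a x * h x))%:E.
have mG : measurable_fun D G.
  by apply/measurable_EFinP; apply: measurable_funM; apply: measurable_funM => //; exact: sh.1.
have mF k : measurable_fun D (F k).
  by apply/measurable_EFinP; apply: measurable_funM; apply: measurable_funM => //; exact: sh.1.
have FG : {ae mu, forall x, D x -> F k x @[k --> \oo] --> G x}.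
  apply: filterS aa => x ax Dx; apply: cvg_EFin; first exact: nearW.
  have H : a_ k x * h x @[k --> \oo] --> a x * h x.
    by apply: cvgM; [exact: ax|exact: cvg_cst].
  exact: (cvgM H H).
have ih := sqint_sqr_integrable sh.
have dom : {ae mu, forall x k, D x -> (`|F k x| <= (h x ^+ 2)%:E)%E}.
  apply: aeW => x k Dx; rewrite /F /= lee_fin -expr2 ger0_norm ?sqr_ge0// exprMn.
  by rewrite ler_piMl ?sqr_ge0// -real_normK ?num_real// exprn_ile1// a1.
have [iG H] : mu.-integrable D G /\ [sequence (\int[mu]_(x in D) F k x)%E]_k @ \oo --> (\int[mu]_(x in D) G x)%E.
  by have [? ? ?] := dominated_convergence mD mF mG FG ih dom.
apply: fine_cvg; rewrite fineK//; exact: integrable_fin_num.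
Qed.

(** [w] replaces [h] up to an error that is bounded by [|f| |z|]; Young's inequality
    makes it a small multiple of the square of [f] plus a multiple of that of [z]. *)
Lemma ip_young_lower (l : R) f h w z : 0 < l ->
  sqint mu D f -> sqint mu D h -> sqint mu D w -> sqint mu D z ->
  (forall x, D x -> f x * h x - `|f x| * `|z x| <= f x * w x) ->
  ip mu D f h <= ip mu D f w + l / 2 * ip mu D f f + (2 * l)^-1 * ip mu D z z.
Proof.
move=> l0 sf sh sw sz H.
have i1 := sqint_mul_integrable mD sf sw.
have i2 := integrableZl mD (l / 2) (sqint_mul_integrable mD sf sf).
have i3 := integrableZl mD (2 * l)^-1 (sqint_mul_integrable mD sz sz).
have i12 := integrableD mD i1 i2; have i123 := integrableD mD i12 i3.
rewrite /ip -(RintegralZl _ mD (sqint_mul_integrable mD sf sf)).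
rewrite -(RintegralZl _ mD (sqint_mul_integrable mD sz sz)).
rewrite -(RintegralD mD i1 i2) -(RintegralD mD i12 i3).
apply: le_Rintegral => //; first exact: sqint_mul_integrable.
move=> x Dx; have := H x Dx.
suff : `|f x| * `|z x| <= l / 2 * (f x * f x) + (2 * l)^-1 * (z x * z x) by lra.
rewrite -!expr2 -[f x ^+ 2]real_normK ?num_real// -[z x ^+ 2]real_normK ?num_real//.
move: `|f x| `|z x| => a b; rewrite -subr_ge0.
have -> : l / 2 * a ^+ 2 + (2 * l)^-1 * b ^+ 2 - a * b = (2 * l)^-1 * (l * a - b) ^+ 2.
  by field; rewrite gt_eqF.
by rewrite mulr_ge0 ?sqr_ge0// invr_ge0 mulr_ge0// ltW.
Qed.

Lemma ip_sqr_le (K : R) f h w : sqint mu D f -> sqint mu D h -> sqint mu D w ->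
  (forall x, D x -> `|w x| <= `|h x| + K * `|f x|) ->
  ip mu D w w <= 2 * ip mu D h h + 2 * K ^+ 2 * ip mu D f f.
Proof.
move=> sf sh sw H.
have i1 := integrableZl mD 2 (sqint_mul_integrable mD sh sh).
have i2 := integrableZl mD (2 * K ^+ 2) (sqint_mul_integrable mD sf sf).
rewrite /ip -(RintegralZl _ mD (sqint_mul_integrable mD sf sf)).
rewrite -(RintegralZl _ mD (sqint_mul_integrable mD sh sh)) -(RintegralD mD i1 i2).
apply: le_Rintegral => //; first exact: sqint_mul_integrable.
  exact: (integrableD mD i1 i2).
move=> x Dx; have := H x Dx; rewrite -!expr2.
rewrite -[f x ^+ 2]real_normK ?num_real// -[h x ^+ 2]real_normK ?num_real//.
rewrite -[w x ^+ 2]real_normK ?num_real//.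
have := normr_ge0 (w x); move: `|f x| `|h x| `|w x| => a b r r0 rb.
have : r ^+ 2 <= (b + K * a) ^+ 2 by rewrite lerXn2r ?nnegrE// (le_trans r0).
move=> /le_trans; apply; rewrite -subr_ge0.
rewrite [leRHS](_ : _ = (b - K * a) ^+ 2) ?sqr_ge0//; ring.
Qed.

End damped_square.

Section truncated_product.
Context {R : realType}.
Implicit Types a b p x y v d M : R.

(** Multiplication by this factor turns a test function into an admissible direction of
    decrease: it is at most [a / d], while it tends to 1 as [d] tends to 0 if [a > 0]. *)
Definition trunc d a := a * (a + d)^-1.

(** [trunc d] is nondecreasing and differs from 1 by [d / (a + d)]; this is the nonlocal
    counterpart of [trunc_grad_lower]. *)
Lemma trunc_lower d a b x y : 0 < d -> 0 <= a -> 0 <= b -> 0 <= x -> 0 <= y ->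
  (a - b) * (x - y) - `|a - b| * `|d / (Num.max a b + d) * (x - y)|
  <= (a - b) * (x * trunc d a - y * trunc d b).
Proof.
move=> d0.
wlog ab : a b x y / b <= a.
  move=> W a0 b0 x0 y0; case/orP: (le_total b a) => ab; first exact: W.
  have := W b a y x ab b0 a0 y0 x0; rewrite maxC.
  rewrite -(opprB a b) -(opprB x y) !mulrN !normrN !mulNr opprK.
  by rewrite -mulrN opprB.
move=> a0 b0 x0 y0; rewrite (max_idPl ab).
have ad : 0 < a + d by rewrite ltr_wpDl.
have bd : 0 < b + d by rewrite ltr_wpDl.
have th : trunc d b <= trunc d a.
  by rewrite /trunc ler_pdivrMr// mulrAC ler_pdivlMr//; nra.
have tE : trunc d a = 1 - d / (a + d) by rewrite /trunc; field; rewrite gt_eqF.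
have dab : 0 <= a - b by rewrite subr_ge0.
have e0 : 0 <= d / (a + d) by rewrite divr_ge0 ?ltW.
rewrite (ger0_norm dab) normrM (ger0_norm e0) -mulrBr ler_wpM2l//.
have h1 : d / (a + d) * (x - y) <= d / (a + d) * `|x - y| by rewrite ler_wpM2l// ler_norm.
have h2 : y * trunc d b <= y * trunc d a by rewrite ler_wpM2l.
rewrite tE in h2 *; move: (d / (a + d)) (trunc d b) h1 h2 => e tb h1 h2; lra.
Qed.

Lemma trunc_bound d M a b x y : 0 < d -> 0 <= a -> 0 <= b -> 0 <= y -> y <= M ->
  `|x * trunc d a - y * trunc d b| <= `|x - y| + M / d * `|a - b|.
Proof.
move=> d0 a0 b0 y0 yM.
have ad : 0 < a + d by rewrite ltr_wpDl.
have bd : 0 < b + d by rewrite ltr_wpDl.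
have -> : x * trunc d a - y * trunc d b = trunc d a * (x - y) + y * (d / ((a + d) * (b + d)) * (a - b)).
  by rewrite /trunc; field; rewrite !gt_eqF.
have t1 : 0 <= trunc d a <= 1.
  by rewrite /trunc divr_ge0 ?(ltW ad)//= ler_pdivrMr// mul1r lerDl ltW.
rewrite (le_trans (ler_normD _ _))// lerD//.
  by rewrite normrM ler_piMl// ger0_norm; case/andP: t1.
rewrite normrM (ger0_norm y0) -[M / d * _]mulrA ler_pM// normrM ler_wpM2r//.
rewrite ger0_norm; last by rewrite divr_ge0 ?mulr_ge0 ?ltW.
rewrite ler_pdivrMr ?mulr_gt0// ler_pdivlMl//; nra.
Qed.

(** The derivative of [trunc d] contributes a nonnegative multiple of [p^2], which is
    dropped. *)
Lemma trunc_grad_lower d a p x v : 0 < d -> 0 <= a -> 0 <= x ->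
  p * v - `|p| * `|d / (a + d) * v|
  <= p * (v * trunc d a + x * (d / (a + d) ^+ 2 * p)).
Proof.
move=> d0 a0 x0.
have ad : 0 < a + d by rewrite ltr_wpDl.
have tE : trunc d a = 1 - d / (a + d) by rewrite /trunc; field; rewrite gt_eqF.
have h : 0 <= x * (d / (a + d) ^+ 2) * p ^+ 2.
  by rewrite mulr_ge0 ?sqr_ge0// mulr_ge0// divr_ge0 ?sqr_ge0// ltW.
have h2 : p * (d / (a + d) * v) <= `|p| * `|d / (a + d) * v| by rewrite -normrM ler_norm.
rewrite tE; move: (d / (a + d)) (d / (a + d) ^+ 2) h h2 => e f h h2.
rewrite [leRHS](_ : _ = p * v - p * (e * v) + x * f * p ^+ 2); last by ring.
lra.
Qed.

Lemma trunc_grad_bound d M a p x v : 0 < d -> 0 <= a -> 0 <= x -> x <= M ->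
  `|v * trunc d a + x * (d / (a + d) ^+ 2 * p)| <= `|v| + M / d * `|p|.
Proof.
move=> d0 a0 x0 xM.
have ad : 0 < a + d by rewrite ltr_wpDl.
have t1 : 0 <= trunc d a <= 1.
  by rewrite /trunc divr_ge0 ?(ltW ad)//= ler_pdivrMr// mul1r lerDl ltW.
rewrite (le_trans (ler_normD _ _))// lerD//.
  by rewrite normrM ler_piMr// ger0_norm; case/andP: t1.
rewrite normrM (ger0_norm x0) -[M / d * _]mulrA ler_pM// normrM ler_wpM2r//.
rewrite ger0_norm; last by rewrite divr_ge0 ?sqr_ge0 ?ltW.
rewrite ler_pdivrMr ?exprn_gt0// ler_pdivlMl//; nra.
Qed.

Lemma trunc_pow_bound p d a : 0 < p -> p < 1 -> 0 < d -> 0 <= a ->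
  a `^ p * (a + d)^-1 <= 1 + d^-1.
Proof.
move=> p0 p1 d0 a0.
have ad : 0 < a + d by rewrite ltr_wpDl.
have h : a `^ p <= 1 + a.
  have [a1|/ltW a1] := leP 1 a.
    by rewrite (le_trans (ler1_powR a1 (ltW p1)))// lerDr.
  have : a `^ p <= 1 `^ p by rewrite ge0_ler_powR ?nnegrE ?(ltW p0).
  by rewrite powR1 => /le_trans; apply; rewrite lerDl.
rewrite ler_pdivrMr// (le_trans h)// -subr_ge0.
rewrite [leRHS](_ : _ = d + a / d); last by field; rewrite gt_eqF.
by rewrite addr_ge0 ?divr_ge0 ?(ltW d0).
Qed.

Lemma trunc_le d M a x : 0 < d -> 0 <= a -> x <= M -> 0 <= M -> x * trunc d a <= M / d * a.
Proof.
move=> d0 a0 xM M0; have ad : 0 < a + d by rewrite ltr_wpDl.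
rewrite /trunc mulrA ler_pdivrMr// -subr_ge0.
rewrite [leRHS](_ : _ = (M - x) * a + M / d * (a * a)); last by field; rewrite gt_eqF.
by rewrite addr_ge0// mulr_ge0 ?subr_ge0 ?divr_ge0 ?mulr_ge0// ltW.
Qed.

(** The tangent inequality is used at the lower of the two points, where the slope is
    at most the slope at [a] times a constant close to 1. *)
Lemma trunc_pow_drop p d M t a x : 0 < p -> p < 1 -> 0 < d -> 0 < t -> t * M / d < 1 ->
  0 <= a -> 0 <= x -> x <= M ->
  0 <= a + - t * (x * trunc d a) /\
  a `^ p - (a + - t * (x * trunc d a)) `^ p
  <= p * t * (1 - t * M / d) `^ (p - 1) * (a `^ p * (a + d)^-1 * x).
Proof.
move=> p0 p1 d0 t0 tM a0 x0 xM.
have ad : 0 < a + d by rewrite ltr_wpDl.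
set w := x * _; have w0 : 0 <= w by rewrite mulr_ge0// mulr_ge0// invr_ge0 ltW.
set rho := 1 - _; have rho0 : 0 < rho by rewrite subr_gt0.
have vu : rho * a <= a + - t * w.
  have := ler_wpM2l (ltW t0) (trunc_le d0 a0 xM (le_trans x0 xM)).
  by rewrite -/w /rho; lra.
have ra0 : 0 <= rho * a by rewrite mulr_ge0// ltW.
split; first exact: le_trans vu.
have [az|az] := eqVneq a 0.
  by rewrite /w /trunc az !mul0r !mulr0 addr0 powR0 ?gt_eqF// !mul0r mulr0 subrr.
have ap : 0 < a by rewrite lt_def az.
have rap : 0 < rho * a by rewrite mulr_gt0.
set v := a + - t * w in vu *; have vp : 0 < v by exact: lt_le_trans vu.
have := powR_tangent p0 p1 a0 vp; rewrite -lerBlDl => /le_trans; apply.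
have -> : a - v = t * w by rewrite /v; ring.
have rr : v `^ (p - 1) <= rho `^ (p - 1) * a `^ (p - 1).
  rewrite -powRM ?(ltW rho0)// -[p - 1]opprB !powRN lef_pV2 ?posrE ?powR_gt0//.
  by rewrite ge0_ler_powR ?nnegrE ?subr_ge0 ?(ltW p1)// ltW.
have -> : a `^ p * (a + d)^-1 * x = a `^ (p - 1) * w.
  by rewrite /w /trunc -(mulr_powRB1 a0 p0); ring.
rewrite [leLHS](_ : _ = p * t * (v `^ (p - 1) * w)); last by ring.
rewrite -!mulrA; apply: ler_wpM2l; first exact: ltW.
by apply: ler_wpM2l; [exact: ltW|rewrite mulrA; exact: ler_wpM2r].
Qed.

Lemma damp_cvg d (a : R) (b : nat -> R) : 0 < d -> 0 <= a -> b k @[k --> \oo] --> a ->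
  d / (b k + d) @[k --> \oo] --> d / (a + d).
Proof.
move=> d0 a0 ba; apply: cvgM; first exact: cvg_cst.
apply: cvgV; first by rewrite gt_eqF// ltr_wpDl.
by apply: cvgD => //; exact: cvg_cst.
Qed.

Lemma upper_arith p t E F P Q S : 0 < p -> 0 < t ->
  (Q - P) / p <= - t * E + (- t) ^+ 2 / 2 * F + t ^+ 2 -> P - Q <= p * t * S ->
  E <= S + t / 2 * F + t.
Proof.
move=> p0 t0; rewrite ler_pdivrMr// => H1 H2.
rewrite -(ler_pM2l t0) -(ler_pM2l p0); nra.
Qed.

End truncated_product.

Section bumps.
Context {R : realType} {n : nat}.
Implicit Types (V : set 'rV[R]_n) (phi : 'rV[R]_n -> R).

(** A bump scaled so as to exceed 1, rather than to be positive, at the given point: no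
    minimum over a compact set is needed in [test_dominated]. *)
Lemma bump_at V p0 : open V -> V p0 -> exists2 b : 'rV[R]_n -> R, nonneg_test V b & 1 < b p0.
Proof.
move=> oV Vp; have [c [k [cp cV]]] := rational_cube_base oV Vp.
set c' := map_mx _ _ in cp cV; set r := k.+1%:R^-1 in cp cV.
have r0 : 0 < r by rewrite invr_gt0.
pose b0 := box_bump (\row_i (c' ord0 i - r)) (\row_i (c' ord0 i + r)) (1 : R).
have b0p : 0 < b0 p0 by exact: box_bump_gt0.
exists (fun x => 2 / b0 p0 * b0 x); last by rewrite divfK ?gt_eqF// ltr1n.
split; last by move=> x; rewrite mulr_ge0 ?box_bump_ge0// divr_ge0// ltW.
apply: test_scale; apply: box_bump_test => // x H; apply: cV; apply/cube_rVE => i.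
by have := H i; rewrite !mxE => /andP[h1 h2]; rewrite ltr_distl; apply/andP; split; lra.
Qed.

Lemma test_sum V (I : Type) (l : seq I) (F : I -> 'rV[R]_n -> R) :
  (forall i, test_function V (F i)) -> test_function V (fun x => \sum_(i <- l) F i x).
Proof.
move=> tF; elim: l => [|i l IH].
  by rewrite (_ : (fun x => _) = fun=> 0); [exact: test0|apply/funext => x; rewrite big_nil].
rewrite (_ : (fun x => _) = F i \+ (fun x => \sum_(i <- l) F i x)); first exact: test_add.
by apply/funext => x; rewrite big_cons.
Qed.

(** Finitely many bumps cover the support. *)
Lemma test_dominated V phi : open V -> test_function V phi ->
  exists2 chi, nonneg_test V chi & forall x, `|phi x| <= chi x.
Proof.
move=> oV tphi; have [M M0 phiM] := test_bounded tphi.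
have [_ cK KV] := tphi.
have /choice[b bP] p : exists b : 'rV[R]_n -> R, nonneg_test V b /\ (tsupport phi p -> 1 < b p).
  have [Kp|nK] := pselect (tsupport phi p); last first.
    by exists (fun=> 0); split => //; split => //; exact: test0.
  by have [b b1 b2] := bump_at oV (KV _ Kp); exists b.
have := cK; rewrite compact_cover => /(_ _ (tsupport phi) (fun p => [set x | 1 < b p x])).
case.
- move=> p _.
  apply: (@open_comp _ _ (b p) [set y | 1 < y]); last exact: open_gt.
  by move=> x _; exact: (test_continuous (bP p).1.1).
- by move=> x Kx; exists x => //; exact: (bP x).2.
move=> S _ KS.
pose chi x := M * \sum_(p <- finmap.enum_fset S) b p x.
have s0 x : 0 <= \sum_(p <- finmap.enum_fset S) b p x.
  by apply: sumr_ge0 => p _; exact: (bP p).1.2.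
exists chi; first split.
- by apply: test_scale; apply: test_sum => p; exact: (bP p).1.1.
- by move=> x; rewrite mulr_ge0// ltW.
move=> x; have [Kx|nK] := pselect (tsupport phi x); last first.
  by rewrite notin_tsupport// normr0 mulr_ge0// ltW.
have [p /= pS bpx] := KS _ Kx.
rewrite (le_trans (phiM x))// ler_peMr ?(ltW M0)//.
rewrite (big_rem p)//= (le_trans (ltW bpx))// lerDl.
by apply: sumr_ge0 => p' _; exact: (bP p').1.2.
Qed.

End bumps.

(** * The Euler-Lagrange equation *)

Section euler_lagrange.
Context {R : realType} {n : nat}.
Local Notation mu := (lebesgue_rV R n).
Local Notation mu2 := ((lebesgue_rV R n) \x (lebesgue_rV R n))%E.
Variables (s p c m : R) (Om : set 'rV[R]_n).
Hypotheses (oOm : open Om) (Ofin : (mu Om < +oo)%E).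
Hypotheses (n2 : (2 <= n)%N) (s0 : 0 < s) (s1 : s < 1) (p0 : 0 < p) (p1 : p < 1) (c0 : 0 < c).
Hypothesis cP : forall phi, test_function Om phi ->
  c * ip mu Om phi phi <= ip mu2 (Qset Om) (ndiff s phi) (ndiff s phi).
Variable u_ : nat -> 'rV[R]_n -> R.
Hypothesis mJ : forall phi, nonneg_test Om phi -> m <= functional s p Om phi.
Hypothesis u_test : forall k, nonneg_test Om (u_ k).
Hypothesis uJ : forall k, functional s p Om (u_ k) <= m + 4^-1 ^+ k.

Local Notation u := (limsup_fun u_).
Local Notation g := (limit_grad u_).

Let mO : measurable Om. Proof. exact: open_measurable_rV. Qed.

Let mQ : measurable (Qset Om).
Proof. by apply: measurableD => //; apply: measurableX; exact: measurableC. Qed.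

Let tu k : test_function Om (u_ k). Proof. exact: (u_test k).1. Qed.

Let u_cauchy := minimizing_cauchy oOm Ofin n2 s0 s1 p0 p1 mJ u_test uJ.

(** The substitute for the vanishing of the first variation, with a step [t] of either
    sign. *)
Lemma quasi_minimality k t w : test_function Om w ->
  (forall x, 0 <= u_ k x + t * w x) ->
  (\int[mu]_(x in Om) ((u_ k x + t * w x) `^ p) - \int[mu]_(x in Om) (u_ k x `^ p)) / p
  <= t * test_energy s Om (u_ k) w + t ^+ 2 / 2 * test_energy s Om w w + 4^-1 ^+ k.
Proof.
move=> tw uw0.
have := mJ (conj (test_lin t (tu k) tw) uw0).
rewrite {1}/functional (test_energy_sqrD oOm n2 s0 s1 t (tu k) tw) => H.
exact: quasi_min_arith H (uJ k).
Qed.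

(* The step for which the defect [4^-k] of minimality is of second order. *)
Let t_ k : R := 2^-1 ^+ k.

Let t0 k : 0 < t_ k. Proof. by rewrite exprn_gt0. Qed.

Let tt k : t_ k ^+ 2 = 4^-1 ^+ k.
Proof. by rewrite /t_ -exprM mulnC exprM; congr (_ ^+ _); field. Qed.

Lemma test_pow_integrable phi : nonneg_test Om phi ->
  mu.-integrable Om (EFin \o (fun x => phi x `^ p)).
Proof. by move=> [tp p_ge0]; apply: pow_integrable => //; exact: test_sqint tp. Qed.

(** Concavity bounds the increase of the power from below by its slope at the end
    point, which is finite where [w > 0]. *)
Lemma lower_step k w : nonneg_test Om w ->
  (\int[mu]_(x in Om) (w x * (u_ k x + t_ k * w x) `^ (p - 1))%:E
   <= (test_energy s Om (u_ k) w + t_ k / 2 * test_energy s Om w w + t_ k)%:E)%E.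
Proof.
move=> [tw w0].
have uw0 x : 0 <= u_ k x + t_ k * w x by rewrite addr_ge0 ?(u_test k).2// mulr_ge0// ltW.
have tk := test_lin (t_ k) (tu k) tw.
have i1 := test_pow_integrable (conj tk uw0).
have i0 := test_pow_integrable (u_test k).
pose h x := (p * t_ k)^-1 * ((u_ k x + t_ k * w x) `^ p - u_ k x `^ p).
have ih : mu.-integrable Om (EFin \o h).
  exact: (integrableZl mO _ (integrableB mO i1 i0)).
have pt0 : 0 < p * t_ k by rewrite mulr_gt0.
apply: (@le_trans _ _ (\int[mu]_(x in Om) (h x)%:E)%E).
  apply: ge0_le_integral => //.
  - by move=> x _; rewrite lee_fin mulr_ge0 ?powR_ge0.
  - apply/measurable_EFinP; apply: measurable_funTS; apply: measurable_funM.
      exact: test_measurable tw.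
    by apply: (measurableT_comp (measurable_powR _)); exact: test_measurable tk.
  - exact: measurable_int ih.
  - move=> x _; rewrite lee_fin /h ler_pdivlMl//.
    have [wx0|wx0] := eqVneq (w x) 0.
      by rewrite wx0 mulr0 addr0 mul0r mulr0 subrr.
    have wp : 0 < w x by rewrite lt_def wx0 w0.
    have y0 : 0 < u_ k x + t_ k * w x by rewrite ltr_wpDl ?(u_test k).2// mulr_gt0.
    have := powR_tangent p0 p1 ((u_test k).2 x) y0; lra.
have -> : (\int[mu]_(x in Om) (h x)%:E)%E = (\int[mu]_(x in Om) h x)%:E.
  by rewrite /Rintegral fineK//; exact: integrable_fin_num.
rewrite lee_fin /h RintegralZl//; last exact: (integrableB mO i1 i0).
rewrite RintegralB//.
have := quasi_minimality tw uw0; rewrite -tt => H.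
rewrite mulrC ler_pdivrMr// [p * _]mulrC mulrA -ler_pdivrMr//.
by apply: (le_trans H); move: (t_ k) (test_energy _ _ _ w) (test_energy _ _ _ _) => a b d; nra.
Qed.


(** Fatou's lemma along [lower_step].  The limit of the integrands is infinite where
    [u = 0 < w], while the right-hand side stays finite. *)
Lemma lower_limit w : nonneg_test Om w ->
  {ae mu, forall x, Om x -> 0 < w x -> 0 < u x} /\
  (\int[mu]_(x in Om) (w x * u x `^ (p - 1))%:E <= (energy_form s Om g (pderiv^~ w) u w)%:E)%E.
Proof.
move=> [tw w0].
have mw := test_measurable tw; have mu_ := limit_measurable u_test.
have ug0 := limit_ge0 u_test.
(* At a zero of [u] the limit is [+oo] or 0 according to the sign of [w]. *)
pose G x := (if (0 < u x)%R then (w x * u x `^ (p - 1))%:E else (w x)%:E * +oo)%E.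
have G0 x : (0 <= G x)%E.
  rewrite /G; case: ifPn => _; first by rewrite lee_fin mulr_ge0 ?powR_ge0.
  by rewrite mule_ge0// lee_fin.
have mG : measurable_fun Om G.
  apply: measurable_funTS; apply: measurable_fun_ifT.
  - by apply: measurable_fun_ltr => //; exact: measurable_cst.
  - apply/measurable_EFinP; apply: measurable_funM => //.
    by apply: (measurableT_comp (measurable_powR _)).
  - by apply: emeasurable_funM => //; exact/measurable_EFinP.
have intG : (\int[mu]_(x in Om) G x <= (energy_form s Om g (pderiv^~ w) u w)%:E)%E.
  apply: (@fatou_cvg _ _ _ mu _ mO
    (fun k x => (w x * (u_ k x + t_ k * w x) `^ (p - 1))%:E) _
    (fun k => test_energy s Om (u_ k) w + t_ k / 2 * test_energy s Om w w + t_ k)) => //.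
  - move=> k; apply/measurable_EFinP; apply: measurable_funTS; apply: measurable_funM => //.
    apply: (measurableT_comp (measurable_powR _)).
    exact: test_measurable (test_lin (t_ k) (tu k) tw).
  - by move=> k x _; rewrite lee_fin mulr_ge0 ?powR_ge0.
  - apply: filterS (limit_cvg oOm c0 cP u_test u_cauchy) => x ux _.
    have t_cvg : t_ k @[k --> \oo] --> (0 : R).
      by apply: cvg_expr; rewrite ger0_norm// invf_lt1// ltr1n.
    have y_cvg : u_ k x + t_ k * w x @[k --> \oo] --> u x.
      rewrite -[in X in _ --> X](addr0 (u x)) -[X in _ --> _ + X](mul0r (w x)).
      by apply: cvgD; [exact: ux|apply: cvgM => //; exact: cvg_cst].
    rewrite /G; case: ifPn => [ux0|].
      apply: cvg_EFin; first exact: nearW.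
      by apply: cvgM; [exact: cvg_cst|exact: powR_cvg_pos].
    rewrite -leNgt => ux0; have ux00 : u x = 0 by apply/le_anti; rewrite ux0 ug0.
    have [wx0|wx0] := eqVneq (w x) 0.
      rewrite wx0 mul0e (_ : (fun k => _) = fun=> 0%E); first exact: cvg_cst.
      by apply/funext => k; rewrite mul0r.
    have wp : 0 < w x by rewrite lt_def wx0 w0.
    under eq_fun do rewrite EFinM.
    apply: cvgeZl => //; apply: powR_cvg_pinfty.
    + by rewrite subr_lt0.
    + by move=> k; rewrite ltr_wpDl ?(u_test k).2// mulr_gt0.
    + by rewrite -ux00.
  - by move=> k; apply: lower_step.
  - rewrite -[X in _ --> X]addr0 -[X in _ --> X + _]addr0 -[X in _ --> _ + X + _](mul0r (test_energy s Om w w)).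
    have t_cvg : t_ k @[k --> \oo] --> (0 : R).
      by apply: cvg_expr; rewrite ger0_norm// invf_lt1// ltr1n.
    apply: cvgD => //; apply: cvgD.
      exact: (test_energy_cvg oOm n2 s0 s1 c0 cP u_test u_cauchy tw).
    apply: cvgM; last exact: cvg_cst.
    rewrite -[X in _ --> X](mul0r 2^-1); apply: cvgM => //; exact: cvg_cst.
split.
  have iG : mu.-integrable Om G.
    apply/integrableP; split => //.
    rewrite (eq_integral G) ?(le_lt_trans intG) ?ltry//.
    by move=> x _; rewrite gee0_abs.
  apply: filterS (integrable_ae mO iG) => x Gx Ox wx0.
  have := Gx Ox; rewrite /G; case: ifPn => //.
  by rewrite gt0_muley// lte_fin.
apply: (le_trans _ intG); apply: ge0_le_integral => //.
- by move=> x _; rewrite lee_fin mulr_ge0 ?powR_ge0.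
- apply/measurable_EFinP; apply: measurable_funTS; apply: measurable_funM => //.
  by apply: (measurableT_comp (measurable_powR _)).
- move=> x _; rewrite /G; case: ifPn => //; rewrite -leNgt => ux0.
  have -> : u x = 0 by apply/le_anti; rewrite ux0 ug0.
  by rewrite powR0 ?subr_eq0 ?lt_eqF// mulr0 mule_ge0// lee_fin.
Qed.


Section upper.
Implicit Types (v w : 'rV[R]_n -> R).
Variables (phi : 'rV[R]_n -> R) (M d : R).
Hypotheses (tphi : nonneg_test Om phi) (phiM : forall x, phi x <= M) (d0 : 0 < d).

Let phi0 x : 0 <= phi x. Proof. exact: tphi.2. Qed.

Definition trunc_test k : 'rV[R]_n -> R := fun x => phi x * trunc d (u_ k x).

(** The energy of [phi] damped by [d / (v + d)]: the error of replacing [phi] by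
    [trunc_test].  In the nonlocal part the larger of the two values of [v] counts. *)
Definition damped v : R :=
  \sum_i ip mu Om (fun x => d / (v x + d) * pderiv i phi x)
                  (fun x => d / (v x + d) * pderiv i phi x)
  + ip mu2 (Qset Om) (fun z => d / (Num.max (v z.1) (v z.2) + d) * ndiff s phi z)
      (fun z => d / (Num.max (v z.1) (v z.2) + d) * ndiff s phi z).

Let ud k x : 0 < u_ k x + d. Proof. by rewrite ltr_wpDl ?(u_test k).2. Qed.

Let sud k : smooth (fun x => u_ k x + d).
Proof. exact: (smoothD (test_smooth (tu k)) (smooth_cst d)). Qed.

Let udn k x : u_ k x + d != 0. Proof. by rewrite gt_eqF. Qed.

Let sinv k : smooth (fun x => (u_ k x + d)^-1).
Proof. exact: smoothV. Qed.

Lemma smooth_trunc k : smooth (fun x => trunc d (u_ k x)).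
Proof. exact: (smoothM (test_smooth (tu k)) (sinv k)). Qed.

Lemma trunc_test_test k : test_function Om (trunc_test k).
Proof. exact: (test_mulr tphi.1 (smooth_trunc k)). Qed.

Lemma pderiv_trunc_test i k x : pderiv i (trunc_test k) x =
  pderiv i phi x * trunc d (u_ k x) + phi x * (d / (u_ k x + d) ^+ 2 * pderiv i (u_ k) x).
Proof.
have su := test_smooth (tu k).
have -> : trunc_test k = phi \* (u_ k \* (fun x => (u_ k x + d)^-1)) by [].
rewrite pderivM; last first.
- by move=> y; apply: smooth_derivable; exact: smooth_trunc.
- by move=> y; apply: smooth_derivable; exact: (test_smooth tphi.1).
rewrite pderivM; last first.
- by move=> y; exact: smooth_derivable.
- by move=> y; exact: smooth_derivable.
rewrite pderivV//; last by move=> y; exact: smooth_derivable.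
have -> : pderiv i (fun x => u_ k x + d) = pderiv i (u_ k).
  rewrite (_ : (fun x => u_ k x + d) = (fun x => u_ k x + d * 1)); last first.
    by apply/funext => y; rewrite mulr1.
  rewrite (pderiv_lin i d su (smooth_cst 1)) pderiv_cst.
  by apply/funext => y; rewrite mulr0 addr0.
rewrite /= /trunc; field; exact: udn.
Qed.

Let damp_bound (a : R) : 0 <= a -> `|d / (a + d)| <= 1.
Proof.
move=> a0; have ad : 0 < a + d by rewrite ltr_wpDl.
by rewrite ger0_norm ?divr_ge0 ?(ltW d0) ?(ltW ad)// ler_pdivrMr// mul1r lerDr.
Qed.

Lemma measurable_damp2 v : (forall x, 0 <= v x) -> measurable_fun setT v ->
  measurable_fun (Qset Om) (fun z => d / (Num.max (v z.1) (v z.2) + d)).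
Proof.
move=> v0 mv; apply: measurable_funTS; apply: measurable_funM; first exact: measurable_cst.
have m2 : measurable_fun setT (fun z : 'rV[R]_n * 'rV[R]_n => Num.max (v z.1) (v z.2)).
  apply: measurable_maxr.
    exact: (measurableT_comp mv measurable_fst).
  exact: (measurableT_comp mv measurable_snd).
rewrite (_ : (fun z => _) = (fun z => (Num.max (v z.1) (v z.2) + d) `^ (-1))).
  apply: (measurableT_comp (measurable_powR _)); apply: measurable_funD => //.
apply/funext => z; rewrite powR_inv1// addr_ge0 ?(ltW d0)//.
by rewrite le_max v0.
Qed.

Lemma measurable_damp v : (forall x, 0 <= v x) -> measurable_fun setT v ->
  measurable_fun Om (fun x => d / (v x + d)).
Proof.
move=> v0 mv; apply: measurable_funTS; apply: measurable_funM; first exact: measurable_cst.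
rewrite (_ : (fun z => _) = (fun x => (v x + d) `^ (-1))).
  by apply: (measurableT_comp (measurable_powR _)); apply: measurable_funD.
by apply/funext => z; rewrite powR_inv1// addr_ge0 ?(ltW d0).
Qed.

Let sphi i : sqint mu Om (pderiv i phi). Proof. exact: test_sqint_pderiv tphi.1. Qed.
Let nphi : sqint mu2 (Qset Om) (ndiff s phi). Proof. exact: test_sqint_ndiff tphi.1. Qed.
Let su i k : sqint mu Om (pderiv i (u_ k)). Proof. exact: test_sqint_pderiv (tu k). Qed.
Let nu k : sqint mu2 (Qset Om) (ndiff s (u_ k)). Proof. exact: test_sqint_ndiff (tu k). Qed.
Let sw i k : sqint mu Om (pderiv i (trunc_test k)).
Proof. exact: test_sqint_pderiv (trunc_test_test k). Qed.
Let nw k : sqint mu2 (Qset Om) (ndiff s (trunc_test k)).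
Proof. exact: test_sqint_ndiff (trunc_test_test k). Qed.

Let damp_sqint i k : sqint mu Om (fun x => d / (u_ k x + d) * pderiv i phi x).
Proof.
apply: (sqint_bounded_mul mO (measurable_damp (u_test k).2 (test_measurable (tu k))) _ (sphi i)).
by move=> x _; apply: damp_bound; exact: (u_test k).2.
Qed.

Let damp2_sqint k : sqint mu2 (Qset Om)
  (fun z => d / (Num.max (u_ k z.1) (u_ k z.2) + d) * ndiff s phi z).
Proof.
apply: (sqint_bounded_mul mQ (measurable_damp2 (u_test k).2 (test_measurable (tu k))) _ nphi).
by move=> x _; apply: damp_bound; rewrite le_max (u_test k).2.
Qed.

(** Apply [ip_young_lower] to the local and to the nonlocal part, with the pointwise
    inequalities [trunc_grad_lower] and [trunc_lower]. *)
Lemma trunc_test_lower (l : R) k : 0 < l ->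
  test_energy s Om (u_ k) phi <= test_energy s Om (u_ k) (trunc_test k)
    + l / 2 * test_energy s Om (u_ k) (u_ k) + (2 * l)^-1 * damped (u_ k).
Proof.
move=> l0.
have H1 i : ip mu Om (pderiv i (u_ k)) (pderiv i phi) <=
    ip mu Om (pderiv i (u_ k)) (pderiv i (trunc_test k))
    + l / 2 * ip mu Om (pderiv i (u_ k)) (pderiv i (u_ k))
    + (2 * l)^-1 * ip mu Om (fun x => d / (u_ k x + d) * pderiv i phi x)
                  (fun x => d / (u_ k x + d) * pderiv i phi x).
  apply: (ip_young_lower mO l0 (su i k) (sphi i) (sw i k) (damp_sqint i k)) => x _.
  by rewrite pderiv_trunc_test; apply: trunc_grad_lower => //; exact: (u_test k).2.
have H2 := ip_young_lower mQ l0 (nu k) nphi (nw k) (damp2_sqint k).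
rewrite /test_energy /energy_form /damped; apply: lerD_lin3.
  by rewrite !mulr_sumr -!big_split; apply: ler_sum => i _; exact: H1.
apply: H2.
move=> [x y] _; rewrite /ndiff /=.
set K := kern s _; have K0 : 0 <= K by exact: kern_ge0.
have := trunc_lower d0 ((u_test k).2 x) ((u_test k).2 y) (phi0 x) (phi0 y).
move=> /(ler_wpM2r (mulr_ge0 K0 K0)) H.
rewrite [leRHS](_ : _ = (u_ k x - u_ k y) *
  (phi x * trunc d (u_ k x) - phi y * trunc d (u_ k y)) * (K * K)); last by rewrite /trunc_test; ring.
apply: le_trans H.
rewrite !normrM (ger0_norm K0) le_eqVlt; apply/orP; left; apply/eqP; ring.
Qed.

(** A bound uniform in [k] suffices, since the step multiplies this energy. *)
Lemma trunc_test_bound k : test_energy s Om (trunc_test k) (trunc_test k) <=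
  2 * test_energy s Om phi phi + 2 * (M / d) ^+ 2 * test_energy s Om (u_ k) (u_ k).
Proof.
have H1 i : ip mu Om (pderiv i (trunc_test k)) (pderiv i (trunc_test k)) <=
    2 * ip mu Om (pderiv i phi) (pderiv i phi)
    + 2 * (M / d) ^+ 2 * ip mu Om (pderiv i (u_ k)) (pderiv i (u_ k)).
  apply: (ip_sqr_le mO (su i k) (sphi i) (sw i k)) => x _.
  by rewrite pderiv_trunc_test; apply: trunc_grad_bound => //; exact: (u_test k).2.
have H2 := ip_sqr_le mQ (nu k) nphi (nw k) (K := M / d).
rewrite /test_energy /energy_form; apply: lerD_lin2.
  by rewrite !mulr_sumr -!big_split; apply: ler_sum => i _; exact: H1.
apply: H2.
move=> [x y] _; rewrite /ndiff /= !normrM.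
rewrite mulrA -mulrDl ler_wpM2r//.
by apply: trunc_bound => //; exact: (u_test k).2.
Qed.

Lemma pow_trunc_integrable v : (forall x, 0 <= v x) -> measurable_fun setT v ->
  mu.-integrable Om (EFin \o (fun x => v x `^ p * (v x + d)^-1 * phi x)).
Proof.
move=> v0 mv.
have iphi : mu.-integrable Om (EFin \o (fun x => (1 + d^-1) * phi x)).
  exact: (integrableZl mO _ (test_integrable mO tphi.1)).
apply: (le_integrable mO _ _ iphi).
  apply/measurable_EFinP; apply: measurable_funTS; apply: measurable_funM; last exact: test_measurable tphi.1.
  apply: measurable_funM; first by apply: (measurableT_comp (measurable_powR _)).
  rewrite (_ : (fun x => (v x + d)^-1) = (fun x => (v x + d) `^ (-1))).
    by apply: (measurableT_comp (measurable_powR _)); apply: measurable_funD.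
  by apply/funext => z; rewrite powR_inv1// addr_ge0 ?(ltW d0).
move=> x _; rewrite /= lee_fin (le_trans _ (ler_norm _))// normrM (ger0_norm (phi0 x)).
rewrite ler_wpM2r// ger0_norm; first exact: trunc_pow_bound.
by rewrite mulr_ge0 ?powR_ge0// invr_ge0 addr_ge0 ?(ltW d0).
Qed.

(** [quasi_minimality] in the direction [- trunc_test k], which keeps [u_ k] nonnegative
    once the step is small. *)
Lemma upper_step k : t_ k * M / d < 1 ->
  test_energy s Om (u_ k) (trunc_test k) <=
  (1 - t_ k * M / d) `^ (p - 1) * \int[mu]_(x in Om) (u_ k x `^ p * (u_ k x + d)^-1 * phi x)
  + t_ k / 2 * test_energy s Om (trunc_test k) (trunc_test k) + t_ k.
Proof.
move=> tM1.
have u0 x : 0 <= u_ k x by exact: (u_test k).2.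
have tw := trunc_test_test k.
have D x := trunc_pow_drop p0 p1 d0 (t0 k) tM1 (u0 x) (phi0 x) (phiM x).
have v0 x : 0 <= u_ k x + - t_ k * trunc_test k x by exact: (D x).1.
have i1 := test_pow_integrable (conj (test_lin (- t_ k) (tu k) tw) v0).
have i0 := test_pow_integrable (u_test k).
have ih := pow_trunc_integrable u0 (test_measurable (tu k)).
have Q := quasi_minimality tw v0; rewrite -tt in Q.
apply: (upper_arith p0 (t0 k) Q).
rewrite mulrA -RintegralB// -RintegralZl//; apply: le_Rintegral => //.
- exact: (integrableB mO i0 i1).
- exact: (integrableZl mO _ ih).
- by move=> x _; exact: (D x).2.
Qed.

Lemma energy_bounded : exists2 B : R, 0 <= B & forall k, test_energy s Om (u_ k) (u_ k) <= B.
Proof.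
have [b bP] := functional_coercive oOm Ofin p0 p1 c0 cP.
have H k : test_energy s Om (u_ k) (u_ k) <= 4 * (m + 1 + b).
  have : 4^-1 ^+ k <= 1 :> R by rewrite exprn_ile1// invf_le1// ler1n.
  by have := bP _ (u_test k); have := uJ k; lra.
exists (4 * (m + 1 + b)) => //; apply: le_trans (H 0%N); exact: test_energy_ge0.
Qed.

Lemma damped_cvg :
  damped (u_ k) @[k --> \oo] --> damped u.
Proof.
have lu := limit_measurable u_test; have l0 := limit_ge0 u_test.
rewrite /damped; apply: cvgD.
  apply: cvg_big => [|i _]; first exact: add_continuous.
  apply: (ip_damped_cvg mO (fun k => measurable_damp (u_test k).2 (test_measurable (tu k)))
    _ (measurable_damp l0 lu) _ (sphi i)).
    by move=> k x _; apply: damp_bound; exact: (u_test k).2.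
  apply: filterS (limit_cvg oOm c0 cP u_test u_cauchy) => x ux _.
  exact: damp_cvg.
apply: (ip_damped_cvg mQ (fun k => measurable_damp2 (u_test k).2 (test_measurable (tu k)))
    _ (measurable_damp2 l0 lu) _ nphi).
  by move=> k x _; apply: damp_bound; rewrite le_max (u_test k).2.
apply: filterS (limit_cvg_pair oOm c0 cP u_test u_cauchy) => z [z1 z2] _.
apply: damp_cvg => //; first by rewrite le_max l0.
exact: (cvg_comp2 z1 z2 (@max_continuous _ R (u z.1, u z.2))).
Qed.

Lemma pow_trunc_cvg :
  \int[mu]_(x in Om) (u_ k x `^ p * (u_ k x + d)^-1 * phi x) @[k --> \oo]
  --> \int[mu]_(x in Om) (u x `^ p * (u x + d)^-1 * phi x).
Proof.
have lu := limit_measurable u_test; have l0 := limit_ge0 u_test.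
have iu := pow_trunc_integrable l0 lu.
have iu_ k := pow_trunc_integrable (u_test k).2 (test_measurable (tu k)).
have cv : {ae mu, forall x, Om x ->
   ((u_ k x `^ p * (u_ k x + d)^-1 * phi x)%:E @[k --> \oo] -->
    (u x `^ p * (u x + d)^-1 * phi x)%:E)%E}.
  apply: filterS (limit_cvg oOm c0 cP u_test u_cauchy) => x ux _.
  apply: cvg_EFin; first exact: nearW.
  apply: cvgM; last exact: cvg_cst.
  apply: cvgM; first by apply: powR_cvg_nneg => // k; exact: (u_test k).2.
  apply: cvgV; first by rewrite gt_eqF// ltr_wpDl.
  by apply: cvgD => //; exact: cvg_cst.
have iphi : mu.-integrable Om (EFin \o (fun x => (1 + d^-1) * phi x)).
  exact: (integrableZl mO _ (test_integrable mO tphi.1)).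
have dom : {ae mu, forall x k, Om x ->
   (`|(u_ k x `^ p * (u_ k x + d)^-1 * phi x)%:E| <= ((1 + d^-1) * phi x)%:E)%E}.
  apply: aeW => x k _; rewrite /= lee_fin normrM (ger0_norm (phi0 x)).
  rewrite ler_wpM2r// ger0_norm; first by apply: trunc_pow_bound => //; exact: (u_test k).2.
  by rewrite mulr_ge0 ?powR_ge0// invr_ge0 ltW.
have H := dominated_convergence mO (fun k => measurable_int _ (iu_ k)) (measurable_int _ iu) cv iphi dom.
have [_ _ {}H] := H.
by apply: fine_cvg; rewrite fineK//; exact: integrable_fin_num.
Qed.

(** The limit of [trunc_test_lower] and [upper_step] as [k] tends to infinity, for fixed
    [d] and [l]. *)
Lemma upper_delta (B l : R) : 0 < l -> (forall k, test_energy s Om (u_ k) (u_ k) <= B) ->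
  energy_form s Om g (pderiv^~ phi) u phi <=
  \int[mu]_(x in Om) (u x `^ p * (u x + d)^-1 * phi x) + l / 2 * B + (2 * l)^-1 * damped u.
Proof.
move=> l0 uB.
pose K := 2 * test_energy s Om phi phi + 2 * (M / d) ^+ 2 * B.
pose rhs k := (1 - t_ k * M / d) `^ (p - 1) * \int[mu]_(x in Om) (u_ k x `^ p * (u_ k x + d)^-1 * phi x)
  + t_ k / 2 * K + t_ k + l / 2 * B + (2 * l)^-1 * damped (u_ k).
have t_cvg : t_ k @[k --> \oo] --> (0 : R).
  by apply: cvg_expr; rewrite ger0_norm// invf_lt1// ltr1n.
have tM_cvg : t_ k * M / d @[k --> \oo] --> (0 : R).
  have <- : 0 * M / d = 0 by rewrite !mul0r.
  by apply: cvgM; [apply: cvgM => //; exact: cvg_cst|exact: cvg_cst].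
have C1 := test_energy_cvg oOm n2 s0 s1 c0 cP u_test u_cauchy tphi.1.
have C2 : rhs k @[k --> \oo] --> \int[mu]_(x in Om) (u x `^ p * (u x + d)^-1 * phi x)
    + l / 2 * B + (2 * l)^-1 * damped u.
  apply: cvgD; last by apply: cvgM; [exact: cvg_cst|exact: damped_cvg].
  apply: cvgD; last exact: cvg_cst.
  rewrite -[X in _ --> X]addr0; apply: cvgD => //.
  rewrite -[X in _ --> X]addr0; apply: cvgD; last first.
    have <- : 0 / 2 * K = 0 by rewrite !mul0r.
    by apply: cvgM; [apply: cvgM => //; exact: cvg_cst|exact: cvg_cst].
  rewrite -[X in _ --> X]mul1r; apply: cvgM; last exact: pow_trunc_cvg.
  have := @powR_cvg_pos R (p - 1) 1 (fun k => 1 - t_ k * M / d) ltr01.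
  rewrite powR1; apply; rewrite -[X in _ --> X]subr0.
  by apply: cvgB => //; exact: cvg_cst.
apply: (ler_cvg_to C1 C2).
near=> k; rewrite /rhs.
  have tM1 : t_ k * M / d < 1 by near: k; exact: (cvgr_lt _ tM_cvg _ ltr01).
  have h1 := trunc_test_lower k l0; have h2 := upper_step tM1.
  have h3 := trunc_test_bound k.
  have h4 : l / 2 * test_energy s Om (u_ k) (u_ k) <= l / 2 * B.
    by rewrite ler_wpM2l// divr_ge0// ltW.
  have h5 : t_ k / 2 * test_energy s Om (trunc_test k) (trunc_test k) <= t_ k / 2 * K.
    rewrite ler_wpM2l ?divr_ge0 ?(ltW (t0 k))// (le_trans h3)// lerD2l ler_wpM2l//.
    by rewrite mulr_ge0 ?sqr_ge0.
  apply: (le_trans h1); rewrite lerD2r; apply: lerD => //.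
  by apply: (le_trans h2); rewrite lerD2r lerD2l.
Unshelve. all: by end_near. Qed.

End upper.

(** By [lower_limit] the limit is positive where some nonnegative test function is, and
    each point of [Om] has a neighbourhood on which one exceeds 1. *)
Lemma limit_gt0 : {ae mu, forall x, Om x -> 0 < u x}.
Proof.
apply: ae_locally => x Ox; have [b nb b1] := bump_at oOm Ox.
exists (Om `&` [set y | 1 < b y]); split => //.
  apply: openI => //; apply: (@open_comp _ _ b [set y | 1 < y]); last exact: open_gt.
  by move=> y _; exact: (test_continuous nb.1).
apply: filterS (lower_limit nb).1 => y H [Oy by1]; apply: H => //.
by rewrite (lt_trans ltr01).
Qed.

Lemma limit_power_integrable w : nonneg_test Om w ->
  mu.-integrable Om (EFin \o (fun x => u x `^ (p - 1) * w x)).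
Proof.
move=> nw; apply/integrableP; split.
  apply/measurable_EFinP; apply: measurable_funTS; apply: measurable_funM; last exact: test_measurable nw.1.
  by apply: (measurableT_comp (measurable_powR _)); exact: limit_measurable.
rewrite (eq_integral (fun x => (w x * u x `^ (p - 1))%:E)).
  exact: le_lt_trans (lower_limit nw).2 (ltry _).
by move=> x _; rewrite /= mulrC ger0_norm// mulr_ge0 ?powR_ge0// nw.2.
Qed.

Lemma lower_inequality w : nonneg_test Om w ->
  \int[mu]_(x in Om) (u x `^ (p - 1) * w x) <= energy_form s Om g (pderiv^~ w) u w.
Proof.
move=> nw; rewrite -lee_fin /Rintegral fineK; last first.
  exact: integrable_fin_num (limit_power_integrable nw).
apply: le_trans (lower_limit nw).2; rewrite le_eqVlt; apply/orP; left; apply/eqP.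
by apply: eq_integral => x _; rewrite mulrC.
Qed.

(** Every pair in [Qset Om] has a point in [Om], where [u > 0] almost everywhere, so that
    the damping factors tend to 0. *)
Lemma damped_vanishes phi : nonneg_test Om phi ->
  damped phi k.+1%:R^-1 u @[k --> \oo] --> (0 : R).
Proof.
move=> tphi; have lu := limit_measurable u_test; have l0 := limit_ge0 u_test.
have d0 k : 0 < k.+1%:R^-1 :> R by rewrite invr_gt0.
have cd (a : R) : 0 < a -> k.+1%:R^-1 / (a + k.+1%:R^-1) @[k --> \oo] --> (0 : R).
  move=> a0; have <- : 0 / (a + 0) = 0 :> R by rewrite mul0r.
  apply: cvgM; first exact: cvg_harmonic.
  apply: cvgV; first by rewrite addr0 gt_eqF.
  by apply: cvgD; [exact: cvg_cst|exact: cvg_harmonic].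
have bd k (a : R) : 0 <= a -> `|k.+1%:R^-1 / (a + k.+1%:R^-1)| <= 1.
  move=> a0; have ad : 0 < a + k.+1%:R^-1 by rewrite ltr_wpDl.
  by rewrite ger0_norm ?divr_ge0 ?(ltW (d0 k)) ?(ltW ad)// ler_pdivrMr// mul1r lerDr.
have ip0 d' (T : measurableType d') (m' : {measure set T -> \bar R}) (D : set T) (h : T -> R) :
    ip m' D (fun x => 0 * h x) (fun x => 0 * h x) = 0.
  rewrite /ip /Rintegral (eq_integral (fun=> 0%E)) ?integral0//.
  by move=> x _; rewrite !mul0r.
rewrite /damped -[X in _ --> X]addr0; apply: cvgD.
  have Z : \sum_i ip mu Om (fun x => 0 * pderiv i phi x) (fun x => 0 * pderiv i phi x) = 0.
    by apply: big1 => i _; exact: ip0.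
  rewrite -[X in _ --> X]Z.
  apply: cvg_big => [|i _]; first exact: add_continuous.
  apply: (@ip_damped_cvg _ _ _ mu Om mO (fun k x => k.+1%:R^-1 / (u x + k.+1%:R^-1)) (fun=> 0)
    (pderiv i phi) (fun k => measurable_damp (d0 k) l0 lu) _ (measurable_cst (0 : R)) _
    (test_sqint_pderiv oOm i tphi.1)).
    by move=> k x _; exact: bd.
  by apply: filterS limit_gt0 => x ux Ox; exact/cd/ux.
rewrite -[X in _ --> X](ip0 _ _ mu2 (Qset Om) (ndiff s phi)).
apply: (@ip_damped_cvg _ _ _ mu2 (Qset Om) mQ
    (fun k z => k.+1%:R^-1 / (Num.max (u z.1) (u z.2) + k.+1%:R^-1)) (fun=> 0)
    (ndiff s phi) (fun k => measurable_damp2 (d0 k) l0 lu) _ (measurable_cst (0 : R)) _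
    (test_sqint_ndiff oOm n2 s0 s1 tphi.1)).
  by move=> k x _; apply: bd; rewrite le_max l0.
apply: filterS2 (ae_prod_fst mu limit_gt0) (ae_prod_snd mu limit_gt0) => -[x y] /= ux uy [_ nO].
apply: cd; rewrite lt_max; have [/ux->//|Ox] := pselect (Om x).
by have [/uy->|Oy] := pselect (Om y); [rewrite orbT|case: nO].
Qed.

(** Let [d] tend to 0 in [upper_delta], which removes [damped], and then [l]. *)
Lemma upper_inequality phi : nonneg_test Om phi ->
  energy_form s Om g (pderiv^~ phi) u phi <= \int[mu]_(x in Om) (u x `^ (p - 1) * phi x).
Proof.
move=> tphi; have [B B0 uB] := energy_bounded.
have [M M0 phiM] := test_bounded tphi.1.
have phiM' x : phi x <= M by rewrite (le_trans (ler_norm _)).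
have iup := limit_power_integrable tphi.
have step (l : R) : 0 < l -> energy_form s Om g (pderiv^~ phi) u phi <=
    \int[mu]_(x in Om) (u x `^ (p - 1) * phi x) + l / 2 * B.
  move=> l0.
  have C : \int[mu]_(x in Om) (u x `^ (p - 1) * phi x) + l / 2 * B
      + (2 * l)^-1 * damped phi k.+1%:R^-1 u @[k --> \oo] -->
      \int[mu]_(x in Om) (u x `^ (p - 1) * phi x) + l / 2 * B.
    rewrite -[X in _ --> X]addr0 -(mulr0 (2 * l)^-1); apply: cvgD; first exact: cvg_cst.
    by apply: cvgM; [exact: cvg_cst|exact: damped_vanishes].
  apply: (ler_cvg_to (cvg_cst _) C); apply: nearW => k.
  have d0 : 0 < k.+1%:R^-1 :> R by rewrite invr_gt0.
  have H := upper_delta tphi phiM' d0 l0 uB.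
  apply: (le_trans H); rewrite 2!lerD2r.
  apply: le_Rintegral => //.
    exact: (pow_trunc_integrable tphi d0 (limit_ge0 u_test) (limit_measurable u_test)).
  move=> x _; apply: ler_wpM2r; first exact: tphi.2.
  have ux := limit_ge0 u_test x; have ud := ltr_wpDl ux d0.
  rewrite ler_pdivrMr// -(mulr_powRB1 ux p0) mulrC ler_wpM2l ?powR_ge0//.
  by rewrite lerDl ltW.
apply/ler_addgt0Pr => e e0; have B1 : 0 < B + 1 by rewrite ltr_wpDl.
(* With this [l] the remaining term [l B / 2] is at most [e]. *)
have l0 : 0 < 2 * e / (B + 1) by rewrite divr_gt0// mulr_gt0.
apply: (le_trans (step _ l0)); rewrite lerD2l.
rewrite [leLHS](_ : _ = e * (B / (B + 1))); last by field; rewrite gt_eqF.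
by rewrite ler_piMr ?(ltW e0)// ler_pdivrMr// mul1r lerDl.
Qed.

Lemma energy_form_lin (h h' : 'I_n -> 'rV[R]_n -> R) v v' (t : R) :
  (forall i, sqint mu Om (h i)) -> (forall i, sqint mu Om (h' i)) ->
  sqint mu2 (Qset Om) (ndiff s v) -> sqint mu2 (Qset Om) (ndiff s v') ->
  energy_form s Om g (fun i x => h i x + t * h' i x) u (fun x => v x + t * v' x)
  = energy_form s Om g h u v + t * energy_form s Om g h' u v'.
Proof.
move=> sh sh' sv sv'; rewrite /energy_form ndiff_lin.
have L d' (T : measurableType d') (m' : {measure set T -> \bar R}) (D : set T) (a b e : T -> R) :
    measurable D -> sqint m' D a -> sqint m' D b -> sqint m' D e ->
    ip m' D a (fun x => b x + t * e x) = ip m' D a b + t * ip m' D a e.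
  move=> mD sa sb se; rewrite ipC (ipDl mD sb (sqintZ mD t se) sa) (ipZl mD t se sa).
  by rewrite ipC [ip _ _ e a]ipC.
have su := limit_ndiff_sqint oOm n2 s0 s1 c0 cP u_test u_cauchy.
have sg i : sqint mu Om (g i) := limit_grad_sqint oOm u_test u_cauchy i.
rewrite (L _ _ _ _ _ _ _ mQ su sv sv').
rewrite [X in X + _ = _](_ : _ = \sum_i ip mu Om (g i) (h i) + t * \sum_i ip mu Om (g i) (h' i)).
  ring.
rewrite mulr_sumr -big_split; apply: eq_bigr => i _.
exact: (L _ _ _ _ _ _ _ mO (sg i) (sh i) (sh' i)).
Qed.

(** The two inequalities give the equation for nonnegative test functions; a signed one is
    the difference [chi - (chi - phi)] for a dominating [chi]. *)
Lemma euler_lagrange phi : test_function Om phi ->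
  mu.-integrable Om (EFin \o (fun x => u x `^ (p - 1) * phi x)) /\
  energy_form s Om g (pderiv^~ phi) u phi = \int[mu]_(x in Om) (u x `^ (p - 1) * phi x).
Proof.
move=> tphi; have [chi nchi chiP] := test_dominated oOm tphi.
have EL w : nonneg_test Om w ->
    energy_form s Om g (pderiv^~ w) u w = \int[mu]_(x in Om) (u x `^ (p - 1) * w x).
  by move=> nw; apply/le_anti; rewrite upper_inequality// lower_inequality.
pose psi x := chi x + -1 * phi x.
have npsi : nonneg_test Om psi.
  split; first exact: test_lin nchi.1 tphi.
  by move=> x; rewrite /psi mulN1r subr_ge0 (le_trans (ler_norm _)).
have phiE : phi = fun x => chi x + -1 * psi x.
  by apply/funext => x; rewrite /psi; ring.
have i1 := limit_power_integrable nchi; have i2 := limit_power_integrable npsi.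
have iE : (fun x => u x `^ (p - 1) * phi x) =
    (fun x => u x `^ (p - 1) * chi x - u x `^ (p - 1) * psi x).
  by apply/funext => x; rewrite phiE; ring.
rewrite iE; split; first exact: (integrableB mO i1 i2).
rewrite RintegralB// -!EL// {1 2}phiE.
have -> : pderiv^~ (fun x => chi x + -1 * psi x) =
    fun i x => pderiv i chi x + -1 * pderiv i psi x.
  by apply/funext => i; apply: pderiv_lin; [exact: test_smooth nchi.1|exact: test_smooth npsi.1].
rewrite energy_form_lin ?mulN1r//.
- by move=> i; exact: test_sqint_pderiv nchi.1.
- by move=> i; exact: test_sqint_pderiv npsi.1.
- exact: test_sqint_ndiff nchi.1.
- exact: test_sqint_ndiff npsi.1.
Qed.

End euler_lagrange.

(** * The limit as a weak solution *)

Section finite_ae.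
Context d (T : measurableType d) (R : realType) (m : {measure set T -> \bar R}).

Lemma ae_forall_fin (I : finType) (P : I -> T -> Prop) :
  (forall i, {ae m, forall x, P i x}) -> {ae m, forall x, forall i, P i x}.
Proof.
move=> H; have : {ae m, forall x, forall i : I, i \in enum I -> P i x}.
  elim: (enum I) => [|j l IH]; first by apply: aeW => x i.
  by apply: filterS2 IH (H j) => x IHx Pj i; rewrite inE => /predU1P[->//|/IHx].
by apply: filterS => x Px i; apply: Px; rewrite mem_enum.
Qed.

End finite_ae.

Section sobolev_limit.
Context {R : realType} {n : nat}.
Local Notation mu := (lebesgue_rV R n).
Local Notation mu2 := ((lebesgue_rV R n) \x (lebesgue_rV R n))%E.
Implicit Types (V U Om : set 'rV[R]_n) (u v w : 'rV[R]_n -> R).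

Lemma integral_supported Om U (f : 'rV[R]_n -> \bar R) : Om `<=` U ->
  (forall x, ~ Om x -> f x = 0%E) -> (\int[mu]_(x in U) f x = \int[mu]_(x in Om) f x)%E.
Proof.
move=> OU f0; rewrite [LHS]integral_mkcond [RHS]integral_mkcond.
apply: eq_integral => x _; rewrite !patchE.
have [Ox|nO] := pselect (Om x).
  by rewrite (mem_set Ox) (mem_set (OU _ Ox)).
by rewrite f0//; do 2 case: ifP.
Qed.

Lemma sqint_supported Om U u : Om `<=` U -> measurable_fun setT u ->
  (forall x, ~ Om x -> u x = 0) -> sqint mu Om u -> sqint mu U u.
Proof.
move=> OU mu_ u0 [_ uoo]; split; first exact: measurable_funTS.
by rewrite (integral_supported OU)// => x nO; rewrite u0// expr0n.
Qed.

Lemma weak_pderivB i u v g h : sqint mu setT u -> sqint mu setT v ->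
  sqint mu setT g -> sqint mu setT h ->
  is_weak_pderiv setT i u g -> is_weak_pderiv setT i v h ->
  is_weak_pderiv setT i (u \- v) (fun x => g x - h x).
Proof.
move=> su sv sg sh ug vh phi tphi.
have sp : sqint mu setT phi by exact: (test_sqint measurableT tphi).
have sdp : sqint mu setT (pderiv i phi) by exact: (test_sqint measurableT (test_pderiv i tphi)).
have := ug _ tphi; have := vh _ tphi.
rewrite !ip_EFin_mul//; [|exact: sqintB|exact: sqintB].
rewrite -!EFinN => -[e1] [e2]; congr EFin.
have L a b e : sqint mu setT a -> sqint mu setT b -> sqint mu setT e ->
    ip mu setT (fun x => a x - b x) e = ip mu setT a e - ip mu setT b e.
  move=> sa sb se; rewrite ipDl//; last exact: sqintN.
  rewrite (_ : (fun x => - b x) = (fun x => -1 * b x)) ?ipZl ?mulN1r//.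
  by apply/funext => x; rewrite mulN1r.
by rewrite (L g h phi)// [LHS](L u v (pderiv i phi))// e1 e2; ring.
Qed.

Lemma integral_sum_mul (I : Type) (l : seq I) (f h : I -> 'rV[R]_n -> R) (D : set 'rV[R]_n) :
  measurable D -> (forall i, sqint mu D (f i)) -> (forall i, sqint mu D (h i)) ->
  mu.-integrable D (EFin \o (fun x => \sum_(i <- l) f i x * h i x)) /\
  \int[mu]_(x in D) (\sum_(i <- l) f i x * h i x) = \sum_(i <- l) ip mu D (f i) (h i).
Proof.
move=> mD sf sh; elim: l => [|i l [IH1 IH2]].
  rewrite big_nil (_ : (fun x => _) = fun=> 0); last by apply/funext => x; rewrite big_nil.
  split; first exact: integrable0.
  by rewrite /Rintegral integral0.
have ifh := sqint_mul_integrable mD (sf i) (sh i).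
rewrite (_ : (fun x => _) = (fun x => f i x * h i x + \sum_(j <- l) f j x * h j x)); last first.
  by apply/funext => x; rewrite big_cons.
split; first exact: (integrableD mD ifh IH1).
by rewrite big_cons RintegralD// IH2.
Qed.

(** [weak_pderiv] picks arbitrary representatives, which agree a.e. with the given weak
    gradients by uniqueness. *)
Lemma energyE (s : R) Om u v (g h : 'I_n -> 'rV[R]_n -> R) :
  0 < s -> measurable Om -> measurable (Qset Om) ->
  (forall i, sqint mu setT (g i)) -> (forall i, sqint mu setT (h i)) ->
  (forall i, is_weak_pderiv setT i u (g i)) -> (forall i, is_weak_pderiv setT i v (h i)) ->
  sqint mu2 (Qset Om) (ndiff s u) -> sqint mu2 (Qset Om) (ndiff s v) ->
  energy s Om u v = (energy_form s Om g h u v)%:E.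
Proof.
move=> s0 mO mQ sg sh ug vh su sv.
have W w f i : sqint mu setT f -> is_weak_pderiv setT i w f ->
    {ae mu, forall x, weak_pderiv setT i w x = f x} /\ measurable_fun Om (weak_pderiv setT i w).
  move=> sf wf; have aT : {ae mu, forall x, setT x -> setT x} by apply: aeW.
  have [H1 [H2 _]] := @weak_pderivE R n setT setT i w f measurableT openT (@subsetT _ _) aT sf wf.
  split; first by apply: filterS H1 => x; exact.
  exact: measurable_funTS.
rewrite /energy nonlocal_energyE// (ip_EFin_mul mQ su sv) /energy_form EFinD; congr (_ + _)%E.
have sgO i : sqint mu Om (g i) by exact: (sqintS measurableT mO).
have shO i : sqint mu Om (h i) by exact: (sqintS measurableT mO).
have [i1 <-] := integral_sum_mul (index_enum 'I_n) mO sgO shO.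
rewrite /Rintegral fineK; last exact: integrable_fin_num.
apply: ae_eq_integral => //.
- apply/measurable_EFinP; apply: measurable_sum => i.
  by apply: measurable_funM; [exact: (W _ _ _ (sg i) (ug i)).2|exact: (W _ _ _ (sh i) (vh i)).2].
- exact: measurable_int i1.
have : {ae mu, forall x, forall i, weak_pderiv setT i u x = g i x /\ weak_pderiv setT i v x = h i x}.
  by apply: ae_forall_fin => i; apply: filterS2 (W _ _ _ (sg i) (ug i)).1 (W _ _ _ (sh i) (vh i)).1.
by apply: filterS => x H _; congr EFin; apply: eq_bigr => i _; rewrite (H i).1 (H i).2.
Qed.

End sobolev_limit.

Section existence.
Context {R : realType} {n : nat}.
Local Notation mu := (lebesgue_rV R n).
Local Notation mu2 := ((lebesgue_rV R n) \x (lebesgue_rV R n))%E.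
Variables (s q : R) (Om Nn : set 'rV[R]_n).
Hypotheses (n2 : (2 <= n)%N) (s0 : 0 < s) (s1 : s < 1) (q0 : 0 < q) (q1 : q < 1).
Hypotheses (oOm : open Om) (oNn : open Nn) (bON : bounded_set (Om `|` Nn)).
Hypothesis sON : smooth_boundary (Om `|` Nn).

Let mO := Om_measurable oOm.
Let mQ := Qset_measurable oOm.
Let U := mixed_domain Om Nn.
Let mU : measurable U := mixed_domain_measurable oOm oNn.

Section limit_in_space.
Variables (c : R) (c0 : 0 < c).
Hypothesis cP : forall phi, test_function Om phi ->
  c * ip mu Om phi phi <= ip mu2 (Qset Om) (ndiff s phi) (ndiff s phi).
Variable u_ : nat -> 'rV[R]_n -> R.
Hypothesis u_test : forall k, nonneg_test Om (u_ k).
Hypothesis u_cauchy : forall j k,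
  test_energy s Om (fun x => u_ j x + -1 * u_ k x) (fun x => u_ j x + -1 * u_ k x)
  <= 4 * (4^-1 ^+ j + 4^-1 ^+ k).

Local Notation u := (limsup_fun u_).
Local Notation g := (limit_grad u_).

Let tu k : test_function Om (u_ k). Proof. exact: (u_test k).1. Qed.

Let su V : Om `<=` V -> sqint mu V u.
Proof.
move=> OV; apply: (sqint_supported OV (limit_measurable u_test)).
  exact: limit_off u_test.
exact: (limit_sqint oOm c0 cP u_test u_cauchy).
Qed.

Let sg V i : Om `<=` V -> sqint mu V (g i).
Proof.
move=> OV; apply: (sqint_supported OV (limit_grad_measurable u_test i)).
  exact: limit_grad_off u_test i.
exact: (limit_grad_sqint oOm u_test u_cauchy).
Qed.

(** Integrate the approximants by parts and pass to the limit in both inner products. *)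
Lemma limit_weak_pderiv i : is_weak_pderiv setT i u (g i).
Proof.
move=> phi tphi; have tdphi := test_pderiv i tphi.
have sp := test_sqint mO tphi; have sdp := test_sqint mO tdphi.
have H k : ip mu Om (u_ k) (pderiv i phi) = - ip mu Om (pderiv i (u_ k)) phi.
  have := @test_weak_pderiv _ _ _ i _ (tu k) _ tphi.
  rewrite (integral_supported (@subsetT _ Om)); last first.
    by move=> x nO; rewrite (test_eq0 (tu k) nO) mul0r.
  rewrite [in RHS](integral_supported (@subsetT _ Om)); last first.
    by move=> x nO; rewrite (test_eq0 (test_pderiv i (tu k)) nO) mul0r.
  rewrite (ip_EFin_mul mO (test_sqint mO (tu k)) sdp).
  by rewrite (ip_EFin_mul mO (test_sqint mO (test_pderiv i (tu k))) sp) -EFinN => -[].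
rewrite (integral_supported (@subsetT _ Om)); last first.
  by move=> x nO; rewrite (limit_off u_test nO) mul0r.
rewrite [in RHS](integral_supported (@subsetT _ Om)); last first.
  by move=> x nO; rewrite (limit_grad_off u_test i nO) mul0r.
rewrite (ip_EFin_mul mO (su (@subset_refl _ _)) sdp).
rewrite (ip_EFin_mul mO (sg i (@subset_refl _ _)) sp) -EFinN; congr EFin.
have C1 := ip_cvg mO (fun k => test_sqint mO (tu k)) (su (@subset_refl _ _)) sdp
  (limit_dist oOm c0 cP u_test u_cauchy) (geo4_cvg0 _).
have C2 := ip_cvg mO (fun k => test_sqint mO (test_pderiv i (tu k))) (sg i (@subset_refl _ _)) sp
  (limit_grad_dist oOm u_test u_cauchy i) (geo4_cvg0 _).
have {}C1 : - ip mu Om (pderiv i (u_ k)) phi @[k --> \oo] --> ip mu Om u (pderiv i phi).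
  by rewrite (_ : (fun k => _) = (fun k => ip mu Om (u_ k) (pderiv i phi)))//; apply/funext => k; rewrite H.
exact: (cvg_unique _ C1 (cvgN C2)).
Qed.

(** The weak gradient on [U] of the difference is again identified through uniqueness, and
    everything vanishes off [Om]. *)
Lemma limit_H1_dist k :
  (H1_normsq U (u \- u_ k)%R <= ((4 / c + n%:R * 4) * 4^-1 ^+ k)%:E)%E.
Proof.
have OU : Om `<=` U := @Om_sub_mixed _ _ Om Nn.
have suT := su (@subsetT _ Om); have sgT i := sg i (@subsetT _ Om).
have sukT : sqint mu setT (u_ k) by exact: (test_sqint measurableT (tu k)).
have sdukT i : sqint mu setT (pderiv i (u_ k)).
  exact: (test_sqint measurableT (test_pderiv i (tu k))).
have wd i := weak_pderivB suT sukT (sgT i) (sdukT i) (limit_weak_pderiv i)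
  (@test_weak_pderiv _ _ _ i _ (tu k)).
have W i := weak_pderivE mU (openU oOm oNn) (@subsetUl _ _ _)
  (mixed_domain_ae sON) (sqintS measurableT mU (@subsetT _ _) (sqintB measurableT (sgT i) (sdukT i)))
  (is_weak_pderiv_restrict (wd i)).
pose v x := u x - u_ k x; pose h i x := g i x - pderiv i (u_ k) x.
have sv : sqint mu Om v := sqintB mO (su (@subset_refl _ _)) (test_sqint mO (tu k)).
have sh i : sqint mu Om (h i) :=
  sqintB mO (sg i (@subset_refl _ _)) (test_sqint mO (test_pderiv i (tu k))).
have svU : sqint mu U v := sqintB mU (su OU) (test_sqint mU (tu k)).
have shU i : sqint mu U (h i) := sqintB mU (sg i OU) (test_sqint mU (test_pderiv i (tu k))).
have sq0 (b : R) (e : 'I_n -> R) : (0 <= (b ^+ 2 + \sum_i e i ^+ 2)%:E)%E.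
  by rewrite lee_fin addr_ge0 ?sqr_ge0//; apply: sumr_ge0 => i _; exact: sqr_ge0.
have -> : H1_normsq U (u \- u_ k) = (\int[mu]_(x in U) (v x ^+ 2 + \sum_i h i x ^+ 2)%:E)%E.
  rewrite /H1_normsq; apply: ge0_ae_eq_integral => //.
  - apply/measurable_EFinP; apply: measurable_funD; first by apply: measurable_funX; exact: svU.1.
    by apply: measurable_sum => i; apply: measurable_funX; exact: (W i).2.1.
  - apply/measurable_EFinP; apply: measurable_funD; first by apply: measurable_funX; exact: svU.1.
    by apply: measurable_sum => i; apply: measurable_funX; exact: (shU i).1.
  have : {ae mu, forall x, forall i, U x -> weak_pderiv U i (u \- u_ k) x = h i x}.
    exact: (ae_forall_fin (fun i => (W i).1)).
  by apply: filterS => x H Ux; congr EFin; congr (_ + _); apply: eq_bigr => i _; rewrite H.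
rewrite (integral_supported OU); last first.
  move=> x nO; rewrite /v /h (limit_off u_test nO) (test_eq0 (tu k) nO) subrr expr0n add0r.
  congr EFin; apply: big1 => i _.
  by rewrite (limit_grad_off u_test i nO) (test_eq0 (test_pderiv i (tu k)) nO) subrr expr0n.
have [i1 E1] := integral_sum_mul (index_enum 'I_n) mO sh sh.
have i0 := sqint_mul_integrable mO sv sv.
have -> : (\int[mu]_(x in Om) (v x ^+ 2 + \sum_i h i x ^+ 2)%:E =
   (ip mu Om v v + \sum_i ip mu Om (h i) (h i))%:E)%E.
  rewrite -E1 /ip -RintegralD// /Rintegral fineK; last first.
    exact: (integrable_fin_num mO (integrableD mO i0 i1)).
  by apply: eq_integral => x _; rewrite expr2; under eq_bigr do rewrite expr2.
rewrite lee_fin mulrDl; apply: lerD; first exact: (limit_dist oOm c0 cP u_test u_cauchy k).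
apply: (@le_trans _ _ (\sum_(i < n) 4 * 4^-1 ^+ k)).
  by apply: ler_sum => i _; exact: (limit_grad_dist oOm u_test u_cauchy i k).
by rewrite sumr_const card_ord -[_ *+ n]mulr_natl mulrA.
Qed.

(** The approximants are test functions of [Om], hence of [U], so that they also witness
    the membership in [H10]. *)
Lemma limit_X12 : X12 U u.
Proof.
have OU : Om `<=` U := @Om_sub_mixed _ _ Om Nn.
split.
- split; first exact: su (@subsetT _ Om).
  by move=> i; exists (g i); [exact: sg (@subsetT _ Om)|exact: limit_weak_pderiv].
- split.
    split; first exact: su.
    move=> i; exists (g i); first exact: sg.
    exact/is_weak_pderiv_restrict/limit_weak_pderiv.
  exists u_; first by move=> k; exact: test_sub OU (tu k).
  apply: (@squeeze_cvge _ _ _ _ (fun=> 0%E) _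
    (fun k => ((4 / c + n%:R * 4) * 4^-1 ^+ k)%:E)).
  + apply: nearW => k; rewrite limit_H1_dist andbT; apply: integral_ge0 => x _.
    by rewrite lee_fin addr_ge0 ?sqr_ge0//; apply: sumr_ge0 => i _; exact: sqr_ge0.
  + exact: cvg_cst.
  + by apply: cvg_EFin; [exact: nearW|exact: geo4_cvg0].
- by apply: aeW => x nU; apply: (limit_off u_test) => /OU.
Qed.

End limit_in_space.

Lemma weak_solution_exists : exists u, weak_solution s q Om Nn u.
Proof.
have Ofin := Om_finite oOm bON.
have n0 : (0 < n)%N by exact: leq_trans n2.
have [c c0 cP'] := nonlocal_poincare oOm bON n0 s0.
have cP phi : test_function Om phi ->
    c * ip mu Om phi phi <= ip mu2 (Qset Om) (ndiff s phi) (ndiff s phi).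
  move=> tphi; have := cP' phi (test_measurable tphi).
  rewrite (ip_EFin mO (test_sqint mO tphi)).
  rewrite (ip_EFin mQ (test_sqint_ndiff oOm n2 s0 s1 tphi)) -EFinM lee_fin; apply.
  apply: aeW => x nU; apply: (test_eq0 tphi) => Ox; apply: nU; exact: Om_sub_mixed.
have p0 : 0 < 1 - q by rewrite subr_gt0.
have p1 : 1 - q < 1 by rewrite gtrBl.
have [m [u_ [mJ u_test uJ]]] := minimizing_sequence oOm Ofin p0 p1 c0 cP.
have uC := minimizing_cauchy oOm Ofin n2 s0 s1 p0 p1 mJ u_test uJ.
have uX := limit_X12 c0 cP u_test uC.
exists (limsup_fun u_); split; first exact: uX.
  exact: (limit_gt0 oOm Ofin n2 s0 s1 p0 p1 c0 cP mJ u_test uJ).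
move=> phi tphi.
have [iphi E] := euler_lagrange oOm Ofin n2 s0 s1 p0 p1 c0 cP mJ u_test uJ tphi.
have qE : 1 - q - 1 = - q by ring.
rewrite qE in iphi E; split; first exact: iphi.
rewrite (energyE (g := limit_grad u_) (h := pderiv^~ phi) s0 mO mQ).
- by rewrite E /Rintegral fineK//; exact: integrable_fin_num.
- move=> i; apply: (sqint_supported (@subsetT _ Om) (limit_grad_measurable u_test i)).
    exact: limit_grad_off u_test i.
  exact: (limit_grad_sqint oOm u_test uC).
- by move=> i; exact: (test_sqint measurableT (test_pderiv i tphi)).
- by move=> i; exact: (limit_weak_pderiv c0 cP u_test uC).
- by move=> i; exact: test_weak_pderiv tphi.
- exact: (limit_ndiff_sqint oOm n2 s0 s1 c0 cP u_test uC).
- exact: (test_sqint_ndiff oOm n2 s0 s1 tphi).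
Qed.

End existence.

Theorem theorem2p4 (R : realType) (N : nat) (s q : R) (Omega D Nn : set 'rV[R]_N)
  (hN : (3 <= N)%N) (hs0 : 0 < s) (hs1 : s < 1) (hq0 : 0 < q) (hq1 : q < 1)
  (Omega_open : open Omega) (Omega_neq0 : Omega !=set0)
  (D_open : open D) (Nn_open : open Nn)
  (DNn_disj : D `&` Nn = set0) (DNn_cover : D `|` Nn = ~` closure Omega)
  (bounded : bounded_set (Omega `|` Nn))
  (smooth_bd : smooth_boundary (Omega `|` Nn)) :
  mixed_sobolev s q Omega Nn <-> exists u, weak_solution s q Omega Nn u.
Proof.
have N2 : (2 <= N)%N := ltnW hN.
split => _; first exact: weak_solution_exists.
by apply: mixed_sobolev_holds => //; exact: ltnW.
Qed.
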